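(* Let $T:X\to X$ be a conservative, ergodic, measure-preserving transformation of the measure space $(X,\mathcal{B},\mu)$ with $\mu$ a $\sigma$-finite measure with $\mu(X)=\infty$, and let $E\in\mathcal{B}$ with $\mu(E)=1$ be a set which induces rapid $\psi$-mixing. Let $g:X\to\mathbb{R}_{\ge 0}$ be a measurable observable. Assume that: (i) $\displaystyle\sum_{n\ge 1}\frac{n\,(\mu(A_{>n}))^2}{w_n(E)^2}<\infty$ and $w_n(E)$ is slowly varying; (ii) there exists a constant $\kappa>0$ such that $\mu(g>n)\sim\kappa\,\mu(A_{>n})$ as $n\to\infty$; (iii) $g$ is locally constant on the partition $\mathcal{P}_E$ of $E$ (i.e. constant on each element of $\mathcal{P}_E$), and $g\notin L^1(E,\mu)$; (iv) there exists $c\in\mathbb{R}$ such that $g\equiv c$ on $X\setminus E$. Then, for $\mu$-a.e. $x\in X$, $$\lim_{N\to\infty}\frac{S_{N+m(N,E,x)}g(x)-\max_{1\le k\le N+m(N,E,x)}(g\circ T^{k-1})(x)-c\,m(N,E,x)}{N}=c+\kappa,$$ and for $\mu$-a.e. $x\in X$, $$\limsup_{N\to\infty}\frac{\max_{1\le k\le N+m(N,E,x)}(g\circ T^{k-1})(x)}{N}=\limsup_{N\to\infty}\frac{m(N,E,x)}{N}=\infty.$$ If, additionally to (i)-(iv), one has $$\mu\left(\{g>N\}\cap\{\varphi_E>M\}\right)\asymp\mu(g>N)\,\mu(\varphi_E>M)\qquad (M,N\in\mathbb{N}),$$ then for $\mu$-a.e. $x\in X$ $$\lim_{N\to\infty}\frac{S_{N+m(N,E,x)}g(x)-\max\left\{\max_{1\le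 k\le N+m(N,E,x)}(g\circ T^{k-1})(x),\;c\,m(N,E,x)\right\}}{N}=c+\kappa.$$
   Context: $\mathbb{N}=\{1,2,\dots\}$. For a measurable $g:X\to\mathbb{R}$, $S_Ng(x)=\sum_{n=1}^N (g\circ T^{n-1})(x)$ is the Birkhoff sum. First return: $\varphi_E:E\to\mathbb{N}$, $\varphi_E(x)=\inf\{k\ge 1: T^k(x)\in E\}$ ($\mu$-a.e. finite). Level sets: $A_n=\{x\in E:\varphi_E(x)=n\}$, and $A_{>n}=\{x\in E:\varphi_E(x)>n\}$. Wandering rate: $w_n(E)=\sum_{k=0}^{n-1}\mu(A_{>k})$. Induced map: $T_E:E\to E$, $T_E(x)=T^{\varphi_E(x)}(x)$, an ergodic measure-preserving transformation of the probability space $(E,\mathcal{B}|_E,\mu)$. A function $f:\mathbb{N}\to\mathbb{R}$ is slowly varying if $\lim_{N\to\infty}f(\lfloor dN\rfloor)/f(N)=1$ for all $d>0$. Longest excursion out of $E$ beginning in the first $N$ steps (defined for $\mu$-a.e. $x$): $$m(N,E,x)=1+\max\{k\ge 1:\exists\,\ell\in\{1,\dots,N+1\}\text{ s.t. }T^{\ell+j}(x)\notin E,\ \forall j=0,\dots,k-1\}.$$ $\psi$-mixing: for a sequence $(Y_n)$ of random variables on a probability space $(\Omega,\mathbb{P})$ let $\mathcal{F}_h^k$ be the $\sigma$-field generated by $(Y_n)_{h\le n\le k}$, $0\le h<k\le\infty$. The sequence is $\psi$-mixing if $$\psi(n)=\sup\left\{\left|\frac{\mathbb{P}(B\cap C)}{\mathbb{P}(B)\mathbb{P}(C)}-1\right|: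 B\in\mathcal{F}_0^j,\ C\in\mathcal{F}_{j+n}^\infty,\ \mathbb{P}(B)>0,\ \mathbb{P}(C)>0,\ j\in\mathbb{N}\right\}$$ tends to $0$ as $n\to\infty$. Rapid $\psi$-mixing: $\mathcal{P}_E$ denotes the partition of $E$ induced by $T_E$, i.e. the finest partition such that each element $P\in\mathcal{P}_E$ satisfies $T_E(P)=E$ a.s. A set $E\in\mathcal{B}$ with $\mu(E)=1$ and with $T_E(A_n)=E$ a.s. for all $n\in\mathbb{N}$ induces rapid $\psi$-mixing if for any sequence $(\phi_n)_{n\in\mathbb{N}}$ of functions from $E$ to $\mathbb{R}$, each piecewise constant on $\mathcal{P}_E$, the sequence $(\phi_n\circ T_E^{n-1})_{n\ge 1}$ is $\psi$-mixing (with respect to $\mu$ on $E$) with coefficient satisfying $\sum_{n\ge 1}\psi(n)/n<\infty$. Notation: $a_N\sim b_N$ means $\lim_{N\to\infty} a_N/b_N=1$. For double sequences, $a_{N,M}\asymp b_Nc_M$ means that there exist constants $C>0$ and $N_0$ such that $C^{-1}a_{N,M}\le b_Nc_M\le C\,a_{N,M}$ for all $M,N\ge N_0$. $\mu(g>n)$ denotes $\mu(\{x\in X: g(x)>n\})$. *)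

(* Defs.v *)
From HB Require Import structures.
From mathcomp Require Import all_boot all_order all_algebra.
From mathcomp Require Import all_classical all_reals all_analysis.
Set Implicit Arguments.
Unset Strict Implicit.
Unset Printing Implicit Defensive.
Import Order.TTheory GRing.Theory Num.Theory.
Import numFieldNormedType.Exports.
Local Open Scope classical_set_scope.
Local Open Scope ring_scope.

Section MeasurePreserving.
Context d (X : measurableType d) (R : realType).
Variables (mu : {measure set X -> \bar R}) (T : X -> X).

Definition measure_preserving : Prop :=
  measurable_fun setT T /\
  forall A : set X, measurable A -> mu (T @^-1` A) = mu A.

Definition ergodic : Prop :=
  forall A : set X, measurable A -> T @^-1` A = A ->
    mu A = 0%E \/ mu (~` A) = 0%E.

Definition conservative : Prop :=
  forall W : set X, measurable W ->
    trivIset setT (fun n : nat => iter n T @^-1` W) -> mu W = 0%E.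

End MeasurePreserving.

Section BirkhoffSums.
Context (X : Type) (R : realType).
Variables (T : X -> X) (g : X -> R).

Definition birkhoff_sum (N : nat) (x : X) : R :=
  \sum_(1 <= n < N.+1) g (iter n.-1 T x).

(* The maximum over 1 <= k <= N, for N >= 1: the default value g x of the big
   operator is its own k = 1 term. *)
Definition birkhoff_max (N : nat) (x : X) : R :=
  \big[Num.max/g x]_(1 <= k < N.+1) g (iter k.-1 T x).

End BirkhoffSums.

Section FirstReturn.
Context d (X : measurableType d) (R : realType).
Variables (mu : {measure set X -> \bar R}) (T : X -> X) (E : set X).

(* The infimum of the empty set is +oo. *)
Definition first_return (x : X) : \bar R :=
  ereal_inf [set (k%:R)%:E | k in [set k : nat | (1 <= k)%N /\ E (iter k T x)]].

Definition return_eq (n : nat) : set X :=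
  [set x | E x /\ first_return x = (n%:R)%:E].

Definition return_gt (n : nat) : set X :=
  [set x | E x /\ ((n%:R)%:E < first_return x)%E].

Definition wandering_rate (n : nat) : R :=
  \sum_(0 <= k < n) fine (mu (return_gt k)).

(* On the points of E that never return this is the identity, as
   [fine +oo = 0]; it maps E to E. *)
Definition induced_map (x : X) : X :=
  iter (Num.truncn (fine (first_return x))) T x.

(* A set of natural numbers without a maximum gets the value 0. *)
Definition max_nat (A : set nat) : nat := xget 0%N (A `&` ubound A).

Definition longest_excursion (N : nat) (x : X) : nat :=
  (1 + max_nat [set k | (1 <= k)%N /\
     exists l : nat, [/\ (1 <= l)%N, (l <= N.+1)%N &
       forall j : nat, (j < k)%N -> ~ E (iter (l + j) T x)]])%N.

End FirstReturn.

Definition slowly_varying (R : realType) (f : nat -> R) : Prop :=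
  forall d : R, 0 < d ->
    f (Num.truncn (d * N%:R)) / f N @[N --> \oo] --> (1 : R).

Definition asymp_equiv (R : realType) (a b : nat -> R) : Prop :=
  a N / b N @[N --> \oo] --> (1 : R).

Definition double_asymp (R : realType) (a : nat -> nat -> R) (b c : nat -> R)
    : Prop :=
  exists (C : R) (N0 : nat), 0 < C /\
    forall N M : nat, (N0 <= N)%N -> (N0 <= M)%N ->
      C^-1 * a N M <= b N * c M /\ b N * c M <= C * a N M.

Section PsiMixing.
Context d (X : measurableType d) (R : realType).
Variables (mu : {measure set X -> \bar R}) (D : set X).

Definition sigma_field (Y : nat -> X -> R) (I : set nat) : set (set X) :=
  <<s D, \bigcup_(n in I) preimage_set_system D (Y n) measurable >>.

(* Here (D, mu) is a probability space; the sequence is (Y n)_{n >= 1}, and the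
   value Y 0 is not used. *)
Definition psi_coef (Y : nat -> X -> R) (n : nat) : \bar R :=
  ereal_sup [set z | exists (j : nat) (B C : set X),
    [/\ (1 <= j)%N,
        sigma_field Y [set k | (1 <= k <= j)%N] B,
        sigma_field Y [set k | (j + n <= k)%N] C,
        (0 < mu B)%E /\ (0 < mu C)%E &
        z = `|fine (mu (B `&` C)) / (fine (mu B) * fine (mu C)) - 1|%:E]].

Definition psi_mixing (Y : nat -> X -> R) : Prop :=
  psi_coef Y n @[n --> \oo] --> 0%E.

End PsiMixing.

Section RapidMixing.
Context d (X : measurableType d) (R : realType).
Variables (mu : {measure set X -> \bar R}) (T : X -> X) (E : set X).

Let TE : X -> X := induced_map R T E.

Definition full_image (A : set X) : Prop :=
  mu.-negligible (E `\` (TE @` A)).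

Definition full_image_partition (P : set (set X)) : Prop :=
  [/\ countable P,
      forall A, P A -> measurable A,
      partition P id E &
      forall A, P A -> full_image A].

Definition finer (Q P : set (set X)) : Prop :=
  forall B, Q B -> exists2 A, P A & mu.-negligible (B `\` A).

Definition level_sets : set (set X) :=
  [set return_eq R T E n | n in [set n : nat | (1 <= n)%N]].

(* "The finest partition" all of whose elements have full image.  A least
   element for refinement does not exist as soon as the induced map is not
   invertible (for the doubling map every partition {A, B} where B is the
   translate of A by 1/2 qualifies), so "finest" means that no such partition
   is strictly finer.  When every level set has full image, the level sets
   form a partition of this kind, which the finest one has to refine. *)
Definition finest_full_image_partition (P : set (set X)) : Prop :=
  [/\ full_image_partition P,
      finer P level_sets &
      forall Q, full_image_partition Q -> finer Q P -> finer P Q].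

Definition constant_on_partition (P : set (set X)) (f : X -> R) : Prop :=
  forall A, P A -> forall x y, A x -> A y -> f x = f y.

Definition rapid_psi_mixing (P : set (set X)) : Prop :=
  [/\ measurable E /\ mu E = 1%E,
      forall n : nat, (1 <= n)%N -> full_image (return_eq R T E n),
      finest_full_image_partition P &
      forall phi : nat -> X -> R,
        (forall n : nat, (1 <= n)%N -> constant_on_partition P (phi n)) ->
        let Y := fun n : nat => phi n \o iter n.-1 TE in
        psi_mixing mu E Y /\
        (\sum_(1 <= n <oo) (psi_coef mu E Y n * (n%:R^-1)%:E) < +oo)%E].

End RapidMixing.

(* Main.v *)
Require Import Defs.
From mathcomp Require Import all_boot all_order all_algebra.
From mathcomp Require Import all_classical all_reals all_analysis.
From mathcomp Require Import measurable_realfun.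
From mathcomp Require Import ring lra zify.
Import Order.TTheory GRing.Theory Num.Theory.
Import numFieldNormedType.Exports.
Local Open Scope classical_set_scope.
Local Open Scope ring_scope.
Set Implicit Arguments.
Unset Strict Implicit.
Unset Printing Implicit Defensive.

(** Cut the orbit of x at its visits to E.  Let e be the entrance time, p_0,
p_1, ... the successive return times, g_0, g_1, ... the values of g at the
visits, t_n = e + p_0 + ... + p_(n-1) the time of the n-th visit, and D_n(f)
the trimmed sum f_0 + ... + f_(n-1) - max f_i.  Since g = c off E, the Birkhoff
sum at a time s in ]t_n, t_(n+1)] is g_0 + ... + g_n + c (s - n - 1).  The role
of m(N) is explained by a deterministic fact ([excursion_sandwich]): if n is
chosen with t_n < N + m(N) <= t_(n+1), then m(N) lies between max_(i < n) p_i
and max_(i <= n) p_i, and D_n(p) <= N - e <= D_(n+1)(p).  Adding m(N) to the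
time thus turns N itself into a trimmed sum of return times.  So if, for some
deterministic sequence b with b(n+1) ~ b(n) and n = o(b(n)), almost surely
D_n(p) ~ b(n) and D_n(g) ~ kappa b(n), then N ~ b(n) and the numerator of the
first limit is D_(n+1)(g) + c (N - n - 1) up to O(n), that is
(kappa + c) N + o(N) ([trimmed_orbit_limit]).

Everything that happens at the visits is read off one sequence.  The induced
map preserves mu on E ([induced_preimage_measure]); with Z_i the number of the
atom of the partition that contains the i-th visit, p_i is a function of Z_i up
to a null set, and g_i is a function of Z_i, which can be rounded up to a
natural number at the cost of an error O(n) in the sums.  The sequence (Z_i) is
stationary and psi-mixing with sum psi(n) / n finite ([code_process_mixing]).

The trimmed law for f(Z_i) ([trimmed_ladder_summable], [trimmed_sum_ae]).  Let
tau(s) be the measure of the points of E that return after time s, and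
L(t) = tau(0) + ... + tau(t - 1) the wandering rate; b(n) is the largest t with
t / L(t) <= n.  Along a ladder of levels t_k = j 16^k and of times
n_k = floor (t_k / L(t_k)) the deviations of D_(n_k)(f) from kappa t_k have
summable probabilities.  This uses two cuts, at a lower level t_(k-r) and at an
upper level u = t_(k-a) which is a small fixed multiple of t_k.
- Below: the sum of the terms truncated at t_(k-r) has mean close to kappa t_k
  and concentrates by the Chebyshev inequality; the covariances are controlled
  by the series psi(n) / n ([low_deviation]).
- Above: two terms exceed u with probability O((n_k tau(u))^2), and n_k tau(u)
  is at most a constant times h(u), where h(t) = t tau(t) / L(t); condensation
  turns the summability hypothesis into the summability of h^2 along the ladder
  ([two_exceed], [ladder_tail_ratio_sq]).  At most one term above u means that
  trimming removes it.
- Between: these terms are bounded by u, so by a first passage argument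
  P(S > x + y + u) <= (1 + psi(1)) P(S > x) P(S > y) for their sum S, which
  raises the bound of P(S > u) from the Markov inequality to its cube
  ([first_passage], [middle_excess]).
With a square summable sequence q that dominates the relevant quantities, the
lower cut contributes O(8^-r q_k) and the middle one O((2^r q_k)^3).  No fixed
depth r makes both summable, but the depth given by 8^r q_k ~ 1 makes both
O(q_k^2) ([truncation_depth]).  The Borel-Cantelli lemma gives the law along
each ladder, and since D_n is nondecreasing in n, comparison of ladders with
different j fills the gaps ([scale_interpolation]).

For the upper limits, the sum of tau(K b(n)) diverges for every K, as otherwise
h would be summable along the ladder, L bounded and g integrable on E.  A second
Borel-Cantelli lemma, run along well separated indices, yields p_n > K b(n)
infinitely often, and likewise for g ([exceed_infinitely_often]).  Such a term
is already seen by m(N), respectively by the maximum of g, at the first N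
beyond D_(n+1)(p) + e, which is asymptotic to b(n).

For the last limit, the maximum of g and c m(N) can be replaced by their sum as
soon as the smaller of them is o(b(n)).  Both exceed u = t_(k-a) only if some
p_i and some g_i' do, an event of probability O((n_k tau(u))^2): mixing gives
this for i <> i', and the additional hypothesis for i = i' ([common_exceed]). *)


(** * Nonnegative series with bounded partial sums *)

Section BoundedSums.
Context {R : realType}.
Implicit Types u v : nat -> R.

Definition bounded_sums u := exists M : R, forall n, \sum_(k < n) u k <= M.

(** Only eventual behaviour along a ladder is ever controlled, so summability must
not depend on the first terms. *)
Lemma bounded_sums_shift u K : (forall k, 0 <= u k) ->
  bounded_sums u <-> bounded_sums (fun k => u (K + k)%N).
Proof.
move=> u0; split=> -[M HM].
  exists M => n; apply: le_trans (HM (K + n)%N).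
  by rewrite big_split_ord /= lerDr sumr_ge0.
exists (\sum_(k < K) u k + M) => n.
have : \sum_(k < K + n) u k <= \sum_(k < K) u k + M.
  by rewrite big_split_ord /= lerD2l; exact: HM.
by apply: le_trans; rewrite addnC big_split_ord /= lerDl sumr_ge0.
Qed.

Lemma bounded_sums_le u v : (forall k, 0 <= u k) ->
  (\forall k \near \oo, u k <= v k) -> (forall k, 0 <= v k) ->
  bounded_sums v -> bounded_sums u.
Proof.
move=> u0 [K _ uv] v0 /(bounded_sums_shift K v0) [M HM].
apply/(bounded_sums_shift K u0); exists M => n; apply: le_trans (HM n).
by apply: ler_sum => i _; apply: uv; rewrite /= leq_addr.
Qed.

Lemma bounded_sumsD u v : bounded_sums u -> bounded_sums v ->
  bounded_sums (fun k => u k + v k).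
Proof.
move=> [M HM] [M' HM']; exists (M + M') => n.
by rewrite big_split lerD.
Qed.

Lemma bounded_sumsZ c u : 0 <= c -> bounded_sums u ->
  bounded_sums (fun k => c * u k).
Proof.
move=> c0 [M HM]; exists (c * M) => n.
by rewrite -mulr_sumr ler_wpM2l.
Qed.

Lemma bounded_sums_cvg0 u : (forall k, 0 <= u k) -> bounded_sums u ->
  forall e, 0 < e -> \forall k \near \oo, u k < e.
Proof.
move=> u0 [M HM] e e0.
have : u @ \oo --> (0 : R).
  apply: cvg_series_cvg_0; apply: nondecreasing_is_cvgn.
    by apply/nondecreasing_seqP => n; rewrite seriesSr lerDl.
  by exists M => _ [n _ <-]; rewrite seriesEord /=; exact: HM.
move=> /cvgrPdist_lt /(_ e e0); apply: filterS => k.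
by rewrite sub0r normrN ger0_norm.
Qed.

(** Summing the recursion bounds the sum of u by twice the sum of v and the first
term of u: half of each term is absorbed by the next one. *)
Lemma bounded_sums_contract u v : (forall k, 0 <= u k) ->
  (forall k, 0 <= v k) ->
  (\forall k \near \oo, u k.+1 <= u k / 2 + v k) ->
  bounded_sums v -> bounded_sums u.
Proof.
move=> u0 v0 [K _ uv] /(bounded_sums_shift K v0) [M HM].
apply/(bounded_sums_shift K u0).
exists (2 * u K + 2 * M) => n.
suff : \sum_(k < n) u (K + k)%N + 2 * u (K + n)%N
       <= 2 * u K + 2 * \sum_(k < n) v (K + k)%N.
  by move: (HM n) (u0 (K + n)%N); lra.
elim: n => [|n IH]; first by rewrite !big_ord0 addn0; lra.
rewrite !big_ord_recr /= addnS.
have := uv (K + n)%N (leq_addr _ _); lra.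
Qed.

End BoundedSums.

(** * Tails and their partial sums *)

Lemma sum_nat_blocks (R : realType) (u : nat -> R) (m : nat -> nat) K :
  {homo m : i j / (i <= j)%N} ->
  \sum_(k < K) \sum_(m k <= n < m k.+1) u n = \sum_(m 0 <= n < m K) u n.
Proof.
move=> mm; elim: K => [|K IH]; first by rewrite big_ord0 big_geq.
by rewrite big_ord_recr /= IH -big_cat_nat //= ?mm.
Qed.

Definition partial_sum (R : realType) (tau : nat -> R) (n : nat) : R :=
  \sum_(0 <= k < n) tau k.

(** The properties of tau(n) = mu (A_{>n}) on which the trimmed law rests;
[partial_sum tau] is then the wandering rate. *)
Record regular_tail (R : realType) (tau : nat -> R) : Prop := RegularTail {
  tail_noninc : forall m n, (m <= n)%N -> tau n <= tau m ;
  tail_gt0 : forall n, 0 < tau n ;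
  tail_le1 : forall n, tau n <= 1 ;
  tail_divergent : forall M : R, exists n, M <= partial_sum tau n ;
  tail_square : exists M : R, forall n,
    \sum_(1 <= k < n) (k%:R * tau k ^+ 2 / partial_sum tau k ^+ 2) <= M
}.

Section Tail.
Context {R : realType} (tau : nat -> R) (rt : regular_tail tau).
Local Notation L := (partial_sum tau).

Lemma LS n : L n.+1 = L n + tau n.
Proof. by rewrite /partial_sum big_nat_recr. Qed.

Lemma L_split m n : (m <= n)%N -> L n = L m + \sum_(m <= k < n) tau k.
Proof. by move=> mn; rewrite /partial_sum -big_cat_nat. Qed.

Lemma sum_le_const m n (u : nat -> R) (c : R) :
  (forall k, (m <= k < n)%N -> u k <= c) ->
  \sum_(m <= k < n) u k <= (n - m)%:R * c.
Proof.
move=> uc; apply: (@le_trans _ _ (\sum_(m <= k < n) c)).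
  by apply: ler_sum_nat.
by rewrite big_const_nat iter_addr_0 mulr_natl.
Qed.

Lemma sum_ge_const m n (u : nat -> R) (c : R) :
  (forall k, (m <= k < n)%N -> c <= u k) ->
  (n - m)%:R * c <= \sum_(m <= k < n) u k.
Proof.
move=> uc; apply: (@le_trans _ _ (\sum_(m <= k < n) c)).
  by rewrite big_const_nat iter_addr_0 mulr_natl.
by apply: ler_sum_nat.
Qed.

Lemma L_incr m n : (m <= n)%N -> L n <= L m + (n - m)%:R * tau m.
Proof.
move=> mn; rewrite (L_split mn) lerD2l; apply: sum_le_const => k /andP[mk _].
exact: tail_noninc.
Qed.

Lemma L_mono : {homo L : m n / (m <= n)%N >-> m <= n}.
Proof.
move=> m n mn; rewrite (L_split mn) lerDl; apply: sumr_ge0 => k _.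
exact/ltW/tail_gt0.
Qed.

Lemma L_ge0 n : 0 <= L n.
Proof. by apply: sumr_ge0 => k _; exact/ltW/tail_gt0. Qed.

Lemma L_gt0 n : (0 < n)%N -> 0 < L n.
Proof.
case: n => // n _; rewrite LS ltr_wpDl ?L_ge0 //; exact: tail_gt0.
Qed.

Lemma L_le_id n : L n <= n%:R.
Proof.
have := @sum_le_const 0 n tau 1 (fun k _ => tail_le1 rt k).
by rewrite subn0 mulr1.
Qed.

Lemma mul_tail_le n : n%:R * tau n <= L n.
Proof.
have := @sum_ge_const 0 n tau (tau n); rewrite subn0; apply => k /andP[_ kn].
by apply: tail_noninc => //; exact: ltnW.
Qed.

(** The value of n tau(t) for n = t / L(t), which is the expected number of
excursions longer than t among the first n. *)
Definition tail_ratio s : R := s%:R * tau s / L s.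
Local Notation h := tail_ratio.

Lemma tail_ratio_ge0 s : 0 <= h s.
Proof. by rewrite !mulr_ge0 ?invr_ge0 ?L_ge0 // ltW // tail_gt0. Qed.

Lemma mul_tailE s : s%:R * tau s = h s * L s.
Proof.
case: s => [|s]; first by rewrite /h !mul0r.
by rewrite /h divfK // gt_eqF // L_gt0.
Qed.

(** The number of excursions after which the trimmed sum has reached the order
of s: the truncated mean over that many excursions is s. *)
Definition time_scale s : R := s%:R / L s.
Local Notation a := time_scale.

Lemma time_scale_mulL s : a s * L s = s%:R.
Proof.
case: s => [|s]; first by rewrite /a !mul0r.
by rewrite divfK // gt_eqF // L_gt0.
Qed.

Lemma time_scale_gt0 s : (0 < s)%N -> 0 < a s.
Proof. by move=> s0; rewrite divr_gt0 ?ltr0n ?L_gt0. Qed.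

Lemma time_scale_ge0 s : 0 <= a s.
Proof. by rewrite divr_ge0 ?L_ge0. Qed.

(** Averages of a nonincreasing sequence are nonincreasing: this is s tau(s) <=
L(s). *)
Lemma time_scale_mono : {homo a : m n / (m <= n)%N >-> m <= n}.
Proof.
apply: homo_leq => // [x y z|n]; first exact: le_trans.
case: n => [|n]; first by rewrite {1}/a mul0r time_scale_ge0.
rewrite /a ler_pdivrMr ?L_gt0 // mulrAC ler_pdivlMr ?L_gt0 // LS.
have := mul_tail_le n.+1; rewrite -[n.+2%:R]natr1; lra.
Qed.

End Tail.

(** * Geometric ladders of levels *)

Section Ladder.
Context {R : realType} (tau : nat -> R) (rt : regular_tail tau).
Local Notation L := (partial_sum tau).
Local Notation h := (tail_ratio tau).
Local Notation a := (time_scale tau).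

(** A fixed ratio, with a free starting level j: interpolation compares
neighbouring levels j 16^k and (j+1) 16^k for large j.  The ratio 16 lets the
truncation at depth r gain 16^r = 8^r 2^r, where 2^r is lost in the regularized
sequence [regular_ratio] and 8^r remains. *)
Definition ladder (j k : nat) : nat := (j * 16 ^ k)%N.

Lemma ladderE j k : ladder j k = (j * 16 ^ k)%N.
Proof. by []. Qed.

Lemma ladderS j k : ladder j k.+1 = (16 * ladder j k)%N.
Proof. by rewrite /ladder expnS mulnCA. Qed.

Lemma ladder_gt0 j k : (0 < j)%N -> (0 < ladder j k)%N.
Proof. by move=> j0; rewrite /ladder muln_gt0 j0 expn_gt0. Qed.

Lemma ladder_mono j : {homo ladder j : m n / (m <= n)%N}.
Proof. by move=> m n mn; rewrite /ladder leq_mul2l leq_pexp2l ?orbT. Qed.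

Lemma ladder_ge j k : (0 < j)%N -> (k <= ladder j k)%N.
Proof.
move=> j0; rewrite (leq_trans (ltnW (ltn_expl k (isT : (1 < 16)%N)))) //.
by rewrite /ladder leq_pmull.
Qed.

Lemma ladderB j a k : (a <= k)%N ->
  (ladder j k)%:R = 16 ^+ a * (ladder j (k - a))%:R :> R.
Proof. by move=> ak; rewrite -natrX -natrM /ladder mulnCA -expnD subnKC. Qed.

Opaque ladder.

Lemma tail_div_mono m n : (0 < m)%N -> (m <= n)%N ->
  tau n / L n <= tau m / L m.
Proof.
move=> m0 mn; have n0 := leq_trans m0 mn.
apply: ler_pM; rewrite ?invr_ge0 ?L_ge0 //; first exact/ltW/tail_gt0.
- exact: tail_noninc.
- by rewrite lef_pV2 ?posrE ?L_gt0 // L_mono.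
Qed.

Section FixedLadder.
Variables (j : nat) (j0 : (0 < j)%N).
Local Notation t := (ladder j).

(** Condensation: n tau(n)^2 / L(n)^2 is n times the square of a nonincreasing
quantity, so over a block of length 15 t_k its sum is at least of the order of
h at the right end, squared. *)
Lemma tail_ratio_ladder_block k :
  h (t k.+1) ^+ 2 <= 256 / 15 *
    \sum_(t k <= n < t k.+1) (n%:R * tau n ^+ 2 / L n ^+ 2).
Proof.
have s0 := ladder_gt0 k j0; set s := t k in s0 *.
have -> : t k.+1 = (16 * s)%N by rewrite ladderS.
have s16 : (0 < 16 * s)%N by rewrite muln_gt0.
set z := tau (16 * s) / L (16 * s).
have z0 : 0 <= z by rewrite divr_ge0 ?L_ge0 // ltW // tail_gt0.
have hE : h (16 * s) = (16 * s)%:R * z by rewrite /h mulrA.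
have zle n : (s <= n < 16 * s)%N ->
    s%:R * z ^+ 2 <= n%:R * tau n ^+ 2 / L n ^+ 2.
  move=> /andP[sn nt]; rewrite -mulrA -expr_div_n ler_pM ?ler_nat ?exprn_ge0 //.
  have /(tail_div_mono (leq_trans s0 sn)) := ltnW nt.
  by move=> zn; rewrite ler_pXn2r // nnegrE ?(le_trans z0 zn).
have /= := sum_ge_const zle.
have -> : (16 * s - s)%:R = 15 * s%:R :> R.
  by rewrite -[X in (_ - X)%N]mul1n -mulnBl natrM.
rewrite hE natrM; lra.
Qed.

(** The 15 t_k new terms are at most tau(t_k) each. *)
Lemma partial_sum_rung k : L (t k.+1) <= (1 + 15 * h (t k)) * L (t k).
Proof.
have := @L_incr _ _ rt _ _ (ladder_mono j (leqnSn k)).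
have -> : (t k.+1 - t k)%:R = 15 * (t k)%:R :> R.
  by rewrite ladderS -[X in (_ - X)%N]mul1n -mulnBl natrM.
by rewrite -mulrA (mul_tailE rt); lra.
Qed.

Lemma ladder_tail_ratio_sq : bounded_sums (fun k => h (t k) ^+ 2).
Proof.
apply/(bounded_sums_shift 1); first by move=> k; exact: sqr_ge0.
have [M HM] := tail_square rt.
exists (256 / 15 * M) => n.
apply: (@le_trans _ _ (256 / 15 * \sum_(k < n)
    \sum_(t k <= i < t k.+1) (i%:R * tau i ^+ 2 / L i ^+ 2))).
  by rewrite mulr_sumr; apply: ler_sum => k _; exact: tail_ratio_ladder_block.
rewrite sum_nat_blocks; last exact: ladder_mono.
rewrite ler_pM2l //; apply: le_trans (HM (t n)).
have t1 : (1 <= t 0)%N by apply: ladder_gt0.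
rewrite [leRHS](big_cat_nat (n := t 0%N)) //=; last exact: ladder_mono.
rewrite lerDr; apply: sumr_ge0 => i _.
exact: divr_ge0 (mulr_ge0 (ler0n _ _) (sqr_ge0 _)) (sqr_ge0 _).
Qed.

Lemma tail_ratio_ladder_small e : 0 < e -> \forall k \near \oo, h (t k) < e.
Proof.
move=> e0; have := bounded_sums_cvg0 (fun k => sqr_ge0 (h (t k)))
  ladder_tail_ratio_sq (exprn_gt0 2 e0).
apply: filterS => k; rewrite ltr_pXn2r // nnegrE ?(ltW e0) //.
exact: tail_ratio_ge0.
Qed.

(** The numerator is the second moment of an excursion length truncated at t_k
(the sum of (2 s + 1) tau(s)), so this is the variance of n_k such truncated
terms divided by t_k^2. *)
Definition second_moment_ratio k : R :=
  (\sum_(0 <= s < t k) (2 * s%:R + 1) * tau s) / ((t k)%:R * L (t k)).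
Local Notation Q := second_moment_ratio.

(** A common upper bound of the variance ratio and of h on the previous rung,
regularized so that it loses at most a factor 2 from one rung to the next
([regular_ratio_double]). *)
Fixpoint regular_ratio k : R :=
  if k is k'.+1 then regular_ratio k' / 2 + 32 * h (t k') else Q 0 + 1.
Local Notation q := regular_ratio.

Let tL_gt0 k : 0 < (t k)%:R * L (t k).
Proof. by rewrite mulr_gt0 ?ltr0n ?L_gt0 ?ladder_gt0. Qed.

Lemma second_moment_ratio_ge0 k : 0 <= Q k.
Proof.
rewrite divr_ge0 ?(ltW (tL_gt0 k)) //; apply: sumr_ge0 => s _.
by rewrite mulr_ge0 ?(ltW (tail_gt0 rt _)) // addr_ge0 ?mulr_ge0.
Qed.

(** The denominator grows by a factor 16 at least; the new part of the sum is
estimated at the left end of the block. *)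
Lemma second_moment_ratioS k : Q k.+1 <= Q k / 16 + 32 * h (t k).
Proof.
have s0 := ladder_gt0 k j0.
have t16 : (t k.+1)%:R = 16 * (t k)%:R :> R by rewrite ladderS natrM.
have LL : L (t k) <= L (t k.+1) by apply: L_mono => //; exact: ladder_mono.
have L0 : 0 < L (t k) by exact: L_gt0.
have N0 : 0 <= \sum_(0 <= s < t k) (2 * s%:R + 1) * tau s.
  apply: sumr_ge0 => s _.
  by rewrite mulr_ge0 ?(ltW (tail_gt0 rt _)) // addr_ge0 ?mulr_ge0.
have split_sum : \sum_(0 <= s < t k.+1) (2 * s%:R + 1) * tau s <=
    \sum_(0 <= s < t k) (2 * s%:R + 1) * tau s +
    512 * (t k)%:R * ((t k)%:R * tau (t k)).
  rewrite (big_cat_nat (n := t k)) //=; last exact: ladder_mono.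
  rewrite lerD2l.
  apply: (@le_trans _ _ ((t k.+1 - t k)%:R * (32 * (t k)%:R * tau (t k)))).
    apply: sum_le_const => s /andP[ks sk].
    rewrite ler_pM ?(ltW (tail_gt0 rt _)) ?addr_ge0 ?mulr_ge0 ?tail_noninc //.
    have : (s.+1)%:R <= (t k.+1)%:R :> R by rewrite ler_nat.
    by rewrite t16 -natr1 => ?; lra.
  have : (t k.+1 - t k)%:R <= 16 * (t k)%:R :> R.
    by rewrite -t16 ler_nat leq_subr.
  have : 0 <= 32 * (t k)%:R * tau (t k).
    by rewrite !mulr_ge0 ?(ltW (tail_gt0 rt _)).
  nra.
rewrite /Q ler_pdivrMr ?tL_gt0 // (le_trans split_sum) // (mul_tailE rt) t16.
set N := \sum_(_ <= _ < _) _ in N0 *.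
set x := (t k)%:R; have x0 : 0 < x by rewrite ltr0n.
have h0 := tail_ratio_ge0 rt (t k).
have -> : (N / (x * L (t k)) / 16 + 32 * h (t k)) * (16 * x * L (t k.+1)) =
  N * (L (t k.+1) / L (t k)) + 512 * x * (h (t k) * L (t k.+1)).
  by field; rewrite !gt_eqF.
rewrite lerD //.
  by rewrite ler_peMr // ler_pdivlMr // mul1r.
by apply: ler_wpM2l; [exact: mulr_ge0 (ler0n _ _) (ltW x0)|exact: ler_wpM2l].
Qed.

Lemma second_le_regular_ratio k : Q k <= q k.
Proof.
elim: k => [|k IH] /=; first by rewrite lerDl.
have := second_moment_ratioS k; have := second_moment_ratio_ge0 k; lra.
Qed.

Lemma regular_ratio_ge0 k : 0 <= q k.
Proof. exact: le_trans (second_moment_ratio_ge0 k) (second_le_regular_ratio k). Qed.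

(** By (x / 2 + 32 y)^2 <= x^2 / 2 + 2048 y^2 the squares satisfy a contracting
recursion whose source term is summable. *)
Lemma regular_ratio_sq : bounded_sums (fun k => q k ^+ 2).
Proof.
apply: (@bounded_sums_contract _ _ (fun k => 2048 * h (t k) ^+ 2)).
- by move=> k; exact: sqr_ge0.
- by move=> k; exact: mulr_ge0 (ler0n _ _) (sqr_ge0 _).
- near=> k; rewrite /=; set x := q k; set y := h (t k).
  have := sqr_ge0 (x / 2 - 32 * y); lra.
- by apply: bounded_sumsZ; [exact: ler0n|exact: ladder_tail_ratio_sq].
Unshelve. all: by end_near. Qed.

Lemma regular_ratio_double i r : q i <= 2 ^+ r * q (i + r).
Proof.
elim: r i => [|r IH] i; first by rewrite expr0 mul1r addn0.
apply: le_trans (IH i) _; rewrite addnS /= exprS.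
have := tail_ratio_ge0 rt (t (i + r)) => h0.
have : 0 <= (2 : R) ^+ r by rewrite exprn_ge0.
nra.
Qed.

(** On each rung L increases by at most 15 h(t_k) L(t_k), hence by at most
q_(k+1) L(t_(k+1)); going back from the last rung these bounds double, whence
the geometric sum 2^r - 1. *)
Lemma partial_sum_gap i r :
  L (t (i + r)) - L (t i) <= L (t (i + r)) * q (i + r) * (2 ^+ r - 1).
Proof.
elim: r => [|r IH]; first by rewrite addn0 subrr expr0 subrr mulr0.
rewrite addnS; set k := (i + r)%N in IH *.
have LL : L (t k) <= L (t k.+1) by apply: L_mono => //; exact: ladder_mono.
have L0 : 0 < L (t k) by apply: L_gt0 => //; exact: ladder_gt0.
have step : L (t k.+1) - L (t k) <= L (t k.+1) * q k.+1.
  have /= H := partial_sum_rung k.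
  have := regular_ratio_ge0 k; have := tail_ratio_ge0 rt (t k) => h0 q0.
  have := ler_wpM2l h0 LL; nra.
have q2 : q k <= 2 * q k.+1 by have := regular_ratio_double k 1; rewrite addn1 expr1.
have r1 : 0 <= (2 : R) ^+ r - 1 by rewrite subr_ge0 exprn_ege1 // ler1n.
have : L (t k) * q k * (2 ^+ r - 1) <= L (t k.+1) * (2 * q k.+1) * (2 ^+ r - 1).
  by rewrite ler_wpM2r // ler_pM ?regular_ratio_ge0 // ltW.
rewrite [2 ^+ r.+1]exprS; lra.
Qed.

Lemma regular_ratio_small e : 0 < e -> \forall k \near \oo, q k < e.
Proof.
move=> e0; have := bounded_sums_cvg0 (fun k => sqr_ge0 (q k))
  regular_ratio_sq (exprn_gt0 2 e0).
apply: filterS => k; rewrite ltr_pXn2r // nnegrE ?(ltW e0) //.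
exact: regular_ratio_ge0.
Qed.

(** The depth r balances the two error terms 8^-r q and (2^r q)^3: with
8^r q of order 1, both are of order q^2.  It does not reach below the bottom
of the ladder because q_k decays at most like 2^-k. *)
Lemma truncation_depth : \forall k \near \oo, exists i r,
  [/\ k = (i + r)%N, q k * 8 ^+ r <= 1 & 1 <= 8 ^+ r.+1 * q k].
Proof.
near=> k.
have q1 : q k <= 1 by apply/ltW; near: k; exact: regular_ratio_small.
have q8 : 1 <= 8 ^+ k * q k.
  have : q 0 <= 2 ^+ k * q k by have := regular_ratio_double 0 k.
  have := second_moment_ratio_ge0 0 => /= Q0.
  have : (2 : R) ^+ k <= 8 ^+ k by rewrite lerXn2r ?nnegrE ?ler_nat.
  have := regular_ratio_ge0 k; nra.
suff : forall s, (s <= k)%N -> 1 <= 8 ^+ s * q k ->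
    exists2 r, (r <= k)%N & q k * 8 ^+ r <= 1 /\ 1 <= 8 ^+ r.+1 * q k.
  move=> /(_ k (leqnn k) q8) [r rk [H1 H2]].
  by exists (k - r)%N, r; rewrite subnK.
elim=> [|s IH] sk; first by move=> H; exists 0%N => //; rewrite expr0 mulr1;
  split=> //; move: H; rewrite expr0 expr1; lra.
move=> H; have [H'|H'] := lerP 1 (8 ^+ s * q k); first exact: IH (ltnW sk) H'.
by exists s; [exact: ltnW | split=> //; rewrite mulrC ltW].
Unshelve. all: by end_near. Qed.

End FixedLadder.
End Ladder.

(** * Times attached to a ladder *)

Section LadderTimes.
Context {R : realType} (tau : nat -> R) (rt : regular_tail tau).
Local Notation L := (partial_sum tau).
Local Notation h := (tail_ratio tau).
Local Notation a := (time_scale tau).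

Definition ladder_time (j k : nat) : nat := Num.truncn (a (ladder j k)).

Section FixedLadder.
Variables (j : nat) (j0 : (0 < j)%N).
Local Notation t := (ladder j).
Local Notation n_ := (ladder_time j).

Lemma ladder_time_itv k : (n_ k)%:R <= a (t k) < (n_ k).+1%:R.
Proof. by apply: truncn_itv; exact: time_scale_ge0. Qed.

Lemma ladder_time_mono : {homo n_ : m n / (m <= n)%N}.
Proof.
move=> m n mn; apply: le_truncn; apply: time_scale_mono => //.
exact: ladder_mono.
Qed.

(** Once h(t_k) < 1 / 15, the partial sum L at most doubles on the rung, while
the level is multiplied by 16. *)
Lemma time_scale_ladder_growth :
  \forall k \near \oo, 8 * a (t k) <= a (t k.+1).
Proof.
near=> k.
have t0 := ladder_gt0 k j0; have t1 := ladder_gt0 k.+1 j0.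
have hk : h (t k) < 1 / 15.
  by near: k; apply: tail_ratio_ladder_small => //; lra.
have L0 : 0 < L (t k) by exact: L_gt0.
have L1 : 0 < L (t k.+1) by exact: L_gt0.
have LL : L (t k.+1) <= 2 * L (t k).
  apply: le_trans (partial_sum_rung rt j k) _; rewrite ler_wpM2r ?(ltW L0) //.
  by lra.
rewrite [leRHS]/time_scale ler_pdivlMr //.
have -> : (t k.+1)%:R = 16 * (a (t k) * L (t k)).
  by rewrite (time_scale_mulL rt) ladderS natrM.
by have := ler_wpM2l (time_scale_ge0 rt (t k)) LL; lra.
Unshelve. all: by end_near. Qed.

(** The inverses contract geometrically, hence tend to 0. *)
Lemma time_scale_ladder_large (A : R) : \forall k \near \oo, A <= a (t k).
Proof.
have a0 k : 0 < a (t k) by rewrite time_scale_gt0 ?ladder_gt0.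
have inva0 k : 0 <= (a (t k))^-1 by rewrite invr_ge0 ltW.
have : bounded_sums (fun k => (a (t k))^-1).
  apply: (@bounded_sums_contract _ _ (fun=> 0)) => //.
    have := time_scale_ladder_growth; apply: filterS => k ak.
    rewrite addr0 (@le_trans _ _ ((8 * a (t k))^-1)) //.
      by rewrite lef_pV2 ?posrE // mulr_gt0 // ltr0n.
    rewrite invfM mulrC ler_pM2l ?invr_gt0 // lef_pV2 ?posrE ?ltr0n //.
    by rewrite ler_nat.
  by exists 0 => n; rewrite big1.
have A0 : 0 < (`|A| + 1)^-1 by rewrite invr_gt0 ltr_wpDl.
move=> /(bounded_sums_cvg0 inva0) /(_ _ A0); apply: filterS => k.
rewrite ltf_pV2 ?posrE ?ltr_wpDl // => /ltW; apply: le_trans.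
by rewrite (le_trans (ler_norm A)) // lerDl.
Qed.

Lemma ladder_time_large (m : nat) : \forall k \near \oo, (m <= n_ k)%N.
Proof.
have := time_scale_ladder_large m%:R; apply: filterS => k.
by rewrite truncn_ge_nat // time_scale_ge0.
Qed.

Lemma ladder_time_double : \forall k \near \oo, (2 * n_ k <= n_ k.+1)%N.
Proof.
near=> k.
have g : 8 * a (t k) <= a (t k.+1) by near: k; exact: time_scale_ladder_growth.
have a1 : 1 <= a (t k) by near: k; exact: time_scale_ladder_large.
have /andP[n1 _] := ladder_time_itv k; have /andP[_ n2] := ladder_time_itv k.+1.
have : (2 * n_ k)%:R < (n_ k.+1).+1%:R :> R.
  by apply: le_lt_trans n2; rewrite natrM; lra.
by rewrite ltr_nat ltnS.
Unshelve. all: by end_near. Qed.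

Lemma ladder_time_ge (e : R) : 0 < e ->
  \forall k \near \oo, (1 - e) * a (t k) <= (n_ k)%:R.
Proof.
move=> e0; have := time_scale_ladder_large e^-1; apply: filterS => k ak.
have /andP[_] := ladder_time_itv k; rewrite -natr1 => nk.
have : 1 <= e * a (t k) by rewrite -(divff (lt0r_neq0 e0)) ler_pM2l.
by lra.
Qed.

(** The averages of psi over the first n_k indices are summable: as the times
n_k at least double, the average halves at each rung, up to the terms of the
new block, for which 1 / n_(k+1) <= 1 / i. *)
Lemma ladder_mixing_sum (psi : nat -> R) : (forall n, 0 <= psi n) ->
  bounded_sums (fun n => psi n.+1 / n.+1%:R) ->
  bounded_sums (fun k => (\sum_(0 <= i < n_ k) psi i.+1) / (n_ k)%:R).
Proof.
move=> psi0 [M HM]; have sum0 m n : 0 <= \sum_(m <= i < n) psi i.+1.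
  by apply: sumr_ge0.
apply: (@bounded_sums_contract _ _
  (fun k => \sum_(n_ k <= i < n_ k.+1) psi i.+1 / i.+1%:R)).
- by move=> k; rewrite divr_ge0.
- by move=> k; apply: sumr_ge0 => i _; rewrite divr_ge0.
- near=> k.
  have nd : (2 * n_ k <= n_ k.+1)%N by near: k; exact: ladder_time_double.
  have n1 : (1 <= n_ k)%N by near: k; exact: ladder_time_large.
  have n2 : (0 < n_ k.+1)%N by lia.
  rewrite (big_cat_nat (n := n_ k)) //=; last exact: ladder_time_mono.
  rewrite mulrDl lerD //.
    rewrite -mulrA -invfM -natrM mulnC ler_wpM2l // lef_pV2 ?posrE ?ltr0n //.
      by rewrite ler_nat.
    by rewrite muln_gt0.
  rewrite mulr_suml; apply: ler_sum_nat => i /andP[_ ik].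
  by rewrite ler_wpM2l // lef_pV2 ?posrE ?ltr0n // ler_nat.
- exists M => n; rewrite sum_nat_blocks; last exact: ladder_time_mono.
  have := HM (n_ n); rewrite -(big_mkord xpredT (fun i => psi i.+1 / i.+1%:R)).
  rewrite (big_cat_nat (n := n_ 0%N)) //=; last exact: ladder_time_mono.
  by apply: le_trans; rewrite lerDr; apply: sumr_ge0 => i _; rewrite divr_ge0.
Unshelve. all: by end_near. Qed.

End FixedLadder.

(** One rung multiplies L by at most 1 + 15 h(t_k) <= exp (15 h(t_k)), so
summability would bound L. *)
Lemma tail_ratio_not_summable :
  ~ bounded_sums (fun k => h (ladder 1 k)).
Proof.
move=> [M HM]; set t := ladder 1.
have LE k : L (t k) <= L (t 0%N) * expR (15 * \sum_(i < k) h (t i)).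
  elim: k => [|k IH]; first by rewrite big_ord0 mulr0 expR0 mulr1.
  apply: le_trans (partial_sum_rung rt 1 k) _.
  rewrite big_ord_recr /= [in leRHS]mulrDr expRD [leRHS]mulrA [leLHS]mulrC.
  apply: ler_pM.
  - exact: L_ge0.
  - by rewrite addr_ge0 // mulr_ge0 // tail_ratio_ge0.
  - exact: IH.
  - exact: expR_ge1Dx.
have [n Hn] := tail_divergent rt (L (t 0%N) * expR (15 * M) + 1).
have : L n <= L (t n) by apply: L_mono => //; exact: ladder_ge.
have : L (t 0%N) * expR (15 * \sum_(i < n) h (t i)) <=
       L (t 0%N) * expR (15 * M).
  by rewrite ler_wpM2l ?L_ge0 // ler_expR ler_pM2l.
have := LE n; lra.
Qed.

End LadderTimes.

(** * The normalizing sequence *)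

Section Normalization.
Context {R : realType} (tau : nat -> R) (rt : regular_tail tau).
Local Notation L := (partial_sum tau).
Local Notation h := (tail_ratio tau).
Local Notation a := (time_scale tau).
Local Notation n_ := (ladder_time tau).

Definition inverse_scale (b : nat -> nat) : Prop :=
  forall n, a (b n) <= n%:R < a (b n).+1.

Lemma inverse_scale_exists : exists b, inverse_scale b.
Proof.
suff : forall n : nat, exists s, a s <= n%:R < a s.+1.
  by move=> /choice[b Hb]; exists b.
move=> n.
have [k _ Hk] := time_scale_ladder_large rt (isT : 0 < 1)%N (n%:R + 1).
have ex : exists s, n%:R < a s.
  by exists (ladder 1 k); apply: lt_le_trans (Hk k (leqnn k)); rewrite ltrDl.
case: (ex_minnP ex) => -[|s].
  by rewrite /time_scale mul0r ltNge ler0n.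
move=> as1 smin; exists s; rewrite as1 andbT leNgt; apply/negP => /smin.
by rewrite ltnn.
Qed.

Variables (b : nat -> nat) (Hb : inverse_scale b).

Lemma scale_ltP n s : (b n < s)%N <-> n%:R < a s.
Proof.
have /andP[H1 H2] := Hb n; split=> [bs|ns].
  by apply: lt_le_trans H2 _; exact: time_scale_mono.
rewrite ltnNge; apply/negP => /(time_scale_mono rt) sb.
by have := le_lt_trans (le_trans sb H1) ns; rewrite ltxx.
Qed.

Lemma scale_mono : {homo b : m n / (m <= n)%N}.
Proof.
move=> m n mn; rewrite leqNgt; apply/negP => /scale_ltP H.
have := Hb m => /andP[H1 _].
have := lt_le_trans H H1; rewrite ltr_nat; lia.
Qed.

Lemma scale_large (B : nat) : \forall n \near \oo, (B <= b n)%N.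
Proof.
exists (Num.truncn (a B)).+1 => // n /= Bn.
rewrite leqNgt; apply/negP => /scale_ltP nB.
have /andP[_ H] := truncn_itv (time_scale_ge0 rt B).
by have := lt_trans nB H; rewrite ltr_nat ltnNge Bn.
Qed.

Lemma time_negligible (e : R) : 0 < e ->
  \forall n \near \oo, n%:R <= e * (b n)%:R :> R.
Proof.
move=> e0; have [s Hs] := tail_divergent rt (2 / e).
near=> n.
have sb : (s.+1 <= b n)%N by near: n; exact: scale_large.
have /andP[_ nb] := Hb n.
have LL : 2 / e <= L (b n).+1.
  by apply: le_trans Hs _; apply: L_mono => //; lia.
have b1 : 1 <= (b n)%:R :> R by rewrite ler1n; lia.
have := time_scale_mulL rt (b n).+1; rewrite -natr1.
set A := a _ in nb *; set B := (b n)%:R in b1 * => AL.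
have A0 : 0 <= A by exact: time_scale_ge0.
have : A * (2 / e) <= B + 1 by rewrite -AL ler_wpM2l.
rewrite mulrA ler_pdivrMr // => H; nra.
Unshelve. all: by end_near. Qed.

(** Between two rungs h grows by a factor 16 at most. *)
Lemma tail_ratio_small (e : R) : 0 < e -> \forall s \near \oo, h s < e.
Proof.
move=> e0.
have e16 : 0 < e / 16 by rewrite divr_gt0.
have [K _ HK] := tail_ratio_ladder_small rt (isT : 0 < 1)%N e16.
exists (16 ^ K)%N => // s /= Ks.
have s0 : (0 < s)%N by apply: leq_trans Ks; rewrite expn_gt0.
have /andP[k1 k2] := trunc_log_bounds (isT : (1 < 16)%N) s0.
set k := trunc_log 16 s in k1 k2.
have Kk : (K <= k)%N by exact: trunc_log_max.
have := HK k Kk; set t := ladder 1 k => ht.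
have tE : t = (16 ^ k)%N by rewrite /t ladderE mul1n.
have t0 : (0 < t)%N by exact: ladder_gt0.
have ts : (t <= s)%N by rewrite tE.
have st : (s <= 16 * t)%N by rewrite tE -expnS ltnW.
have : h s <= 16 * h t.
  rewrite /tail_ratio -!mulrA [leRHS]mulrA.
  apply: ler_pM => //.
  - by rewrite divr_ge0 ?L_ge0 // ltW // tail_gt0.
  - by rewrite -natrM ler_nat.
  - exact: tail_div_mono.
lra.
Qed.

Lemma tail_small (e : R) : 0 < e -> \forall s \near \oo, tau s < e.
Proof.
move=> e0; near=> s.
have s0 : (0 < s)%N by near: s; exact: nbhs_infty_gt.
have : h s < e by near: s; exact: tail_ratio_small.
apply: le_lt_trans; rewrite /tail_ratio ler_pdivlMr ?L_gt0 // mulrC.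
by rewrite ler_wpM2r ?L_le_id // ltW // tail_gt0.
Unshelve. all: by end_near. Qed.

Lemma time_scale_large (A : R) : \forall s \near \oo, A <= a s.
Proof.
have [k _ Hk] := time_scale_ladder_large rt (isT : 0 < 1)%N A.
exists (ladder 1 k) => // s /= /(time_scale_mono rt); apply: le_trans.
by apply: Hk => /=.
Qed.

(** Write b(n+1) = s + u with s = b(n) + 1.  The value of t / L(t) has increased
by less than 1 between s and s + u, whereas L has increased by at most u tau(s);
with h(s) and tau(s) small this leaves u <= 4 L(s), and L(s) = s / a(s) is
negligible. *)
Lemma scale_next (e : R) : 0 < e ->
  \forall n \near \oo, (b n.+1)%:R <= (1 + e) * (b n)%:R :> R.
Proof.
move=> e0; have e4 : 0 < e / 4 by rewrite divr_gt0.
have small : \forall s \near \oo, [/\ h s < 1 / 2, tau s < 1 / 4 &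
    16 / e <= a s].
  near=> s; split; near: s.
  - by apply: tail_ratio_small; lra.
  - by apply: tail_small; lra.
  - exact: time_scale_large.
have [S _ HS] := small.
near=> n.
have Sb : (S <= b n)%N by near: n; exact: scale_large.
have b4 : 4 / e <= (b n)%:R.
  have : ((Num.truncn (4 / e)).+1 <= b n)%N by near: n; exact: scale_large.
  rewrite -(ler_nat R); apply: le_trans; apply/ltW.
  by have /andP[] := truncn_itv (ltW (divr_gt0 (ltr0n R 4) e0)).
have /andP[_ na] := Hb n; have /andP[an _] := Hb n.+1.
have [hs ts As] : [/\ h (b n).+1 < 1 / 2, tau (b n).+1 < 1 / 4 &
    16 / e <= a (b n).+1] by apply: HS => /=; lia.
set s := (b n).+1 in na hs ts As.
have B1 : 1 <= e / 4 * (b n)%:R.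
  by rewrite -(ler_pM2l (divr_gt0 (ltr0n R 4) e0)) mulrA;
     rewrite (_ : 4 / e * (e / 4) = 1) ?mulr1 ?mul1r //; field; rewrite gt_eqF.
have sB : s%:R = (b n)%:R + 1 :> R by rewrite natr1.
have [ts'|st] := leqP (b n.+1) s.
  have : (b n.+1)%:R <= s%:R :> R by rewrite ler_nat.
  rewrite sB => /le_trans; apply; lra.
have L0 := L_ge0 rt s.
have tL := L_incr rt (ltnW st).
have u0 : 0 <= (b n.+1 - s)%:R :> R by [].
have tE : (b n.+1)%:R = s%:R + (b n.+1 - s)%:R :> R by rewrite -natrD subnKC // ltnW.
set u := (b n.+1 - s)%:R in tL u0 tE.
have ahE : a s * tau s = h s by rewrite /time_scale /tail_ratio mulrAC.
have t0 := ltW (tail_gt0 rt s).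
have as0 := time_scale_ge0 rt s.
have aE := time_scale_mulL rt s; have atE := time_scale_mulL rt (b n.+1).
rewrite -natr1 in an.
(* an upper bound of b(n+1) = a(b(n+1)) L(b(n+1)), as a(b(n+1)) <= n+1 < a(s)+1 *)
have key : s%:R + u <= (a s + 1) * (L s + u * tau s).
  rewrite -tE -atE; apply: ler_pM; rewrite ?time_scale_ge0 ?L_ge0 //; lra.
have ubnd : u <= 4 * L s.
  have E1 : (a s + 1) * (L s + u * tau s) =
     a s * L s + L s + u * (a s * tau s + tau s) by ring.
  rewrite E1 aE ahE in key.
  have : u * (h s + tau s) <= u * (3 / 4) by apply: ler_wpM2l => //; lra.
  lra.
have LB : 4 * L s <= e / 4 * s%:R.
  rewrite -aE mulrA.
  apply: ler_wpM2r => //.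
  rewrite -(ler_pM2l (divr_gt0 (ltr0n R 4) e0)) mulrA.
  rewrite (_ : 4 / e * (e / 4) = 1); last by field; rewrite gt_eqF.
  by rewrite mul1r; apply: le_trans As; rewrite mulrAC -natrM.
rewrite tE; rewrite sB in LB *.
have : e <= e * (b n)%:R.
  by rewrite ler_peMr ?(ltW e0) // ler1n; move: B1; case: (b n) => //;
     rewrite mulr0 ler10.
lra.
Unshelve. all: by end_near. Qed.

(** Two levels j 16^k and (j+1) 16^k with j >= J differ by a fraction 1 / J at
most, so a nondecreasing function known on all ladders is known everywhere.
Given b(n), the level is located by k = log_16 (b(n) / J) and then
j = b(n) / 16^k, which lies in [J, 16 J[: finitely many ladders suffice. *)
Lemma scale_interpolation (F : nat -> R) (kap : R) : 0 <= kap ->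
  {homo F : m n / (m <= n)%N >-> m <= n} ->
  (forall j, (0 < j)%N -> forall e, 0 < e -> \forall k \near \oo,
     `|F (n_ j k) - kap * (ladder j k)%:R| <= e * (ladder j k)%:R) ->
  forall e, 0 < e -> \forall n \near \oo,
     `|F n - kap * (b n)%:R| <= e * (b n)%:R.
Proof.
move=> kap0 Fm FL e e0.
(* J makes the error (kap + e) 16^k, caused by one step of j, at most e b(n) / 2 *)
pose J := (Num.truncn (2 * (kap + 1 + e) / e)).+1.
have JE : 2 * (kap + 1 + e) <= e * J%:R.
  have /andP[_ /ltW] := truncn_itv (divr_ge0
    (mulr_ge0 (ler0n R 2) (addr_ge0 (addr_ge0 kap0 ler01) (ltW e0))) (ltW e0)).
  by rewrite ler_pdivrMr // [leRHS]mulrC.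
have e4 : 0 < e / 4 by rewrite divr_gt0.
have [K _ HK] : \forall k \near \oo, forall i : 'I_(16 * J),
    `|F (n_ i.+1 k) - kap * (ladder i.+1 k)%:R| <= e / 4 * (ladder i.+1 k)%:R.
  by apply: filter_forall => i; exact: FL.
near=> n.
have bK : (J * 16 ^ K <= b n)%N by near: n; exact: scale_large.
have J0 : (0 < J)%N by [].
have bJ0 : (0 < b n %/ J)%N.
  by rewrite divn_gt0 // (leq_trans _ bK) // leq_pmulr // expn_gt0.
have /andP[k1 k2] := trunc_log_bounds (isT : (1 < 16)%N) bJ0.
set k := trunc_log 16 (b n %/ J) in k1 k2.
have Kk : (K <= k)%N.
  by apply: trunc_log_max => //; rewrite leq_divRL // mulnC.
have Jk : (J * 16 ^ k <= b n)%N by rewrite mulnC -leq_divRL.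
have kJ : (b n < J * 16 ^ k.+1)%N by rewrite mulnC -ltn_divLR.
pose p := (16 ^ k)%N; have p0 : (0 < p)%N by rewrite expn_gt0.
pose j := (b n %/ p)%N.
have Jj : (J <= j)%N by rewrite leq_divRL.
have jJ : (j < 16 * J)%N by rewrite ltn_divLR // -mulnA mulnCA -expnS.
have jb : (ladder j k <= b n)%N by rewrite ladderE -leq_divRL.
have bj : (b n < ladder j.+1 k)%N by rewrite ladderE -ltn_divLR.
have lE : ladder j.+1 k = (ladder j k + p)%N by rewrite ladderE mulSn addnC.
have j0 : (0 < j)%N by apply: leq_trans Jj.
have lo : (n_ j k <= n)%N.
  rewrite -(ler_nat R); have /andP[H _] := ladder_time_itv rt j k.
  apply: le_trans H _; have /andP[H _] := Hb n.
  by apply: le_trans H; exact: time_scale_mono.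
have hi : (n <= n_ j.+1 k)%N.
  rewrite -ltnS -(ltr_nat R); have /andP[_ H] := ladder_time_itv rt j.+1 k.
  by apply: lt_trans H; apply/scale_ltP.
have Flo := le_trans _ (Fm _ _ lo); have Fhi := le_trans (Fm _ _ hi).
have j1 : (j.-1 < 16 * J)%N by apply: leq_ltn_trans jJ; exact: leq_pred.
have H1 := HK k Kk (Ordinal j1); have H2 := HK k Kk (Ordinal jJ).
rewrite /= (prednK j0) ler_distl in H1; rewrite /= ler_distl in H2.
case/andP: H1 => H1 _; case/andP: H2 => _ H2.
have {Flo} F1 := Flo _ H1; have {Fhi} F2 := Fhi _ H2.
have pJ : J%:R * p%:R <= (b n)%:R :> R by rewrite -natrM ler_nat.
have bl : (ladder j k)%:R <= (b n)%:R :> R by rewrite ler_nat.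
have bl' : (b n)%:R <= (ladder j k)%:R + p%:R :> R.
  by rewrite -natrD -lE ler_nat ltnW.
rewrite lE natrD in F2.
set B := (b n)%:R in pJ bl bl' *; set l := (ladder j k)%:R in F1 F2 bl bl'.
set P := p%:R in pJ bl' F2.
have P0 : 0 <= P by [].
have PJ : 2 * (kap + 1 + e) * P <= e * B.
  apply: le_trans (_ : e * (J%:R * P) <= _); last by rewrite ler_pM2l.
  by rewrite mulrA ler_wpM2r.
have eB0 : 0 <= e * B by rewrite mulr_ge0 // ltW.
rewrite ler_distl; apply/andP; split.
  apply: le_trans F1.
  have := ler_wpM2l kap0 bl'; have := ler_wpM2l (ltW e0) bl.
  have := mulr_ge0 (ltW e0) P0; lra.
apply: (le_trans F2).
have := ler_wpM2l kap0 bl; have := ler_wpM2l (ltW e0) bl.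
have := mulr_ge0 (ltW e0) P0; have := mulr_ge0 kap0 P0; lra.
Unshelve. all: by end_near. Qed.

(** For n in the block [n_k, n_(k+1)[ one has b(n) < t_(k+1), and the block has
length of order t_(k+1) / L(t_(k+1)).  Hence the block sum is at least a
constant times h at the level t_(k+s+1), and h is not summable along the
ladder. *)
Lemma scale_tail_not_summable (s : nat) :
  ~ bounded_sums (fun n => tau (16 ^ s * b n)).
Proof.
move=> [M HM]; apply: (tail_ratio_not_summable rt).
set t := ladder 1; set m := n_ 1.
have h0 k : 0 <= h (t k) by exact: tail_ratio_ge0.
apply/(bounded_sums_shift s.+1 h0).
have tau0 n : 0 <= tau n by apply/ltW/tail_gt0.
pose v k := 4 * 16 ^+ s * \sum_(m k <= n < m k.+1) tau (16 ^ s * b n)%N.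
have c0 : 0 <= (4 : R) * 16 ^+ s by rewrite mulr_ge0 // exprn_ge0.
have v0 k : 0 <= v k by rewrite mulr_ge0 // sumr_ge0.
apply: (@bounded_sums_le _ _ v) => //.
- near=> k.
  have m2 : (2 * m k <= m k.+1)%N by near: k; exact: ladder_time_double.
  have a1 : 1 <= a (t k.+1).
    by near: k; have [K _ HK] := time_scale_ladder_large rt (isT : 0 < 1)%N 1;
       exists K => // k /= Kk; apply: HK => /=; lia.
  have blk : (m k.+1 - m k)%:R * tau (t (s.+1 + k)) <=
      \sum_(m k <= n < m k.+1) tau (16 ^ s * b n)%N.
    apply: sum_ge_const => n /andP[_ nm]; apply: tail_noninc => //.
    have bn : (b n < t k.+1)%N.
      apply/scale_ltP; have /andP[H _] := ladder_time_itv rt 1 k.+1.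
      by apply: lt_le_trans H; rewrite ltr_nat.
    have -> : t (s.+1 + k) = (16 ^ s * t k.+1)%N.
      by rewrite /t !ladderE !mul1n -expnD addnS.
    by rewrite leq_mul2l ltnW ?orbT.
  have m4 : a (t k.+1) <= 4 * (m k.+1 - m k)%:R.
    have /andP[_ H] := ladder_time_itv rt 1 k.+1; apply: le_trans (ltW H) _.
    have : (1 <= m k.+1)%N by rewrite truncn_ge_nat // time_scale_ge0.
    by rewrite -natrM ler_nat -/(m _); lia.
  have hE : h (t (s.+1 + k)) <= 16 ^+ s * (a (t k.+1) * tau (t (s.+1 + k))).
    rewrite /tail_ratio /time_scale.
    have -> : (t (s.+1 + k))%:R = 16 ^+ s * (t k.+1)%:R :> R.
      by rewrite -natrX -natrM /t !ladderE !mul1n -expnD addnS.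
    rewrite -!mulrA ler_wpM2l ?exprn_ge0 // ler_wpM2l // mulrC ler_wpM2r //.
    rewrite lef_pV2 ?posrE ?L_gt0 ?ladder_gt0 // L_mono //.
    by apply: ladder_mono; lia.
  apply: (le_trans hE).
  have -> : v k = 16 ^+ s * (4 * \sum_(m k <= n < m k.+1) tau (16 ^ s * b n)%N).
    by rewrite /v; ring.
  apply: ler_wpM2l; first exact: exprn_ge0.
  have := ler_wpM2r (tau0 (t (s.+1 + k)%N)) m4; lra.
- apply: bounded_sumsZ => //; exists M => n.
  rewrite sum_nat_blocks; last exact: ladder_time_mono.
  have := HM (m n); rewrite -(big_mkord xpredT (fun i => tau (16 ^ s * b i)%N)).
  rewrite (big_cat_nat (n := m 0%N)) //=; last exact: ladder_time_mono.
  by apply: le_trans; rewrite lerDr; apply: sumr_ge0.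
Unshelve. all: by end_near. Qed.

End Normalization.

(** * Events determined by finitely many coordinates *)

Section Determined.
Context (X : Type) (Z : nat -> X -> nat).

(** Membership depends only on Z_m, ..., Z_(n-1).  For a sequence with countably
many values this is the same as belonging to the sigma-algebra generated by
these coordinates ([determined_sigma_algebra]), and it is a condition that is
checked by rewriting. *)
Definition determined (m n : nat) (B : set X) : Prop :=
  forall x y, (forall i, (m <= i < n)%N -> Z i x = Z i y) -> B x -> B y.

Lemma determined_widen m n m' n' B : (m' <= m)%N -> (n <= n')%N ->
  determined m n B -> determined m' n' B.
Proof.
by move=> mm nn dB x y xy; apply: dB => i /andP[mi ni]; apply: xy; lia.
Qed.

Lemma determinedI m n B C : determined m n B -> determined m n C ->
  determined m n (B `&` C).
Proof. by move=> dB dC x y xy [Bx Cx]; split; [exact: dB Bx|exact: dC Cx]. Qed.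

Lemma determined_sum (w : nat -> nat) (Q : nat -> Prop) m n :
  determined m n [set x | Q (\sum_(m <= i < n) w (Z i x))%N].
Proof.
move=> x y xy; rewrite /=.
by rewrite (eq_big_nat _ _ (F2 := fun i => w (Z i y))) // => i /xy ->.
Qed.

Lemma sigma_algebra_setI (D : set X) (S : set (set X)) A B :
  sigma_algebra D S -> S (D `&` A) -> S (D `&` B) -> S (D `&` (A `&` B)).
Proof.
move=> [S0 SC SU] SA SB.
have -> : D `&` (A `&` B) =
    D `\` \bigcup_i (if i is 0%N then D `\` (D `&` A) else D `\` (D `&` B)).
  apply/seteqP; split=> x.
    by move=> [Dx [Ax Bx]]; split=> // -[[|i] _ [_]]; apply.
  move=> [Dx nx]; split=> //; split; apply: contrapT => nAB; apply: nx.
    by exists 0%N => //; split=> // -[].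
  by exists 1%N => //; split=> // -[].
by apply: (SC); apply: SU => -[|i]; exact: SC.
Qed.

(** Induction on n: split B according to the countably many values of the last
coordinate; on each piece the remaining condition is determined by the earlier
coordinates. *)
Lemma determined_sigma_algebra (D : set X) (S : set (set X)) m n B :
  sigma_algebra D S ->
  (forall i v, (m <= i < n)%N -> S (D `&` [set x | Z i x = v])) ->
  determined m n B -> S (D `&` B).
Proof.
move=> sS; have [S0 SC SU] := sS.
elim: n B => [|n IH] B SZ dB; last have [mn|nm] := leqP m n.
2: {
  pose B_ v : set X := [set x | exists y, [/\ B y, Z n y = v &
      forall i, (m <= i < n)%N -> Z i x = Z i y]].
  have -> : D `&` B = \bigcup_v (D `&` (B_ v `&` [set x | Z n x = v])).
    apply/seteqP; split=> x.
      move=> [Dx Bx]; exists (Z n x) => //; split=> //; split=> //.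
      by exists x.
    move=> [v _ [Dx [[y [By yv xy]] xv]]]; split=> //.
    apply: dB By => i /andP[mi]; rewrite ltnS leq_eqVlt => /orP[/eqP->|ni].
      by rewrite yv.
    by rewrite xy // mi.
  apply: SU => v; apply: sigma_algebra_setI => //; last by apply: SZ; lia.
  apply: IH => [i w ?|x y xy [z [Bz zv xz]]]; first by apply: SZ; lia.
  by exists z; split=> // i ?; rewrite -xy // xz. }
all: have [[x Bx]|nB] := pselect (exists x, B x).
1, 3: have -> : B = setT by apply/seteqP; split=> // y _; apply: dB Bx => i; lia.
1, 2: by rewrite setIT -[D]setD0; exact: SC.
all: suff -> : B = set0 by rewrite setI0.
all: by apply/seteqP; split=> // x Bx; apply: nB; exists x.
Qed.

End Determined.
Arguments determined_sum {X Z} w Q m n.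

Section FiniteMeasure.
Context d (X : measurableType d) (R : realType) (P : {measure set X -> \bar R}).
Hypothesis P1 : P setT = 1%E.

Definition pr (A : set X) : R := fine (P A).

Lemma prE A : measurable A -> P A = (pr A)%:E.
Proof.
move=> mA; rewrite fineK // ge0_fin_numE ?measure_ge0 //.
apply: (@le_lt_trans _ _ (P setT)); last by rewrite P1 ltry.
by apply: le_measure; rewrite ?inE.
Qed.

Lemma pr_ge0 A : 0 <= pr A.
Proof. exact: fine_ge0. Qed.

Lemma pr_le A B : measurable A -> measurable B -> A `<=` B -> pr A <= pr B.
Proof.
move=> mA mB AB; rewrite -lee_fin -!prE //.
by apply: le_measure => //; rewrite inE.
Qed.

Lemma pr_setT : pr setT = 1.
Proof. by rewrite /pr P1. Qed.

Lemma pr_le1 A : measurable A -> pr A <= 1.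
Proof. by move=> mA; rewrite -pr_setT; exact: pr_le. Qed.

Lemma pr_setD A B : measurable A -> measurable B ->
  pr A = pr (A `\` B) + pr (A `&` B).
Proof.
move=> mA mB; apply: EFin_inj; rewrite EFinD -!prE //; first exact: measureDI.
- exact: measurableI.
- exact: measurableD.
Qed.

Lemma pr_setU A B : measurable A -> measurable B ->
  pr (A `|` B) <= pr A + pr B.
Proof.
move=> mA mB; rewrite -lee_fin EFinD -!prE //; first exact: measureU2.
exact: measurableU.
Qed.

(** Integration of an inequality between finite combinations of indicators.
The moment inequalities below take this form, so that no integral of an
unbounded function occurs. *)
Lemma indicator_comparison (I J : Type) (s : seq I) (t : seq J)
    (u : I -> R) (v : J -> R) (A : I -> set X) (B : J -> set X) :
  (forall i, 0 <= u i) -> (forall j, 0 <= v j) ->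
  (forall i, measurable (A i)) -> (forall j, measurable (B j)) ->
  (forall x, \sum_(i <- s) u i * \1_(A i) x <= \sum_(j <- t) v j * \1_(B j) x) ->
  \sum_(i <- s) u i * pr (A i) <= \sum_(j <- t) v j * pr (B j).
Proof.
move=> u0 v0 mA mB AB.
have intE (K : Type) (r : seq K) (w : K -> R) (C : K -> set X) :
    (forall i, 0 <= w i) -> (forall i, measurable (C i)) ->
    (\int[P]_x (\sum_(i <- r) w i * \1_(C i) x)%:E)%E =
    (\sum_(i <- r) w i * pr (C i))%:E.
  move=> w0 mC.
  under eq_integral do rewrite -sumEFin.
  rewrite ge0_integral_sum //.
  - rewrite -sumEFin; apply: eq_bigr => i _.
    under eq_integral do rewrite EFinM.
    rewrite ge0_integralZl_EFin //.
    + by rewrite integral_indic // setIT EFinM prE.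
    + apply/measurable_EFinP; exact: measurable_indic.
  - move=> i; apply/measurable_EFinP.
    apply: measurable_funM; first exact: measurable_cst.
    exact: measurable_indic.
  - by move=> i x _; rewrite lee_fin mulr_ge0.
have mf (K : Type) (r : seq K) (w : K -> R) (C : K -> set X) :
    (forall i, measurable (C i)) ->
    measurable_fun setT (fun x => (\sum_(i <- r) w i * \1_(C i) x)%:E).
  move=> mC; apply/measurable_EFinP.
  apply: measurable_sum => i; apply: measurable_funM.
    exact: measurable_cst.
  exact: measurable_indic.
rewrite -lee_fin -!intE //; apply: ge0_le_integral => //.
- by move=> x _; rewrite lee_fin sumr_ge0 // => i _; rewrite mulr_ge0.
- exact: mf.
- exact: mf.
- by move=> x _; rewrite lee_fin.
Qed.

End FiniteMeasure.

(** * Mixing processes *)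

Section Counting.
Context d (X : measurableType d) (R : realType) (P : {measure set X -> \bar R}).
Hypothesis P1 : P setT = 1%E.
Local Notation pr := (pr P).
Variables (I : Type) (ps : seq I) (A : I -> set X).
Hypothesis mA : forall i, measurable (A i).
Let N x : R := \sum_(i <- ps) \1_(A i) x.

Lemma markov_count (u : R) (B : set X) : 0 <= u -> measurable B ->
  (forall x, B x -> u <= N x) -> u * pr B <= \sum_(i <- ps) pr (A i).
Proof.
move=> u0 mB BN.
have := @indicator_comparison _ _ _ _ P1 unit I [:: tt] ps (fun=> u) (fun=> 1)
  (fun=> B) A (fun=> u0) (fun=> ler01) (fun=> mB) mA.
rewrite big_seq1 => H; apply: le_trans (H _) _ => [x|].
  rewrite big_seq1 (eq_bigr (fun i => \1_(A i) x)) ?indicE => [|i _].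
    have [xB|_] := boolP (x \in B).
      by rewrite mulr1 BN //; move: xB; rewrite inE.
    by rewrite mulr0 sumr_ge0.
  by rewrite mul1r.
by rewrite (eq_bigr (fun i => pr (A i))) // => i _; rewrite mul1r.
Qed.

(** Integration of u^2 1_B + 2 M N <= M^2 + N^2, where N counts the events that
occur. *)
Lemma chebyshev_count (u M : R) (B : set X) : 0 <= u -> measurable B ->
  M = \sum_(i <- ps) pr (A i) -> (forall x, B x -> u <= `|N x - M|) ->
  u ^+ 2 * pr B + M ^+ 2 <= \sum_(i <- ps) \sum_(j <- ps) pr (A i `&` A j).
Proof.
move=> u0 mB ME BN.
have M0 : 0 <= M by rewrite ME sumr_ge0 // => i _; exact: pr_ge0.
pose l := None :: map Some ps.
pose r := None :: map Some [seq (i, j) | i <- ps, j <- ps].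
have := @indicator_comparison _ _ _ _ P1 _ _ l r
  (fun o => if o is Some _ then 2 * M else u ^+ 2)
  (fun o => if o is Some _ then 1 else M ^+ 2)
  (fun o => if o is Some i then A i else B)
  (fun o => if o is Some p then A p.1 `&` A p.2 else setT).
rewrite /l /r !big_cons !big_map big_allpairs /= => H.
have {}H : u ^+ 2 * pr B + \sum_(j <- ps) 2 * M * pr (A j) <=
    M ^+ 2 * pr setT + \sum_(i <- ps) \sum_(j <- ps) 1 * pr (A i `&` A j).
  apply: H.
  - by case=> [i|]; rewrite ?mulr_ge0 // exprn_ge0.
  - by case=> [i|]; rewrite ?exprn_ge0.
  - by case=> [i|].
  - by case=> [[i j]|] //; exact: measurableI.
  - move=> x; rewrite !big_cons !big_map big_allpairs /=.
    have -> : \sum_(j <- ps) 2 * M * \1_(A j) x = 2 * M * N x.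
      by rewrite /N mulr_sumr.
    have -> : \sum_(i <- ps) \sum_(j <- ps) 1 * \1_(A i `&` A j) x = N x ^+ 2.
      rewrite expr2 {1}/N mulr_suml; apply: eq_bigr => i _.
      rewrite /N mulr_sumr; apply: eq_bigr => j _.
      by rewrite mul1r indicI.
    rewrite indicT /= mulr1 indicE.
    have [xB|_] := boolP (x \in B).
      have : u ^+ 2 <= (N x - M) ^+ 2.
        rewrite -[leRHS]real_normK ?num_real // ler_pXn2r ?nnegrE //.
        by apply: BN; move: xB; rewrite inE.
      by rewrite mulr1; lra.
    by have := sqr_ge0 (N x - M); rewrite mulr0; lra.
rewrite -mulr_sumr -ME pr_setT // in H.
rewrite [X in _ <= _ + X](eq_bigr (fun i => \sum_(j <- ps) pr (A i `&` A j))) in H.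
  by lra.
by move=> i _; apply: eq_bigr => j _; rewrite mul1r.
Qed.

End Counting.

(** A stationary sequence with values in the natural numbers, psi-mixing in the
form |P(B C) - P(B) P(C)| <= psi(gap) P(B) P(C).  The past is Z_0, ..., Z_(j-1),
the future starts at Z_i, and adjacent blocks (i = j) have gap 1. *)
Record mixing_process d (X : measurableType d) (R : realType)
    (P : {measure set X -> \bar R}) (Z : nat -> X -> nat) (psi : nat -> R) :
    Prop := MixingProcess {
  mp_total : P setT = 1%E ;
  mp_measurable : forall i v, measurable [set x | Z i x = v] ;
  mp_psi_ge0 : forall n, 0 <= psi n ;
  mp_mixing : forall j i n B C, (0 < j <= i)%N ->
    determined Z 0 j B -> determined Z i n C ->
    `|pr P (B `&` C) - pr P B * pr P C| <= psi (i - j).+1 * (pr P B * pr P C) ;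
  mp_stationary : forall i (V : set nat), pr P (Z i @^-1` V) = pr P (Z 0%N @^-1` V)
}.

Section MixingProcess.
Context d (X : measurableType d) (R : realType) (P : {measure set X -> \bar R}).
Context (Z : nat -> X -> nat) (psi : nat -> R) (mp : mixing_process P Z psi).
Local Notation pr := (pr P).
Local Notation P1 := (mp_total mp).
Let psi0 : forall n, 0 <= psi n := mp_psi_ge0 mp.

Lemma determined_measurable m n B : determined Z m n B -> measurable B.
Proof.
move=> dB; rewrite -[B]setTI; apply: determined_sigma_algebra dB.
  exact: sigma_algebra_measurable.
by move=> i v _; rewrite setTI; exact: mp_measurable mp _ _.
Qed.

Lemma determined_coord i (V : set nat) : determined Z i i.+1 (Z i @^-1` V).
Proof. by move=> x y xy; rewrite /preimage /= xy // leqnn ltnSn. Qed.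

Lemma measurable_coord i (V : set nat) : measurable (Z i @^-1` V).
Proof. exact: determined_measurable (@determined_coord i V). Qed.

Lemma mixing_upper j i n B C : (0 < j <= i)%N ->
  determined Z 0 j B -> determined Z i n C ->
  pr (B `&` C) <= (1 + psi (i - j).+1) * (pr B * pr C).
Proof.
move=> ji dB dC; have := mp_mixing mp ji dB dC; rewrite ler_distl.
by case/andP=> _; lra.
Qed.

Lemma mixing_coord i i' (U V : set nat) : (i < i')%N ->
  pr (Z i @^-1` U `&` Z i' @^-1` V) <=
  (1 + psi (i' - i)) * (pr (Z 0%N @^-1` U) * pr (Z 0%N @^-1` V)).
Proof.
move=> ii'; rewrite -(mp_stationary mp i U) -(mp_stationary mp i' V).
have -> : (i' - i)%N = (i' - i.+1).+1 by lia.
apply: mixing_upper => //; last exact: determined_coord.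
exact: determined_widen (@determined_coord i U).
Qed.

Section FirstPassage.
Variables (w : nat -> nat) (u : nat).
Hypothesis wu : forall v, (w v <= u)%N.
Local Notation S m n x := (\sum_(m <= i < n) w (Z i x))%N.

(** When the sum first exceeds a, at the index k, it is at most a + u, as the
terms are bounded by u.  If the total exceeds a + b + u, then the terms after k
must add up to more than b, and this event involves only the coordinates after
k; mixing at gap 1 and summation over k finish the proof. *)
Lemma first_passage a b n :
  pr [set x | (a + b + u < S 0 n x)%N] <=
  (1 + psi 1) * (pr [set x | (a < S 0 n x)%N] * pr [set x | (b < S 0 n x)%N]).
Proof.
have mS k (Q : nat -> Prop) : measurable [set x | Q (S 0 k x)].
  exact: determined_measurable (determined_sum w Q 0 k).
have SS k x : S 0 k.+1 x = (S 0 k x + w (Z k x))%N by rewrite big_nat_recr.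
pose FP k := [set x | (S 0 k x <= a)%N /\ (a < S 0 k.+1 x)%N].
have dFP k : determined Z 0 k.+1 (FP k).
  apply: determinedI; last exact: (determined_sum w (fun s => (a < s)%N) _ _).
  apply: (@determined_widen _ _ 0 k) => //.
  exact: (determined_sum w (fun s => (s <= a)%N) _ _).
have mFP k : measurable (FP k) by exact: determined_measurable (@dFP k).
have sumFP k : \sum_(0 <= i < k) pr (FP i) = pr [set x | (a < S 0 k x)%N].
  elim: k => [|k IH].
    rewrite big_geq //; apply/esym; rewrite (_ : [set x | _] = set0) /pr ?measure0 //.
    by apply/seteqP; split=> // x; rewrite /= big_geq.
  rewrite big_nat_recr //= IH addrC.
  rewrite (pr_setD P1 (mS k.+1 (fun s => (a < s)%N)) (mS k (fun s => (a < s)%N))).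
  congr (pr _ + pr _); apply/seteqP; split=> x /=.
  - by move=> [H1 H2]; split=> //; apply/negP; rewrite -leqNgt.
  - by move=> [H1 /negP]; rewrite -leqNgt.
  - by move=> H; rewrite SS (leq_trans H) // leq_addr.
  - by case.
set q := pr [set x | (b < S 0 n x)%N].
pose E k := [set x | (a + b + u < S 0 n x)%N /\ (a < S 0 k x)%N].
have mE k : measurable (E k).
  apply: measurableI; first exact: (mS n (fun s => (a + b + u < s)%N)).
  exact: (mS k (fun s => (a < s)%N)).
have step k : (k <= n)%N ->
    pr (E k) <= \sum_(0 <= i < k) (1 + psi 1) * (pr (FP i) * q).
  elim: k => [|k IH] kn.
    rewrite big_geq // (_ : E 0%N = set0) /pr ?measure0 //.
    by apply/seteqP; split=> // x [_]; rewrite /= big_geq.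
  rewrite big_nat_recr //=.
  pose Rest := [set x | (b < S k.+1 n x)%N].
  have dRest : determined Z k.+1 n Rest.
    exact: (determined_sum w (fun s => (b < s)%N) _ _).
  have mRest := determined_measurable dRest.
  have sub : E k.+1 `<=` E k `|` (FP k `&` Rest).
    move=> x [H1 H2]; have [H|H] := ltnP a (S 0 k x); first by left.
    right; split=> //=.
    have Sn : S 0 n x = (S 0 k.+1 x + S k.+1 n x)%N by rewrite -big_cat_nat.
    by move: H1 (wu (Z k x)) => /=; rewrite Sn SS /Rest /=; lia.
  have mFR : measurable (FP k `&` Rest) by exact: measurableI.
  apply: le_trans (pr_le P1 (mE k.+1) (measurableU _ _ (mE k) mFR) sub) _.
  apply: le_trans (pr_setU P1 (mE k) mFR) _.
  apply: lerD; first by apply: IH; exact: ltnW.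
  have kk : (0 < k.+1 <= k.+1)%N by rewrite /=.
  have := mixing_upper kk (dFP k) dRest; rewrite subnn => /le_trans; apply.
  rewrite ler_wpM2l ?addr_ge0 // ler_wpM2l ?pr_ge0 //.
  rewrite /q; apply: (pr_le P1 mRest (mS n (fun s => (b < s)%N))) => x /= H.
  by apply: leq_trans H _; rewrite [leqRHS](big_cat_nat (n := k.+1)) //= leq_addl.
have -> : [set x | (a + b + u < S 0 n x)%N] = E n.
  by apply/seteqP; split=> x /=; [move=> H; split=> //; lia|case].
apply: le_trans (step n (leqnn n)) _.
rewrite -mulr_sumr ler_wpM2l ?addr_ge0 // -mulr_suml sumFP.
exact: lexx.
Qed.

End FirstPassage.

End MixingProcess.

(** * Trimmed sums *)

Definition trimmed_sum (p : nat -> nat) (n : nat) : nat :=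
  (\sum_(i < n) p i - \max_(i < n) p i)%N.

Lemma trimmed_sum_ext (p p' : nat -> nat) n :
  (forall i, (i < n)%N -> p i = p' i) -> trimmed_sum p n = trimmed_sum p' n.
Proof.
move=> pp'; rewrite /trimmed_sum; congr (_ - _)%N; apply: eq_bigr => i _;
exact: pp'.
Qed.

Lemma max_le_sum (p : nat -> nat) n : (\max_(i < n) p i <= \sum_(i < n) p i)%N.
Proof. by apply/bigmax_leqP => i _; rewrite (bigD1 i) //= leq_addr. Qed.

Lemma trimmed_sumK (p : nat -> nat) n :
  (trimmed_sum p n + \max_(i < n) p i = \sum_(i < n) p i)%N.
Proof. by rewrite subnK // max_le_sum. Qed.

(** Of the new term and the old maximum, the smaller one is kept. *)
Lemma trimmed_sumS (p : nat -> nat) n :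
  trimmed_sum p n.+1 = (trimmed_sum p n + minn (p n) (\max_(i < n) p i))%N.
Proof.
rewrite {1}/trimmed_sum !big_ord_recr /=.
have := trimmed_sumK p n; set M := \max_(_ < n) _; set S := (\sum_(_ < n) _)%N.
lia.
Qed.

Lemma trimmed_sum_mono (p : nat -> nat) :
  {homo trimmed_sum p : m n / (m <= n)%N}.
Proof.
apply: homo_leq => // [x y z|n]; first exact: leq_trans.
by rewrite trimmed_sumS leq_addr.
Qed.

(** Truncating all the terms at c leaves at most c of the trimmed maximum. *)
Lemma trimmed_sum_ge (p : nat -> nat) n c :
  (\sum_(i < n) minn (p i) c <= trimmed_sum p n + c)%N.
Proof.
elim: n => [|n IH]; first by rewrite big_ord0.
rewrite big_ord_recr /= trimmed_sumS.
have : (\sum_(i < n) minn (p i) c <= trimmed_sum p n +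
        minn c (\max_(i < n) p i))%N \/ (p n <= \max_(i < n) p i)%N.
  have [cM|Mc] := leqP c (\max_(i < n) p i); first by left.
  left; rewrite trimmed_sumK; apply: leq_sum => i _; exact: geq_minl.
move: IH; set S := (\sum_(_ < n) _)%N; set M := \max_(_ < n) _; lia.
Qed.

(** If at most one term exceeds u, then trimming removes it, and the others
split into the part below c and the excess over c. *)
Lemma trimmed_sum_le (p : nat -> nat) n c u :
  (\sum_(0 <= i < n) (u < p i) <= 1)%N ->
  (trimmed_sum p n <= \sum_(0 <= i < n) minn (p i) c +
     \sum_(0 <= i < n) (if (p i <= u)%N then p i - c else 0))%N.
Proof.
elim: n => [|n IH]; first by rewrite /trimmed_sum big_ord0.
rewrite !big_nat_recr //= trimmed_sumS; case: (leqP (p n) u) => pu /=.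
  rewrite addn0 => /IH; have := geq_minl (p n) (\max_(i < n) p i); lia.
rewrite addn1 ltnS leqn0 => /eqP S0.
have /IH H : (\sum_(0 <= i < n) (u < p i) <= 1)%N by rewrite S0.
suff H' : (\sum_(i < n) p i <= \sum_(0 <= i < n) minn (p i) c +
     \sum_(0 <= i < n) (if (p i <= u)%N then p i - c else 0))%N.
  rewrite -trimmed_sumK in H'.
  have := geq_minr (p n) (\max_(i < n) p i); move: H'.
  set A := (\sum_(_ <= _ < _) minn _ _)%N; set B := (\sum_(_ <= _ < _) _)%N.
  set M := \max_(_ < _) _; lia.
rewrite -big_split /= big_mkord; apply: leq_sum => i _.
have : (u < p i)%N = false.
  apply/negbTE; move: S0; rewrite big_mkord => /eqP; rewrite sum_nat_eq0.
  by move=> /forallP /(_ i); rewrite eqb0.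
by move=> /negbT; rewrite -leqNgt => ->; lia.
Qed.

Lemma sum_ltn_minn (R : pzSemiRingType) v c :
  \sum_(0 <= s < c) (s < v)%:R = (minn v c)%:R :> R.
Proof.
elim: c => [|c IH]; first by rewrite big_geq // minn0.
rewrite big_nat_recr //= IH -natrD; congr (_%:R).
by case: (ltnP c v) => H /=; lia.
Qed.

(** The value maxn s s' = k is taken by 2 k + 1 pairs; this is the formula for the
second moment in terms of the tail. *)
Lemma sum_tail_max (R : numDomainType) (t : nat -> R) c :
  \sum_(0 <= s < c) \sum_(0 <= s' < c) t (maxn s s') =
  \sum_(0 <= s < c) (2 * s%:R + 1) * t s.
Proof.
elim: c => [|c IH]; first by rewrite !big_geq.
rewrite big_nat_recr //= [in RHS]big_nat_recr //= -IH.
have row : \sum_(0 <= s' < c.+1) t (maxn c s') = c.+1%:R * t c.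
  rewrite (eq_big_nat _ _ (F2 := fun=> t c)) => [|i /andP[_ ic]].
    by rewrite big_const_nat iter_addr_0 subn0 mulr_natl.
  by rewrite (maxn_idPl _) // -ltnS.
have col : \sum_(0 <= s < c) \sum_(0 <= s' < c.+1) t (maxn s s') =
    \sum_(0 <= s < c) \sum_(0 <= s' < c) t (maxn s s') + c%:R * t c.
  rewrite (eq_big_nat _ _ (F2 := fun s => \sum_(0 <= s' < c) t (maxn s s') + t c)).
    rewrite big_split /=; congr (_ + _).
    by rewrite big_const_nat iter_addr_0 subn0 mulr_natl.
  by move=> s /andP[_ sc]; rewrite big_nat_recr //= (maxn_idPr _) // ltnW.
rewrite row col -natr1; ring.
Qed.

(** Each distance h >= 1 occurs at most twice among the distances to i. *)
Lemma sum_distance (R : numDomainType) (psi : nat -> R) n i :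
  (forall k, 0 <= psi k) -> (i < n)%N ->
  \sum_(0 <= j < n) (if j == i then 0 else psi (maxn i j - minn i j)%N) <=
  2 * \sum_(0 <= h < n) psi h.+1.
Proof.
move=> psi0 ni.
have half m : (m <= n)%N ->
    \sum_(0 <= h < m) psi h.+1 <= \sum_(0 <= h < n) psi h.+1.
  by move=> mn; rewrite [leRHS](big_cat_nat (n := m)) //= lerDl sumr_ge0.
rewrite (big_cat_nat (n := i)) //= ?(ltnW ni) //.
rewrite [X in _ + X](big_cat_nat (n := i.+1)) //= big_nat1 eqxx add0r.
rewrite mulr_natl mulr2n; apply: lerD.
  apply: le_trans (half i (ltnW ni)); rewrite [leRHS]big_nat_rev /= add0n.
  apply: ler_sum_nat => j /andP[_ ji].
  rewrite ltn_eqF // (maxn_idPl _) ?(minn_idPr _) ?(ltnW ji) //.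
  by have -> : (i - j = (i - j.+1).+1)%N by lia.
apply: le_trans (half (n - i.+1)%N (leq_subr _ _)).
rewrite -{1}[i.+1]add0n big_addn; apply: ler_sum_nat => j _.
rewrite gtn_eqF ?(maxn_idPr _) ?(minn_idPl _) //; try lia.
by have -> : (j + i.+1 - i = j.+1)%N by lia.
Qed.

(** * Deviation bounds *)

Section Deviations.
Context d (X : measurableType d) (R : realType) (P : {measure set X -> \bar R}).
Context (Z : nat -> X -> nat) (psi : nat -> R) (mp : mixing_process P Z psi).
Local Notation pr := (pr P).
Local Notation P1 := (mp_total mp).
Let psi0 : forall n, 0 <= psi n := mp_psi_ge0 mp.
Variable f : nat -> nat.

Definition code_tail (s : nat) : R := pr [set x | (s < f (Z 0%N x))%N].
Local Notation T := code_tail.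
Local Notation LT := (partial_sum code_tail).

Definition mixing_sum (n : nat) : R := \sum_(0 <= h < n) psi h.+1.

Lemma code_tail_ge0 s : 0 <= T s.
Proof. exact: pr_ge0. Qed.

Lemma code_partial_sum_ge0 c : 0 <= LT c.
Proof. by apply: sumr_ge0 => s _; exact: code_tail_ge0. Qed.

(** The truncation of f(Z_i) at c counts the levels s < c that it exceeds, so
sums of truncated terms count events of this form. *)
Let A (q : nat * nat) : set X := [set x | (q.2 < f (Z q.1 x))%N].

Let A_coord i s : A (i, s) = Z i @^-1` [set v | (s < f v)%N].
Proof. by []. Qed.

Let mA q : measurable (A q).
Proof. by case: q => i s; rewrite A_coord; exact: (measurable_coord mp). Qed.

Let prA i s : pr (A (i, s)) = T s.
Proof. by rewrite A_coord (mp_stationary mp). Qed.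

Let A_indic i s x : \1_(A (i, s)) x = (s < f (Z i x))%:R :> R.
Proof.
rewrite indicE; congr ((nat_of_bool _)%:R).
by apply/idP/idP; rewrite inE.
Qed.

Let pairs n c c' := [seq (i, s) | i <- index_iota 0 n, s <- index_iota c c'].

Let count_pairs n c c' x : (c <= c')%N ->
  \sum_(q <- pairs n c c') \1_(A q) x =
  (\sum_(0 <= i < n) (minn (f (Z i x)) c' - minn (f (Z i x)) c))%:R :> R.
Proof.
move=> cc; rewrite /pairs big_allpairs natr_sum; apply: eq_bigr => i _.
rewrite natrB; last by lia.
rewrite -!sum_ltn_minn (big_cat_nat (m := 0%N) (n := c) (p := c')) //= [X in X - _]addrC addrK.
by apply: eq_bigr => s _; exact: A_indic.
Qed.

Let pr_pairs n c c' : (c <= c')%N ->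
  \sum_(q <- pairs n c c') pr (A q) = n%:R * (LT c' - LT c).
Proof.
move=> cc; rewrite /pairs big_allpairs.
rewrite (eq_bigr (fun=> LT c' - LT c)) => [|i _].
  by rewrite big_const_nat iter_addr_0 subn0 mulr_natl.
rewrite /partial_sum (big_cat_nat (m := 0%N) (n := c) (p := c')) //= [X in X - _]addrC addrK.
by apply: eq_bigr => s _; exact: prA.
Qed.

Lemma some_exceeds n u :
  pr [set x | (0 < \sum_(0 <= i < n) (u < f (Z i x)))%N] <= n%:R * T u.
Proof.
have mB : measurable [set x | (0 < \sum_(0 <= i < n) (u < f (Z i x)))%N].
  apply: (determined_measurable mp).
  exact: (determined_sum (fun v => nat_of_bool (u < f v)%N) (fun s => (0 < s)%N) _ _).
rewrite -[leLHS]mul1r.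
have -> : n%:R * T u = \sum_(q <- pairs n u u.+1) pr (A q).
  by rewrite pr_pairs // /partial_sum big_nat_recr //= addrC addrK.
apply: (markov_count P1 mA) => // x H; rewrite count_pairs //.
rewrite ler1n; apply: leq_trans H _; apply: leq_sum => i _.
by case: (ltnP u (f (Z i x))) => /=; lia.
Qed.

(** The first passage inequality for the number of terms that exceed u, with
a = b = 0 and terms bounded by 1. *)
Lemma two_exceed n u :
  pr [set x | (1 < \sum_(0 <= i < n) (u < f (Z i x)))%N] <=
  (1 + psi 1) * (n%:R * T u) ^+ 2.
Proof.
have wu v : (nat_of_bool (u < f v)%N <= 1)%N by case: (_ < _)%N.
have := first_passage mp wu 0 0 n; rewrite !add0n => /le_trans; apply.
rewrite ler_wpM2l ?addr_ge0 // -expr2 ler_pXn2r ?nnegrE ?pr_ge0 //.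
- exact: some_exceeds.
- by rewrite mulr_ge0 // code_tail_ge0.
Qed.

(** Two first passages lead from 5 u to 3 u and from there to u.  Each of the
resulting three factors P(S > u) is bounded by the Markov inequality. *)
Lemma middle_excess n c u t : (0 < u)%N -> (c <= t)%N -> (u <= t)%N ->
  pr [set x | (5 * u < \sum_(0 <= i < n)
    (if (f (Z i x) <= u)%N then f (Z i x) - c else 0))%N] <=
  (1 + psi 1) ^+ 2 * (n%:R * (LT t - LT c) / u%:R) ^+ 3.
Proof.
move=> u0 ct ut; pose w v := (if f v <= u then f v - c else 0)%N.
have wu v : (w v <= u)%N by rewrite /w; case: (leqP (f v) u) => /=; lia.
pose S x := (\sum_(0 <= i < n) w (Z i x))%N.
set q := n%:R * (LT t - LT c) / u%:R.
have mS b : measurable [set x | (b < S x)%N].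
  apply: (determined_measurable mp).
  exact: (determined_sum w (fun s => (b < s)%N) _ _).
have u0' : 0 < u%:R :> R by rewrite ltr0n.
have pq : pr [set x | (u < S x)%N] <= q.
  rewrite /q ler_pdivlMr // mulrC -pr_pairs //.
  apply: (markov_count P1 mA) => // x H; rewrite count_pairs //.
  rewrite ler_nat; apply: leq_trans (ltnW H) _; apply: leq_sum => i _.
  by rewrite /w; case: (leqP (f (Z i x)) u) => /=; lia.
have q0 : 0 <= q by apply: le_trans pq; exact: pr_ge0.
have K0 : 0 <= 1 + psi 1 by rewrite addr_ge0.
have -> : (5 * u = (u + u + u) + u + u)%N by lia.
apply: le_trans (first_passage mp wu _ _ n) _.
rewrite expr2 -mulrA; apply: ler_wpM2l => //.
rewrite exprSr mulrA; apply: ler_pM; rewrite ?pr_ge0 //.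
apply: le_trans (first_passage mp wu _ _ n) _.
by rewrite ler_wpM2l // expr2 ler_pM ?pr_ge0.
Qed.

(** The Chebyshev inequality for the number of pairs (i, s) with s < c and
s < f(Z_i).  Pairs with the same i contribute the second moment, pairs with
different i contribute at most 1 + psi(distance) times the product of their
probabilities. *)
Lemma low_deviation n c (u : R) : 0 <= u ->
  u ^+ 2 * pr [set x | u <=
    `|(\sum_(0 <= i < n) minn (f (Z i x)) c)%:R - n%:R * LT c| ] <=
  n%:R * (\sum_(0 <= s < c) (2 * s%:R + 1) * T s) +
  2 * n%:R * LT c ^+ 2 * mixing_sum n.
Proof.
move=> u0; set B := [set x | _].
have mB : measurable B.
  apply: (determined_measurable mp).
  exact: (determined_sum (fun v => minn (f v) c) (fun s => u <= `|s%:R - n%:R * LT c|) _ _).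
have ME : n%:R * LT c = \sum_(q <- pairs n 0 c) pr (A q).
  by rewrite pr_pairs // [in RHS]/partial_sum (big_geq (leqnn 0)) subr0.
have BN x : B x -> u <= `|\sum_(q <- pairs n 0 c) \1_(A q) x - n%:R * LT c|.
  rewrite count_pairs // /B /=; congr (u <= `|_%:R - _|).
  by apply: eq_bigr => i _; rewrite minn0 subn0.
have := chebyshev_count P1 mA u0 mB ME BN.
set V := \sum_(0 <= s < c) _.
have V0 : 0 <= V.
  apply: sumr_ge0 => s _; apply: mulr_ge0; last exact: code_tail_ge0.
  exact: addr_ge0 (mulr_ge0 (ler0n _ _) (ler0n _ _)) ler01.
pose G i i' := \sum_(0 <= s < c) \sum_(0 <= s' < c) pr (A (i, s) `&` A (i', s')).
have L2 : \sum_(0 <= s < c) \sum_(0 <= s' < c) T s * T s' = LT c ^+ 2.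
  rewrite expr2 {1}/partial_sum mulr_suml; apply: eq_bigr => s _.
  by rewrite mulr_sumr.
have Glt i i' : (i < i')%N -> G i i' <= (1 + psi (i' - i)) * LT c ^+ 2.
  move=> ii'; rewrite -L2 mulr_sumr; apply: ler_sum_nat => s _.
  rewrite mulr_sumr; apply: ler_sum_nat => s' _.
  exact: (@mixing_coord _ _ _ _ _ _ mp i i'
    [set v | (s < f v)%N] [set v | (s' < f v)%N] ii').
have Gsym i i' : G i i' = G i' i.
  rewrite /G exchange_big /=; apply: eq_bigr => s _; apply: eq_bigr => s' _.
  by rewrite setIC.
have Gb i i' : G i i' <= LT c ^+ 2 + (if i' == i then V else 0) +
    (if i' == i then 0 else psi (maxn i i' - minn i i')) * LT c ^+ 2.
  have L0 : 0 <= LT c ^+ 2 by exact: sqr_ge0.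
  have [ii'|ii'|<-] := ltngtP i i'.
  - by apply: le_trans (Glt _ _ ii') _; lra.
  - by rewrite Gsym; apply: le_trans (Glt _ _ ii') _; lra.
  - suff -> : G i i = V by lra.
    rewrite /V -sum_tail_max; apply: eq_bigr => s _; apply: eq_bigr => s' _.
    rewrite -(prA i); congr pr; apply/seteqP; split=> x /=.
      by rewrite /A /= => -[H H']; rewrite gtn_max H H'.
    by rewrite /A /= gtn_max => /andP[].
have -> : \sum_(q <- pairs n 0 c) \sum_(q' <- pairs n 0 c) pr (A q `&` A q') =
    \sum_(0 <= i < n) \sum_(0 <= i' < n) G i i'.
  rewrite /pairs big_allpairs; apply: eq_bigr => i _.
  rewrite exchange_big big_allpairs; apply: eq_bigr => i' _.
  by rewrite /G exchange_big.
have row i : (i < n)%N -> \sum_(0 <= i' < n) G i i' <=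
    n%:R * LT c ^+ 2 + V + 2 * mixing_sum n * LT c ^+ 2.
  move=> ni; apply: le_trans (ler_sum_nat (fun i' _ => Gb i i')) _.
  have constE : \sum_(0 <= i' < n) LT c ^+ 2 = n%:R * LT c ^+ 2.
    by rewrite big_const_nat iter_addr_0 subn0 mulr_natl.
  rewrite !big_split /= constE -mulr_suml; apply: lerD; last first.
    by rewrite ler_wpM2r ?sqr_ge0 ?sum_distance.
  by rewrite lerD2l -big_mkcond /= big_mkord (big_pred1 (Ordinal ni)).
have : \sum_(0 <= i < n) \sum_(0 <= i' < n) G i i' <=
    n%:R * (n%:R * LT c ^+ 2 + V + 2 * mixing_sum n * LT c ^+ 2).
  have := @sum_le_const R 0 n _ _ (fun i H => row i (andP H).2).
  by rewrite subn0.
rewrite exprMn; lra.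
Qed.

End Deviations.

(** * The trimmed law along a ladder *)

Lemma power16_absorbs (R : realType) (A e : R) : 0 < e ->
  exists a : nat, A <= e * 16 ^+ a.
Proof.
move=> e0; exists (Num.truncn `|A / e|).+1.
have /andP[_ /ltW H] := truncn_itv (normr_ge0 (A / e)).
rewrite mulrC -ler_pdivrMr //; apply: le_trans (ler_norm _) (le_trans H _).
by rewrite -natrX ler_nat ltnW // ltn_expl.
Qed.

Section TrimmedLaw.
Context d (X : measurableType d) (R : realType) (P : {measure set X -> \bar R}).
Context (Z : nat -> X -> nat) (psi : nat -> R) (mp : mixing_process P Z psi).
Hypothesis psi_sum : bounded_sums (fun n => psi n.+1 / n.+1%:R).
Context (tau : nat -> R) (rt : regular_tail tau).
Local Notation pr := (pr P).
Local Notation P1 := (mp_total mp).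
Local Notation L := (partial_sum tau).
Let psi0 : forall n, 0 <= psi n := mp_psi_ge0 mp.
Variables (f : nat -> nat) (C kap : R).
Local Notation T := (code_tail P Z f).
Local Notation LT := (partial_sum T).
Hypothesis C0 : 0 <= C.
Hypothesis TC : forall s, T s <= C * tau s.
Hypothesis kap0 : 0 <= kap.
Hypothesis LTkap : forall e : R, 0 < e ->
  exists D : R, forall n, `|LT n - kap * L n| <= e * L n + D.

Section FixedLadder.
Variables (j : nat) (j0 : (0 < j)%N).
Local Notation t := (ladder j).
Local Notation n_ := (ladder_time tau j).
Local Notation q := (regular_ratio tau j).

Let t0 k : 0 < (t k)%:R :> R.
Proof. by rewrite ltr0n ladder_gt0. Qed.

Let L0 k : 0 < L (t k).
Proof. by apply: L_gt0 => //; exact: ladder_gt0. Qed.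

Lemma ladder_timeL k : (n_ k)%:R * L (t k) <= (t k)%:R.
Proof.
rewrite -[leRHS](time_scale_mulL rt) ler_wpM2r ?(ltW (L0 k)) //.
by have /andP[] := ladder_time_itv rt j k.
Qed.

(** Since (2^r q)^3 = q^2 (8^r q) <= q^2, and q_k tends to 0. *)
Lemma depth_small (e : R) : 0 < e -> \forall k \near \oo, forall r,
  q k * 8 ^+ r <= 1 -> q k * 2 ^+ r <= e.
Proof.
move=> e0; have e20 : 0 < e ^+ 2 * e by rewrite mulr_gt0 ?exprn_gt0.
near=> k => r qr.
have q0 : 0 <= q k by exact: regular_ratio_ge0.
have qe : q k < Num.min 1 (e ^+ 3).
  near: k; apply: regular_ratio_small => //.
  by rewrite lt_min ltr01 exprn_gt0.
have : (q k * 2 ^+ r) ^+ 3 <= e ^+ 3.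
  have -> : (q k * 2 ^+ r) ^+ 3 = q k ^+ 2 * (q k * 8 ^+ r).
    have -> : (8 : R) = 2 ^+ 3 by rewrite -natrX.
    by rewrite -exprM mulnC exprM; ring.
  move: qe; rewrite lt_min => /andP[q1 q3].
  have : q k ^+ 2 <= q k by rewrite expr2 ler_piMr // ltW.
  have := sqr_ge0 (q k); nra.
by rewrite ler_pXn2r // ?nnegrE ?(ltW e0) // mulr_ge0 // exprn_ge0.
Unshelve. all: by end_near. Qed.

(** Truncation at t_i instead of t_k changes L by a relative amount of at most
2^r q_k, which tends to 0; the mean is then n_k kap L(t_k) ~ kap t_k. *)
Lemma truncated_mean (e : R) : 0 < e -> \forall k \near \oo, forall i r,
  k = (i + r)%N -> q k * 8 ^+ r <= 1 ->
  `|(n_ k)%:R * LT (t i) - kap * (t k)%:R| <= e * (t k)%:R.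
Proof.
move=> e0; pose e1 := e / (4 * (1 + kap)).
have k1 : 0 < 4 * (1 + kap) by rewrite mulr_gt0 ?ltr_wpDr.
have e10 : 0 < e1 by rewrite divr_gt0.
have eE : 4 * e1 + 4 * (kap * e1) = e.
  by rewrite /e1; field; rewrite gt_eqF // ltr_wpDr.
have [D HD] := LTkap e10.
have [m Hm] := tail_divergent rt (D / e1).
near=> k => i r kir qr.
have H1 : (1 - e1) * time_scale tau (t k) <= (n_ k)%:R.
  by near: k; exact: ladder_time_ge.
have H2 : q k * 2 ^+ r <= e1.
  by move: r qr {kir}; near: k; exact: depth_small.
have H3 : D <= e1 * L (t k).
  have mk : (m <= k)%N by near: k; exact: nbhs_infty_ge.
  rewrite mulrC -ler_pdivrMr //; apply: le_trans Hm _; apply: L_mono => //.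
  by apply: leq_trans mk _; exact: ladder_ge.
have H4 := ladder_timeL k.
have tE := time_scale_mulL rt (t k).
have Li : L (t i) <= L (t k).
  by apply: L_mono => //; apply: ladder_mono; rewrite kir leq_addr.
have gap : L (t k) * (1 - e1) <= L (t i).
  have := partial_sum_gap rt j0 i r; rewrite -kir -mulrA => gap.
  have : q k * (2 ^+ r - 1) <= e1.
    apply: le_trans H2; rewrite ler_wpM2l //; first exact: regular_ratio_ge0.
    by rewrite lerBlDr lerDl.
  by move=> /(ler_wpM2l (ltW (L0 k))); lra.
have n0 : 0 <= (n_ k)%:R :> R by [].
have up : (n_ k)%:R * L (t i) <= (t k)%:R.
  by apply: le_trans H4; rewrite ler_wpM2l.
have lo : (1 - 2 * e1) * (t k)%:R <= (n_ k)%:R * L (t i).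
  have := ler_wpM2l n0 gap; have := ler_wpM2r (ltW (L0 k)) H1.
  rewrite -mulrA tE; have := ltW (t0 k).
  have : (n_ k)%:R * L (t k) * e1 <= (t k)%:R * e1 by rewrite ler_wpM2r // ltW.
  lra.
have := ler_wpM2l n0 (HD (t i)).
have -> : (n_ k)%:R * `|LT (t i) - kap * L (t i)| =
    `|(n_ k)%:R * LT (t i) - kap * ((n_ k)%:R * L (t i))|.
  by rewrite -[X in X * `|_|]ger0_norm // -normrM; congr `|_|; ring.
rewrite ler_norml => /andP[A1 A2].
have nD : (n_ k)%:R * D <= e1 * (t k)%:R.
  apply: le_trans (ler_wpM2l n0 H3) _.
  by rewrite mulrCA ler_wpM2l // ltW.
have := ler_wpM2l (ltW e10) up; have := ler_wpM2l kap0 up.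
have := ler_wpM2l kap0 lo; have := ltW (t0 k).
have -> : kap * ((1 - 2 * e1) * (t k)%:R) = kap * (t k)%:R - 2 * (kap * e1) * (t k)%:R.
  by ring.
have := mulr_ge0 (mulr_ge0 kap0 (ltW e10)) (ltW (t0 k)).
rewrite -eE ler_distl => B1 B2 B3 B4 B5; apply/andP; split; lra.
Unshelve. all: by end_near. Qed.

Lemma trimmed_sum_measurable n (Q : nat -> Prop) :
  measurable [set x | Q (trimmed_sum (fun i => f (Z i x)) n)].
Proof.
apply: (determined_measurable mp (m := 0%N) (n := n)) => x y xy /=.
by rewrite (@trimmed_sum_ext _ (fun i => f (Z i y))) // => i /xy ->.
Qed.

(** The variance ratio at the level t_i is at most q_i <= 2^r q_k, and the level
itself is 16^-r t_k; the choice of r bounds the product 8^-r q_k by 8 q_k^2. *)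
Lemma low_bound (a k i r : nat) : (a <= k)%N -> k = (i + r)%N ->
  (0 < n_ k)%N -> 1 <= 8 ^+ r.+1 * q k ->
  pr [set x | (t (k - a))%:R <= `|(\sum_(0 <= l < n_ k)
       minn (f (Z l x)) (t i))%:R - (n_ k)%:R * LT (t i)| ] <=
  8 * C * 16 ^+ a ^+ 2 * q k ^+ 2 +
  2 * C ^+ 2 * 16 ^+ a ^+ 2 * (mixing_sum psi (n_ k) / (n_ k)%:R).
Proof.
move=> ak kir n0 q8; set u := (t (k - a))%:R.
have u0 : 0 < u by exact: t0.
have tu : (t k)%:R = 16 ^+ a * u :> R by exact: ladderB.
have ti : (t k)%:R = 16 ^+ r * (t i)%:R :> R.
  by rewrite -natrX -natrM !ladderE mulnCA -expnD kir addnC.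
rewrite -(ler_pM2l (exprn_gt0 2 u0)).
apply: le_trans (low_deviation mp f (n_ k) (t i) (ltW u0)) _.
have nn : 0 < (n_ k)%:R :> R by rewrite ltr0n.
have nL := ladder_timeL k; have Lk := L0 k; have Li := L0 i.
have LL : L (t i) <= L (t k).
  by apply: L_mono => //; apply: ladder_mono; rewrite kir leq_addr.
have nLi : (n_ k)%:R * L (t i) <= (t k)%:R.
  by apply: le_trans nL; rewrite ler_wpM2l.
have LTL s : LT s <= C * L s.
  by rewrite /partial_sum mulr_sumr; apply: ler_sum_nat => l _; exact: TC.
have Psi0 : 0 <= mixing_sum psi (n_ k) by rewrite sumr_ge0.
rewrite mulrDr; apply: lerD.
- have qi : q i <= 2 ^+ r * q k.
    by rewrite kir; exact: regular_ratio_double.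
  have Qi := second_le_regular_ratio rt j0 i.
  have V : \sum_(0 <= s < t i) (2 * s%:R + 1) * T s <=
      C * (q i * ((t i)%:R * L (t i))).
    apply: (@le_trans _ _ (C * \sum_(0 <= s < t i) (2 * s%:R + 1) * tau s)).
      rewrite mulr_sumr; apply: ler_sum_nat => s _.
      rewrite mulrCA; apply: ler_wpM2l; last exact: TC.
      exact: addr_ge0 (mulr_ge0 (ler0n _ _) (ler0n _ _)) ler01.
    rewrite ler_wpM2l // -ler_pdivrMr ?mulr_gt0 //.
  apply: le_trans (ler_wpM2l (ltW nn) V) _.
  have -> : (n_ k)%:R * (C * (q i * ((t i)%:R * L (t i)))) =
      C * (q i * (t i)%:R * ((n_ k)%:R * L (t i))) by ring.
  have -> : u ^+ 2 * (8 * C * 16 ^+ a ^+ 2 * q k ^+ 2) =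
      C * (8 * q k ^+ 2 * (16 ^+ a * u) * (16 ^+ a * u)) by ring.
  rewrite -tu; apply: ler_wpM2l => //; apply: ler_pM => //.
  + by rewrite mulr_ge0 // (regular_ratio_ge0 rt).
  + by rewrite mulr_ge0 // ltW.
  have qk0 := regular_ratio_ge0 rt j0 k.
  rewrite ti.
  have -> : (16 : R) ^+ r = 8 ^+ r * 2 ^+ r.
    by rewrite -exprMn -natrM.
  have r2 : 0 <= (2 : R) ^+ r by rewrite exprn_ge0.
  have : 2 ^+ r * q k <= 8 * q k ^+ 2 * (8 ^+ r * 2 ^+ r).
    have := ler_wpM2l (mulr_ge0 r2 qk0) q8; rewrite exprS mulr1.
    by move=> /le_trans; apply; rewrite le_eqVlt; apply/orP; left; apply/eqP; ring.
  move=> /(le_trans qi) /(ler_wpM2r (ler0n R (t i))); lra.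
- have L2 : LT (t i) ^+ 2 <= C ^+ 2 * L (t k) ^+ 2.
    rewrite -exprMn ler_pXn2r ?nnegrE ?code_partial_sum_ge0 ?mulr_ge0 ?(ltW Lk) //.
    by apply: le_trans (LTL _) _; rewrite ler_wpM2l.
  have : (n_ k)%:R * L (t k) ^+ 2 * (n_ k)%:R <= (16 ^+ a * u) ^+ 2.
    have -> : (n_ k)%:R * L (t k) ^+ 2 * (n_ k)%:R = ((n_ k)%:R * L (t k)) ^+ 2.
      by ring.
    rewrite -tu ler_pXn2r ?nnegrE ?mulr_ge0 ?(ltW Lk) //.
  rewrite -ler_pdivlMr // => H.
  have -> : u ^+ 2 * (2 * C ^+ 2 * 16 ^+ a ^+ 2 *
      (mixing_sum psi (n_ k) / (n_ k)%:R)) =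
      2 * C ^+ 2 * mixing_sum psi (n_ k) * ((16 ^+ a * u) ^+ 2 / (n_ k)%:R).
    by ring.
  have w0 : 0 <= 2 * C ^+ 2 * mixing_sum psi (n_ k).
    exact: mulr_ge0 (mulr_ge0 (ler0n _ _) (sqr_ge0 _)) Psi0.
  apply: le_trans (ler_wpM2l w0 H).
  have v0 : 0 <= 2 * (n_ k)%:R * mixing_sum psi (n_ k).
    exact: mulr_ge0 (mulr_ge0 (ler0n _ _) (ler0n _ _)) Psi0.
  have := ler_wpM2l v0 L2; lra.
Qed.

(** The Markov bound for the excess over t_i is of order 2^r q_k, and the cube of
this is at most q_k^2 by the choice of r. *)
Lemma middle_bound (a k i r : nat) : (a <= k)%N -> k = (i + r)%N ->
  q k * 8 ^+ r <= 1 ->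
  pr [set x | (5 * t (k - a) < \sum_(0 <= l < n_ k)
     (if (f (Z l x) <= t (k - a))%N then f (Z l x) - t i else 0))%N] <=
  (1 + psi 1) ^+ 2 * (C * 16 ^+ a) ^+ 3 * q k ^+ 2.
Proof.
move=> ak kir q8; set u := t (k - a).
have u0 : 0 < u%:R :> R by exact: t0.
have tu : (t k)%:R = 16 ^+ a * u%:R :> R by exact: ladderB.
have ik : (t i <= t k)%N by apply: ladder_mono; rewrite kir leq_addr.
have uk : (u <= t k)%N by apply: ladder_mono; rewrite leq_subr.
have u0' : (0 < u)%N by exact: ladder_gt0.
apply: le_trans (middle_excess mp f (n_ k) u0' ik uk) _.
have K0 : 0 <= (1 + psi 1) ^+ 2 by exact: sqr_ge0.
rewrite -[leRHS]mulrA; apply: ler_wpM2l => //.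
have qk0 := regular_ratio_ge0 rt j0 k.
have Cu0 : 0 <= C * 16 ^+ a by rewrite mulr_ge0 // exprn_ge0.
have main : (n_ k)%:R * (LT (t k) - LT (t i)) / u%:R <= C * 16 ^+ a * (q k * 2 ^+ r).
  rewrite ler_pdivrMr //.
  have LTL : LT (t k) - LT (t i) <= C * (L (t k) - L (t i)).
    rewrite !(L_split _ ik) ![_ + _ - _]addrAC !subrr !add0r mulr_sumr.
    by apply: ler_sum_nat => l _; exact: TC.
  apply: le_trans (ler_wpM2l (ler0n R (n_ k)) LTL) _.
  have := partial_sum_gap rt j0 i r; rewrite -kir => gap.
  have gap' : L (t k) - L (t i) <= L (t k) * (q k * 2 ^+ r).
    apply: le_trans gap _; rewrite -mulrA ler_wpM2l ?(ltW (L0 k)) // ler_wpM2l //.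
    by rewrite lerBlDr lerDl.
  have := ler_wpM2l (mulr_ge0 (ler0n R (n_ k)) C0) gap'.
  have := ler_wpM2l (mulr_ge0 C0 (mulr_ge0 qk0 (exprn_ge0 r (ler0n R 2))))
    (ladder_timeL k).
  rewrite tu; lra.
have lhs0 : 0 <= (n_ k)%:R * (LT (t k) - LT (t i)) / u%:R.
  rewrite divr_ge0 // mulr_ge0 // (L_split _ ik) addrAC subrr add0r sumr_ge0 //.
  by move=> l _; exact: code_tail_ge0.
have rhs0 : 0 <= C * 16 ^+ a * (q k * 2 ^+ r).
  by rewrite mulr_ge0 // mulr_ge0 // exprn_ge0.
have : ((n_ k)%:R * (LT (t k) - LT (t i)) / u%:R) ^+ 3 <=
   (C * 16 ^+ a * (q k * 2 ^+ r)) ^+ 3 by rewrite ler_pXn2r.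
move=> /le_trans; apply; rewrite exprMn; apply: ler_wpM2l; first exact: exprn_ge0.
have -> : (q k * 2 ^+ r) ^+ 3 = q k ^+ 2 * (q k * 8 ^+ r).
  have -> : (8 : R) = 2 ^+ 3 by rewrite -natrX.
  by rewrite -exprM mulnC exprM; ring.
by rewrite ler_piMr // sqr_ge0.
Qed.

Lemma tail_at_ladder (a k : nat) : (a <= k)%N ->
  (n_ k)%:R * T (t (k - a)) <= C * 16 ^+ a * tail_ratio tau (t (k - a)).
Proof.
move=> ak; set u := t (k - a).
have tu : (t k)%:R = 16 ^+ a * u%:R :> R by exact: ladderB.
have Lu : 0 < L u by exact: L0.
have Luk : L u <= L (t k).
  by apply: L_mono => //; apply: ladder_mono; rewrite leq_subr.
apply: (@le_trans _ _ ((n_ k)%:R * (C * tau u))); first by rewrite ler_wpM2l.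
rewrite /tail_ratio [leRHS]mulrA ler_pdivlMr //.
have nLu : (n_ k)%:R * L u <= 16 ^+ a * u%:R.
  by rewrite -tu; apply: le_trans (ladder_timeL k); rewrite ler_wpM2l.
have := ler_wpM2l (mulr_ge0 C0 (ltW (tail_gt0 rt u))) nLu; lra.
Qed.

(** The upper cut u = t_(k-a) satisfies 12 u <= e t_k.  Outside the three bad
events the trimmed sum differs from the truncated mean by at most u + 5 u on one
side and u + u on the other, hence by at most half of e t_k; the truncated mean
accounts for the other half. *)
Lemma trimmed_ladder_summable (e : R) : 0 < e ->
  exists v : nat -> R, [/\ forall k, 0 <= v k, bounded_sums v &
    \forall k \near \oo, pr [set x | e * (t k)%:R <
       `|(trimmed_sum (fun i => f (Z i x)) (n_ k))%:R - kap * (t k)%:R| ] <= v k].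
Proof.
move=> e0.
have [a aE] := power16_absorbs 12 e0.
pose h2 k : R := if (k < a)%N then 0 else tail_ratio tau (t (k - a)) ^+ 2.
pose v1 k := 8 * C * 16 ^+ a ^+ 2 * q k ^+ 2.
pose v2 k := 2 * C ^+ 2 * 16 ^+ a ^+ 2 * (mixing_sum psi (n_ k) / (n_ k)%:R).
pose v3 k := (1 + psi 1) ^+ 2 * (C * 16 ^+ a) ^+ 3 * q k ^+ 2.
pose v4 k := (1 + psi 1) * (C * 16 ^+ a) ^+ 2 * h2 k.
have c16 : 0 <= (16 : R) ^+ a by exact: exprn_ge0.
have Ca0 : 0 <= C * 16 ^+ a by exact: mulr_ge0.
have K0 : 0 <= 1 + psi 1 by exact: addr_ge0.
have c1 : 0 <= 8 * C * 16 ^+ a ^+ 2.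
  exact: mulr_ge0 (mulr_ge0 (ler0n _ _) C0) (sqr_ge0 _).
have c2 : 0 <= 2 * C ^+ 2 * 16 ^+ a ^+ 2.
  exact: mulr_ge0 (mulr_ge0 (ler0n _ _) (sqr_ge0 _)) (sqr_ge0 _).
have c3 : 0 <= (1 + psi 1) ^+ 2 * (C * 16 ^+ a) ^+ 3.
  exact: mulr_ge0 (sqr_ge0 _) (exprn_ge0 _ Ca0).
have c4 : 0 <= (1 + psi 1) * (C * 16 ^+ a) ^+ 2 by exact: mulr_ge0 K0 (sqr_ge0 _).
have Psi0 n : 0 <= mixing_sum psi n by exact: sumr_ge0.
have h20 k : 0 <= h2 k by rewrite /h2; case: ifP => // _; exact: sqr_ge0.
exists (fun k => v1 k + v2 k + (v3 k + v4 k)); split.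
- move=> k; apply: addr_ge0; apply: addr_ge0.
  + exact: mulr_ge0 c1 (sqr_ge0 _).
  + exact: mulr_ge0 c2 (divr_ge0 (Psi0 _) (ler0n _ _)).
  + exact: mulr_ge0 c3 (sqr_ge0 _).
  + exact: mulr_ge0 c4 (h20 k).
- apply: bounded_sumsD; apply: bounded_sumsD; apply: bounded_sumsZ => //.
  + exact: regular_ratio_sq.
  + exact: ladder_mixing_sum.
  + exact: regular_ratio_sq.
  + apply/(bounded_sums_shift a h20).
    have [M HM] := ladder_tail_ratio_sq rt j0; exists M => n.
    apply: le_trans (HM n); apply: ler_sum => i _.
    by rewrite /h2 ltnNge leq_addr /= addKn.
- near=> k.
  have ak : (a <= k)%N by near: k; exact: nbhs_infty_ge.
  have n0 : (0 < n_ k)%N by near: k; exact: ladder_time_large.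
  have [i [r [kir q8 q8']]] : exists i r, [/\ k = (i + r)%N,
      q k * 8 ^+ r <= 1 & 1 <= 8 ^+ r.+1 * q k].
    by near: k; exact: truncation_depth.
  have mean : `|(n_ k)%:R * LT (t i) - kap * (t k)%:R| <= e / 2 * (t k)%:R.
    by move: i r kir q8 {q8'}; near: k; apply: truncated_mean; lra.
  (* The lower cut lies below the upper one, since r tends to infinity. *)
  have ra : (a <= r)%N.
    rewrite leqNgt; apply/negP => ra.
    have qa : q k < (8 ^+ a.+1)^-1.
      by near: k; apply: regular_ratio_small => //; rewrite invr_gt0 exprn_gt0.
    have : 8 ^+ r.+1 * q k < 1.
      apply: le_lt_trans (_ : 8 ^+ a.+1 * q k < 1).
        rewrite ler_wpM2r ?(regular_ratio_ge0 rt) //.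
        by rewrite ler_eXn2l ?ltr1n //; lia.
      by rewrite mulrC -ltr_pdivlMr ?exprn_gt0 // div1r.
    by rewrite ltNge q8'.
  have iu : (t i <= t (k - a))%N by apply: ladder_mono; lia.
  have tu : (t k)%:R = 16 ^+ a * (t (k - a))%:R :> R by exact: ladderB.
  set Blow := [set x | (t (k - a))%:R <= `|(\sum_(0 <= l < n_ k)
       minn (f (Z l x)) (t i))%:R - (n_ k)%:R * LT (t i)| ].
  set Bmid := [set x | (5 * t (k - a) < \sum_(0 <= l < n_ k)
     (if (f (Z l x) <= t (k - a))%N then f (Z l x) - t i else 0))%N].
  set Bhigh := [set x | (1 < \sum_(0 <= l < n_ k) (t (k - a) < f (Z l x)))%N].
  have mlow : measurable Blow.
    apply: (determined_measurable mp).
    exact: (determined_sum (fun v => minn (f v) (t i))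
      (fun s => (t (k - a))%:R <= `|s%:R - (n_ k)%:R * LT (t i)|) 0 (n_ k)).
  have mmid : measurable Bmid.
    apply: (determined_measurable mp).
    exact: (determined_sum (fun v => if (f v <= t (k - a))%N then f v - t i else 0)%N
      (fun s => (5 * t (k - a) < s)%N) 0 (n_ k)).
  have mhigh : measurable Bhigh.
    apply: (determined_measurable mp).
    exact: (determined_sum (fun v => nat_of_bool (t (k - a) < f v)%N)
      (fun s => (1 < s)%N) 0 (n_ k)).
  have mB := trimmed_sum_measurable (n_ k)
    (fun s => e * (t k)%:R < `|s%:R - kap * (t k)%:R|).
  have sub : [set x | e * (t k)%:R <
      `|(trimmed_sum (fun i => f (Z i x)) (n_ k))%:R - kap * (t k)%:R| ] `<=`
      Blow `|` (Bmid `|` Bhigh).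
    move=> x /= Bx; apply: contrapT => /not_orP[nlow /not_orP[nmid nhigh]].
    move: nlow nmid nhigh; rewrite /Blow /Bmid /Bhigh /= => /negP; rewrite -ltNge.
    move=> low /negP; rewrite -leqNgt => mid /negP; rewrite -leqNgt => high.
    have up := trimmed_sum_le (t i) high.
    have lo := trimmed_sum_ge (fun l => f (Z l x)) (n_ k) (t i).
    move: low up lo; rewrite -(big_mkord xpredT (fun l => minn (f (Z l x)) (t i))).
    set S := (\sum_(0 <= l < n_ k) minn _ _)%N => low up lo.
    have {mid} up : (trimmed_sum (fun i => f (Z i x)) (n_ k))%:R <=
        S%:R + 5 * (t (k - a))%:R :> R.
      by rewrite -natrM -natrD ler_nat; apply: leq_trans up _; rewrite leq_add2l.
    have {lo} lo : S%:R <= (trimmed_sum (fun i => f (Z i x)) (n_ k))%:R +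
        (t (k - a))%:R :> R.
      by rewrite -natrD ler_nat; apply: leq_trans lo _; rewrite leq_add2l.
    move: Bx; rewrite ltNge => /negP; apply.
    have u6 : 12 * (t (k - a))%:R <= e * (t k)%:R.
      by rewrite tu mulrA ler_wpM2r.
    move: low mean; rewrite ltr_distl !ler_distl.
    move=> /andP[? ?] /andP[? ?]; apply/andP; split; lra.
  apply: le_trans (pr_le P1 mB _ sub) _.
    by apply: measurableU => //; exact: measurableU.
  apply: le_trans (pr_setU P1 mlow (measurableU _ _ mmid mhigh)) _.
  apply: lerD; first exact: (low_bound ak kir n0 q8').
  apply: le_trans (pr_setU P1 mmid mhigh) _; apply: lerD.
    exact: (middle_bound ak kir q8).
  apply: le_trans (two_exceed mp f (n_ k) (t (k - a))) _.
  rewrite /v4 -mulrA ler_wpM2l // /h2 ltnNge ak /= -exprMn.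
  rewrite ler_pXn2r // ?nnegrE; first exact: tail_at_ladder.
    exact: mulr_ge0 (ler0n _ _) (code_tail_ge0 _ _ _ _).
  exact: mulr_ge0 Ca0 (tail_ratio_ge0 rt _).
Unshelve. all: by end_near. Qed.

End FixedLadder.
End TrimmedLaw.

(** * Almost sure statements *)

Section AlmostSure.
Context d (X : measurableType d) (R : realType) (P : {measure set X -> \bar R}).
Context (Z : nat -> X -> nat) (psi : nat -> R) (mp : mixing_process P Z psi).
Local Notation pr := (pr P).
Local Notation P1 := (mp_total mp).
Let psi0 : forall n, 0 <= psi n := mp_psi_ge0 mp.

Lemma borel_cantelli (A : nat -> set X) (v : nat -> R) :
  (forall k, measurable (A k)) -> (forall k, 0 <= v k) -> bounded_sums v ->
  (\forall k \near \oo, pr (A k) <= v k) ->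
  {ae P, forall x, \forall k \near \oo, ~ A k x}.
Proof.
move=> mA v0 bv Av.
have [M HM] := bounded_sums_le (fun k => pr_ge0 P (A k)) Av v0 bv.
have PA0 : P (lim_sup_set A) = 0%E.
  apply: lim_sup_set_cvg0 => //.
  apply: (@le_lt_trans _ _ M%:E); last exact: ltry.
  apply: lime_le; first by apply: is_cvg_nneseries => n _ _; exact: measure_ge0.
  apply: nearW => n.
  rewrite (eq_bigr (fun k => (pr (A k))%:E)) => [|k _]; last exact: (prE P1).
  by rewrite sumEFin lee_fin big_mkord.
have mL : measurable (lim_sup_set A).
  by apply: bigcap_measurable => // n _; exact: bigcup_measurable.
apply: (@negligibleS _ _ _ _ (lim_sup_set A)); last exact/negligibleP.
move=> x /= nx n _; apply: contrapT => nA; apply: nx.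
by exists n => // k nk Ak; apply: nA; exists k.
Qed.

Lemma negligible_bigcap_small (B : nat -> set X) :
  (forall n, measurable (B n)) ->
  (forall e, 0 < e -> exists n, pr (B n) <= e) ->
  P.-negligible (\bigcap_n B n).
Proof.
move=> mB Be.
have mI : measurable (\bigcap_n B n) by exact: bigcapT_measurable.
suff : P (\bigcap_n B n) = 0%E by move/negligibleP; apply.
rewrite (prE P1) //; congr (_%:E).
apply/le_anti; rewrite pr_ge0 andbT; apply/ler_addgt0Pr => e e0.
have [n Hn] := Be e e0; rewrite add0r; apply: le_trans Hn.
by apply: (pr_le P1) => //; exact: bigcap_inf.
Qed.

Section Ladder.
Context (tau : nat -> R) (rt : regular_tail tau).
Variables (b : nat -> nat) (Hb : inverse_scale tau b).

(** The Borel-Cantelli lemma on countably many ladders and tolerances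
1 / (m + 1), followed by interpolation. *)
Lemma ladder_ae (F : nat -> X -> nat) (kap : R) : 0 <= kap ->
  (forall n (Q : nat -> Prop), measurable [set x | Q (F n x)]) ->
  (forall x, {homo F ^~ x : m n / (m <= n)%N}) ->
  (forall j, (0 < j)%N -> forall e : R, 0 < e -> exists v : nat -> R,
    [/\ forall k, 0 <= v k, bounded_sums v & \forall k \near \oo,
      pr [set x | e * (ladder j k)%:R <
        `|(F (ladder_time tau j k) x)%:R - kap * (ladder j k)%:R|] <= v k]) ->
  {ae P, forall x, forall e : R, 0 < e -> \forall n \near \oo,
     `|(F n x)%:R - kap * (b n)%:R| <= e * (b n)%:R}.
Proof.
move=> kap0 mF Fm Fv.
have : {ae P, forall x, forall j m : nat, \forall k \near \oo,
   ~ (m.+1%:R^-1 * (ladder j.+1 k)%:R <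
   `|(F (ladder_time tau j.+1 k) x)%:R - kap * (ladder j.+1 k)%:R|)}.
  apply/ae_foralln => j; apply/ae_foralln => m.
  have m0 : 0 < (m.+1%:R^-1 : R) by rewrite invr_gt0.
  have [v [v0 bv Hv]] := Fv j.+1 isT _ m0.
  apply: borel_cantelli Hv => // k.
  exact: (mF _ (fun s => m.+1%:R^-1 * (ladder j.+1 k)%:R <
     `|s%:R - kap * (ladder j.+1 k)%:R|)).
apply: filterS => x Hx.
apply: (scale_interpolation rt Hb kap0 (F := fun n => (F n x)%:R)).
  by move=> m n mn; rewrite ler_nat; exact: Fm.
move=> [//|j] _ e e0; pose m := Num.truncn e^-1.
have me : m.+1%:R^-1 <= e.
  rewrite -[leRHS]invrK lef_pV2 ?posrE ?invr_gt0 //.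
  by have /andP[_ /ltW] := truncn_itv (ltW (divr_gt0 ltr01 e0)); rewrite div1r.
have := Hx j m; apply: filterS => k /negP; rewrite -leNgt => /le_trans; apply.
by rewrite ler_wpM2r.
Qed.

Hypothesis psi_sum : bounded_sums (fun n => psi n.+1 / n.+1%:R).

Lemma trimmed_sum_ae (f : nat -> nat) (C kap : R) : 0 <= C -> 0 <= kap ->
  (forall s, code_tail P Z f s <= C * tau s) ->
  (forall e : R, 0 < e -> exists D : R, forall n,
     `|partial_sum (code_tail P Z f) n - kap * partial_sum tau n| <=
     e * partial_sum tau n + D) ->
  {ae P, forall x, forall e : R, 0 < e -> \forall n \near \oo,
     `|(trimmed_sum (fun i => f (Z i x)) n)%:R - kap * (b n)%:R| <=
     e * (b n)%:R}.
Proof.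
move=> C0 kap0 TC LTk.
apply: (@ladder_ae (fun n x => trimmed_sum (fun i => f (Z i x)) n)) => //.
- by move=> n Q; exact: (trimmed_sum_measurable mp f).
- by move=> x m n; exact: trimmed_sum_mono.
- by move=> j j0 e e0; exact: (trimmed_ladder_summable mp psi_sum rt C0 TC).
Qed.

Lemma common_max_measurable (f g : nat -> nat) n (Q : nat -> Prop) :
  measurable
    [set x | Q (minn (\max_(i < n) f (Z i x)) (\max_(i < n) g (Z i x)))].
Proof.
apply: (determined_measurable mp (m := 0%N) (n := n)) => x y xy.
have E (h : nat -> nat) : \max_(i < n) h (Z i x) = \max_(i < n) h (Z i y).
  by apply: eq_bigr => i _; rewrite xy //=.
by rewrite /= !E.
Qed.

(** Union bound over the pairs (i, i') with u < f(Z_i) and u < g(Z_i'): mixing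
for i <> i', the bound D for i = i'. *)
Lemma common_exceed (f g : nat -> nat) (D : R) n u :
  pr [set x | (u < f (Z 0%N x))%N /\ (u < g (Z 0%N x))%N] <= D ->
  pr [set x | (u < minn (\max_(i < n) f (Z i x)) (\max_(i < n) g (Z i x)))%N] <=
  (1 + psi 1) * ((n%:R * code_tail P Z f u) * (n%:R * code_tail P Z g u)) +
  n%:R * D.
Proof.
move=> fgD.
pose U (h : nat -> nat) i := Z i @^-1` [set v | (u < h v)%N].
pose A (q : nat * nat) := U f q.1 `&` U g q.2.
have mU h i : measurable (U h i) by exact: measurable_coord mp _ _.
have mA q : measurable (A q) by exact: measurableI.
pose ps := [seq (i, i') | i <- index_iota 0 n, i' <- index_iota 0 n].
set B := [set x | _].
have mB : measurable B by exact: (common_max_measurable f g n (fun s => (u < s)%N)).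
have D0 : 0 <= D by apply: le_trans fgD; exact: pr_ge0.
have K0 : 0 <= 1 + psi 1 by rewrite addr_ge0.
have T0 h : 0 <= code_tail P Z h u by exact: code_tail_ge0.
have prU h i : pr (U h i) = code_tail P Z h u.
  by rewrite /U (mp_stationary mp).
have lt_bound h h' i i' : (i < i')%N ->
    pr (U h i `&` U h' i') <= (1 + psi 1) * (code_tail P Z h u * code_tail P Z h' u).
  move=> ii'; rewrite -(prU h i) -(prU h' i').
  have jj : (0 < i.+1 <= i.+1)%N by rewrite /=.
  have := @mixing_upper _ _ _ _ _ _ mp i.+1 i.+1 i'.+1 (U h i) (U h' i') jj.
  rewrite subnn; apply.
    apply: (@determined_widen _ _ i i.+1 0 i.+1) => //; exact: determined_coord.
  apply: (@determined_widen _ _ i' i'.+1 i.+1 i'.+1) => //.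
  exact: determined_coord.
have Ab i i' : pr (A (i, i')) <=
    (1 + psi 1) * (code_tail P Z f u * code_tail P Z g u) +
    (if i' == i then D else 0).
  have M0 : 0 <= (1 + psi 1) * (code_tail P Z f u * code_tail P Z g u).
    by rewrite !mulr_ge0.
  have [ii'|ii'|<-] := ltngtP i i'.
  - by rewrite addr0; exact: lt_bound.
  - by rewrite addr0 [A _]setIC [X in _ * X]mulrC; exact: lt_bound.
  - apply: le_trans (_ : D <= _); last by rewrite lerDr.
    apply: le_trans fgD.
    have -> : A (i, i) = Z i @^-1` [set v | (u < f v)%N /\ (u < g v)%N] by [].
    by rewrite (mp_stationary mp).
rewrite -[leLHS]mul1r.
apply: (@le_trans _ _ (\sum_(q <- ps) pr (A q))).
  apply: (markov_count P1 mA) => // x; rewrite /B /= leq_min => /andP[Bf Bg].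
  have ex h : (u < \max_(i < n) h (Z i x))%N -> exists2 i : 'I_n, True & U h i x.
    move=> H; apply: contrapT => nex; move: H; apply/negP; rewrite -leqNgt.
    apply/bigmax_leqP => i _; rewrite leqNgt; apply/negP => Ui; apply: nex.
    by exists i.
  have [i _ Ui] := ex f Bf; have [i' _ Ui'] := ex g Bg.
  rewrite /ps big_allpairs big_mkord (bigD1 i) //= big_mkord (bigD1 i') //=.
  rewrite indicE mem_set //= -addrA lerDl addr_ge0 //; apply: sumr_ge0 => // l _.
  by rewrite sumr_ge0.
rewrite /ps big_allpairs.
have row i : (0 <= i < n)%N -> \sum_(0 <= i' < n) pr (A (i, i')) <=
    n%:R * ((1 + psi 1) * (code_tail P Z f u * code_tail P Z g u)) + D.
  move=> /= ni; apply: le_trans (ler_sum_nat (fun i' _ => Ab i i')) _.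
  rewrite big_split /= big_const_nat iter_addr_0 subn0 mulr_natl lerD2l.
  by rewrite -big_mkcond /= big_mkord (big_pred1 (Ordinal ni)).
have := sum_le_const row; rewrite subn0 => /le_trans; apply.
lra.
Qed.

(** Both factors n_k P(f > u), n_k P(g > u) are of order h(u) at u = t_(k-a), and
h^2 is summable along the ladder.  This is the case kap = 0 of [ladder_ae]. *)
Lemma common_max_ae (f g : nat -> nat) (C D : R) (u0 : nat) : 0 <= C -> 0 <= D ->
  (forall s, code_tail P Z f s <= C * tau s) ->
  (forall s, code_tail P Z g s <= C * tau s) ->
  (forall u, (u0 <= u)%N ->
     pr [set x | (u < f (Z 0%N x))%N /\ (u < g (Z 0%N x))%N] <=
     D * (code_tail P Z f u * code_tail P Z g u)) ->
  {ae P, forall x, forall e : R, 0 < e -> \forall n \near \oo,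
     (minn (\max_(i < n) f (Z i x)) (\max_(i < n) g (Z i x)))%:R <=
     e * (b n)%:R}.
Proof.
move=> C0 D0 fC gC fgD.
pose F n x := minn (\max_(i < n) f (Z i x)) (\max_(i < n) g (Z i x)).
suff : {ae P, forall x, forall e : R, 0 < e -> \forall n \near \oo,
     `|(F n x)%:R - 0 * (b n)%:R| <= e * (b n)%:R}.
  apply: filterS => x Hx e e0; have := Hx e e0; apply: filterS => n.
  by rewrite mul0r subr0 ger0_norm.
apply: ladder_ae => //.
- by move=> n Q; exact: (common_max_measurable f g n Q).
- move=> x; apply: homo_leq => // [p q r|n]; first exact: leq_trans.
  rewrite /F !big_ord_recr /=; lia.
move=> j j0 e e0; pose n_ := ladder_time tau j; pose t := ladder j.
have [a aE] := power16_absorbs 1 e0.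
pose h2 k : R := if (k < a)%N then 0 else tail_ratio tau (t (k - a)%N) ^+ 2.
have h20 k : 0 <= h2 k by rewrite /h2; case: ifP => // _; exact: sqr_ge0.
have Ca0 : 0 <= C * 16 ^+ a by rewrite mulr_ge0 // exprn_ge0.
have K0 : 0 <= 1 + psi 1 + D by rewrite !addr_ge0.
have c0 : 0 <= (1 + psi 1 + D) * (C * 16 ^+ a) ^+ 2.
  exact: mulr_ge0 K0 (sqr_ge0 _).
exists (fun k => (1 + psi 1 + D) * (C * 16 ^+ a) ^+ 2 * h2 k); split.
- by move=> k; exact: mulr_ge0.
- apply: bounded_sumsZ => //; apply/(bounded_sums_shift a h20).
  have [M HM] := ladder_tail_ratio_sq rt j0; exists M => n.
  apply: le_trans (HM n); apply: ler_sum => i _.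
  by rewrite /h2 ltnNge leq_addr /= addKn.
near=> k.
have ak : (a <= k)%N by near: k; exact: nbhs_infty_ge.
have u0k : (u0 <= t (k - a))%N.
  apply: leq_trans (ladder_ge _ j0); rewrite leq_subRL //.
  by near: k; exact: nbhs_infty_ge.
have n0 : (0 < n_ k)%N by near: k; exact: ladder_time_large.
have tu : (t k)%:R = 16 ^+ a * (t (k - a)%N)%:R :> R by exact: ladderB.
set u := t (k - a)%N in u0k tu *.
have mF (Q : nat -> Prop) : measurable [set x | Q (F (n_ k) x)].
  exact: (common_max_measurable f g (n_ k) Q).
apply: (@le_trans _ _ (pr [set x | (u < F (n_ k) x)%N])).
  apply: (pr_le P1).
  - exact: (mF (fun s => e * (t k)%:R < `|s%:R - 0 * (t k)%:R|)).
  - exact: (mF (fun s => (u < s)%N)).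
  - move=> x /=; rewrite mul0r subr0 ger0_norm // -/(n_ k) => H.
    rewrite -(ltr_nat R); apply: le_lt_trans H.
    by rewrite tu mulrA ler_peMl.
apply: le_trans (common_exceed (n_ k) (fgD u u0k)) _.
rewrite /h2 ltnNge ak /= -/u.
have Hf := tail_at_ladder rt C0 fC j0 ak; have Hg := tail_at_ladder rt C0 gC j0 ak.
move: Hf Hg; rewrite -/(n_ k) -/(t (k - a)%N) -/u.
set x := (n_ k)%:R * code_tail _ _ f _; set y := (n_ k)%:R * code_tail _ _ g _.
set z := C * 16 ^+ a * _ => Hf Hg.
have x0 : 0 <= x by exact: mulr_ge0 (ler0n _ _) (code_tail_ge0 _ _ _ _).
have y0 : 0 <= y by exact: mulr_ge0 (ler0n _ _) (code_tail_ge0 _ _ _ _).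
have xy : x * y <= z ^+ 2 by rewrite expr2 ler_pM.
have nD : (n_ k)%:R * (D * (code_tail P Z f u * code_tail P Z g u)) <= D * (x * y).
  have -> : D * (x * y) = (n_ k)%:R * (D * (x * code_tail P Z g u)).
    by rewrite /y; ring.
  do 2 apply: ler_wpM2l => //; apply: ler_wpM2r; first exact: code_tail_ge0.
  by rewrite ler_peMl ?ler1n //; exact: code_tail_ge0.
have -> : (1 + psi 1 + D) * (C * 16 ^+ a) ^+ 2 * tail_ratio tau u ^+ 2 =
   (1 + psi 1) * z ^+ 2 + D * z ^+ 2 by rewrite /z; ring.
apply: lerD; first by rewrite ler_wpM2l // addr_ge0.
by apply: le_trans nD _; rewrite ler_wpM2l.
Unshelve. all: by end_near. Qed.

End Ladder.

(** Second Borel-Cantelli lemma.  Choose a gap q with psi(q) <= 1 / 2 and look at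
the indices m + q, m + 2 q, ... only.  Given that no exceedance has occurred so
far, the next one has conditional probability at least p_I / 2, and the product
of the factors 1 - p_I / 2 tends to 0.  Since the tail at a nondecreasing level
is nonincreasing, the sum over every q-th index still diverges. *)
Lemma exceed_infinitely_often (f : nat -> nat) (be : nat -> nat) :
  {homo be : m n / (m <= n)%N} ->
  ~ bounded_sums (fun n => code_tail P Z f (be n)) ->
  (forall e, 0 < e -> \forall n \near \oo, psi n < e) ->
  {ae P, forall x, forall m, exists2 n, (m <= n)%N & (be n < f (Z n x))%N}.
Proof.
move=> bem nsum psi_small.
have [q0 _ Hq0] := psi_small (1 / 2) (divr_gt0 ltr01 (ltr0n R 2)).
pose q := q0.+1.
have psiq : psi q < 1 / 2 by apply: Hq0 => /=; exact: leqnSn.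
apply/ae_foralln => m.
pose id I := (m + I.+1 * q)%N.
pose A I := Z (id I) @^-1` [set v | (be (id I) < f v)%N].
pose B I := [set x | forall i, (i < I)%N -> ~ A i x].
pose p I := code_tail P Z f (be (id I)).
have p0 I : 0 <= p I by exact: code_tail_ge0.
have tail_mono u v : (u <= v)%N -> code_tail P Z f v <= code_tail P Z f u.
  move=> uv; apply: (pr_le P1).
  - exact: (measurable_coord mp 0 [set w | (v < f w)%N]).
  - exact: (measurable_coord mp 0 [set w | (u < f w)%N]).
  - by move=> x /=; exact: leq_ltn_trans.
have prA I : pr (A I) = p I by rewrite /A (mp_stationary mp).
have dA I : determined Z (id I) (id I).+1 (A I) by exact: determined_coord.
have dB I : determined Z 0 (m + I * q).+1 (B I).
  move=> x y xy Bx i iI Ay; apply: (Bx i iI); apply: dA Ay => l /andP[l1 l2].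
  apply/esym/xy => /=; apply: leq_trans l2 _.
  by rewrite ltnS leq_add2l leq_mul2r iI orbT.
have mA I : measurable (A I) by exact: (determined_measurable mp (dA I)).
have mB I : measurable (B I) by exact: (determined_measurable mp (@dB I)).
have step I : pr (B I.+1) <= pr (B I) * (1 - p I / 2).
  have -> : B I.+1 = B I `\` A I.
    apply/seteqP; split=> x.
      move=> H; split; last exact: H.
      by move=> i iI; apply: H; exact: ltnW.
    move=> [H nA] i; rewrite ltnS leq_eqVlt => /orP[/eqP->//|]; exact: H.
  have := pr_setD P1 (mB I) (mA I).
  have jj : (0 < (m + I * q).+1 <= id I)%N.
    by rewrite /= /id mulSn ltn_add2l addSn ltnS leq_addl.
  have := mp_mixing mp jj (@dB I) (@dA I).
  have -> : (id I - (m + I * q).+1).+1 = q by rewrite /id mulSn; lia.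
  rewrite prA ler_distl => /andP[H _].
  have : psi q * (pr (B I) * p I) <= 1 / 2 * (pr (B I) * p I).
    by rewrite ler_wpM2r ?(ltW psiq) // mulr_ge0 ?pr_ge0.
  lra.
(* The product of the 1 - p_i / 2 is at most 1 / (1 + S / 2), S the sum of p_i. *)
have decay I : pr (B I) * (1 + (\sum_(i < I) p i) / 2) <= 1.
  elim: I => [|I IH].
    by rewrite big_ord0 mul0r addr0 mulr1; exact: (pr_le1 P1).
  rewrite big_ord_recr /=; apply: le_trans IH.
  set S := \sum_(_ < I) _; have S0 : 0 <= S by rewrite sumr_ge0.
  apply: le_trans (ler_wpM2r _ (step I)) _.
    by rewrite addr_ge0 // divr_ge0 // addr_ge0.
  rewrite -mulrA ler_wpM2l ?pr_ge0 //.
  by have := mulr_ge0 (p0 I) S0; have := mulr_ge0 (p0 I) (p0 I); lra.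
have psum : ~ bounded_sums p.
  move=> [M HM]; apply: nsum.
  apply/(bounded_sums_shift (m + q)) => [k|]; first exact: code_tail_ge0.
  exists (q%:R * M) => n.
  apply: (@le_trans _ _ (\sum_(0 <= i < n * q) code_tail P Z f (be (m + q + i)))).
    rewrite -(big_mkord xpredT (fun k => code_tail P Z f (be (m + q + k)%N))).
    rewrite [leRHS](big_cat_nat (n := n)) //= ?leq_pmulr //.
    by rewrite lerDl sumr_ge0 // => i _; exact: code_tail_ge0.
  rewrite -(mul0n q) -(sum_nat_blocks _ (m := fun k => (k * q)%N)); last first.
    by move=> k l kl; rewrite leq_mul2r kl orbT.
  apply: le_trans (_ : \sum_(k < n) q%:R * p k <= _); last first.
    by rewrite -mulr_sumr ler_wpM2l.
  apply: ler_sum => k _; rewrite mulSn.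
  have := @sum_le_const R (k * q) (q + k * q)
    (fun i => code_tail P Z f (be (m + q + i)%N)) (p k).
  rewrite addnK; apply => i /andP[ki _]; apply: tail_mono; apply: bem.
  by rewrite /id mulSn addnA leq_add2l.
apply: (@negligibleS _ _ _ _ (\bigcap_n B n)).
  move=> x /= nx n _ i _ Ax; apply: nx; exists (id i) => //.
  by rewrite leq_addr.
apply: negligible_bigcap_small => // e e0.
have [I HI] : exists I, 2 / e <= \sum_(i < I) p i.
  apply: contrapT => nI; apply: psum; exists (2 / e) => n.
  by rewrite leNgt; apply/negP => /ltW H; apply: nI; exists n.
exists I; have := decay I; set S := \sum_(_ < I) _ in HI *.
have S2 : 0 < 1 + S / 2.
  by rewrite ltr_wpDr // divr_ge0 //; apply: le_trans HI; rewrite divr_ge0 // ltW.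
rewrite -ler_pdivlMr // => /le_trans; apply.
rewrite ler_pdivrMr //.
move: HI; rewrite ler_pdivrMr // => HI; lra.
Qed.

End AlmostSure.

(** * Orbits cut at their visits *)

Lemma leq_bigmax_nat (q : nat -> nat) i n : (i < n)%N ->
  (q i <= \max_(l < n) q l)%N.
Proof. by move=> ni; exact: (leq_bigmax (Ordinal ni)). Qed.

Lemma bigmax_widen (q : nat -> nat) m n : (m <= n)%N ->
  (\max_(l < m) q l <= \max_(l < n) q l)%N.
Proof.
move=> mn; apply/bigmax_leqP => i _; apply: leq_bigmax_nat.
exact: leq_trans mn.
Qed.

Lemma bigmax_attained (q : nat -> nat) n :
  exists2 i, (i <= n)%N & \max_(l < n.+1) q l = q i.
Proof.
have I0 : (0 < #|'I_n.+1|)%N by rewrite card_ord.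
have [i Hi] := bigop.eq_bigmax (fun i : 'I_n.+1 => q i) I0.
by exists i => //; rewrite -ltnS.
Qed.

Lemma max_nat_unique (A : set nat) k : A k -> (forall l, A l -> (l <= k)%N) ->
  max_nat A = k.
Proof.
move=> Ak Ale; apply: xget_unique; first by split.
move=> l [Al Aub]; apply/eqP; rewrite eqn_leq Ale //=; exact: Aub.
Qed.

Section Orbit.
Context d (X : measurableType d) (R : realType) (T : X -> X) (E : set X) (x : X).
Variables (e : nat) (p : nat -> nat).
(** The time of the n-th visit to E, for the entrance time e and the return
times p. *)
Definition visit_time (n : nat) : nat := (e + \sum_(i < n) p i)%N.
Local Notation t := visit_time.
Hypothesis p_gt0 : forall i, (0 < p i)%N.
Hypothesis visits : forall s, E (iter s T x) <-> exists n, s = t n.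

Lemma visit_timeS n : t n.+1 = (t n + p n)%N.
Proof. by rewrite /t big_ord_recr /= addnA. Qed.

Lemma visit_time_mono : {homo t : m n / (m <= n)%N}.
Proof.
apply: homo_leq => // [m n k|n]; first exact: leq_trans.
by rewrite visit_timeS leq_addr.
Qed.

Lemma visit_time_ltn m n : (m < n)%N -> (t m < t n)%N.
Proof.
move=> mn; apply: leq_trans (visit_time_mono mn).
by rewrite visit_timeS -[X in (X < _)%N]addn0 ltn_add2l.
Qed.

Lemma visit_time_lt_inv m n : (t m < t n)%N -> (m < n)%N.
Proof.
by rewrite !ltnNge; apply: contraNN; exact: visit_time_mono.
Qed.

Lemma visit_time_ge n : (n <= t n)%N.
Proof.
elim: n => // n IH; apply: leq_ltn_trans IH _; exact: visit_time_ltn.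
Qed.

Lemma visit_index s : (e <= s)%N -> exists n, (t n <= s < t n.+1)%N.
Proof.
move=> es.
have ex : exists n, (s < t n.+1)%N by exists s; exact: visit_time_ge.
case: (ex_minnP ex) => -[|n] sn nmin; first by exists 0%N; rewrite sn andbT /t big_ord0 addn0.
exists n.+1; rewrite sn andbT leqNgt; apply/negP => /nmin.
by rewrite ltnn.
Qed.

Lemma no_visit n s : (t n < s < t n.+1)%N -> ~ E (iter s T x).
Proof.
move=> /andP[ns sn] /visits[m sm]; subst s.
have := visit_time_lt_inv ns; have := visit_time_lt_inv sn; lia.
Qed.

Lemma no_visit_before s : (s < e)%N -> ~ E (iter s T x).
Proof. by move=> se /visits[m sm]; move: se; rewrite sm /t; lia. Qed.

(** An excursion that starts right after the i-th visit avoids E for p_i - 1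
steps, and m(N) is one more than the longest such stay; an excursion that has
started by time N + 1 is counted in full, hence the range i <= n1.  The initial
stay outside E, of length less than e, is dominated by some return time. *)
Lemma longest_excursionE N n1 : (t n1 <= N < t n1.+1)%N ->
  (e <= \max_(i < n1.+1) p i)%N ->
  longest_excursion T E N x = \max_(i < n1.+1) p i.
Proof.
move=> /andP[n1N Nn1]; set M := \max_(i < n1.+1) p i => eM.
rewrite /longest_excursion; set A := [set k | _].
have pM i : (i <= n1)%N -> (p i <= M)%N.
  by move=> i1; exact: (leq_bigmax (Ordinal (i1 : (i < n1.+1)%N))).
have M0 : (0 < M)%N by apply: leq_trans (pM 0%N _) => //; exact: p_gt0.
have Aub k : A k -> (k < M)%N.
  move=> [k1 [l [l1 lN nE]]].
  have [le|el] := leqP l e.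
    apply: leq_trans eM; rewrite ltnNge; apply/negP => ek.
    by apply: (nE (e - l)%N); [lia|apply/visits; exists 0%N; rewrite /t big_ord0; lia].
  have [i /andP[i1 i2]] := @visit_index l.-1 ltac:(lia).
  have il : (i <= n1)%N.
    by rewrite -ltnS; apply: visit_time_lt_inv; apply: leq_ltn_trans i1 _; lia.
  apply: leq_trans (pM i il).
  have := visit_timeS i => tS.
  have [H|H] := ltnP (t i.+1) (l + k); last by lia.
  exfalso; apply: (nE (t i.+1 - l)%N); first by lia.
  by apply/visits; exists i.+1; lia.
(* If all return times are 1, the set of stays is empty, and its maximum is 0. *)
have [M1|M2] := leqP M 1.
  rewrite /max_nat xgetPN; first by lia.
  by move=> k [Ak _]; have := Aub k Ak; case: Ak; lia.
have [i il] := bigmax_attained p n1; rewrite -/M => Mp.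
rewrite (@max_nat_unique A M.-1); first by rewrite add1n prednK.
  split; first by lia.
  exists (t i).+1; split=> //.
    by rewrite ltnS; apply: leq_trans n1N; exact: visit_time_mono.
  move=> l lM; apply: (@no_visit i); rewrite visit_timeS -Mp; lia.
by move=> k /Aub; lia.
Qed.

(** Here t_n = D_n + max_(i < n) p_i + e.  Let n1 be the index of the last visit up
to time N, so that m = max_(i <= n1) p_i.  For n1 < i < n the i-th excursion
starts after N and ends before N + m, hence p_i < m.  Lower estimate: if n > n1,
the maximum over i < n is therefore m, and t_n < N + m reads D_n + e < N; if
n = n1, then D_n + e <= t_n <= N.  Upper estimate: if p_n <= m, then
N + m <= t_(n+1) reads N <= D_(n+1) + e; if p_n > m, then p_n is the maximum and
n > n1, so that D_(n+1) + e = t_n > N. *)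
Lemma excursion_sandwich (i0 : nat) : (e <= p i0)%N -> forall N, (t i0 <= N)%N ->
  let m := longest_excursion T E N x in
  exists n, [/\ (trimmed_sum p n + e <= N <= trimmed_sum p n.+1 + e)%N,
    (\max_(i < n) p i <= m <= \max_(i < n.+1) p i)%N &
    (t n < N + m <= t n.+1)%N].
Proof.
move=> ei0 N i0N.
have eN : (e <= N)%N by apply: leq_trans i0N; rewrite leq_addr.
have [n1 n1N] := visit_index eN; have /andP[t1 t2] := n1N.
have i01 : (i0 < n1.+1)%N by apply: visit_time_lt_inv; exact: leq_ltn_trans t2.
have eM : (e <= \max_(i < n1.+1) p i)%N.
  by apply: leq_trans ei0 _; exact: leq_bigmax_nat.
rewrite (longest_excursionE n1N eM); set m := \max_(i < n1.+1) p i.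
have m0 : (0 < m)%N by apply: leq_trans (leq_bigmax_nat p (ltn0Sn n1)); exact: p_gt0.
have [n /andP[s1 s2]] := @visit_index (N + m).-1 ltac:(lia).
have n1n : (n1 <= n)%N.
  by rewrite -ltnS; apply: visit_time_lt_inv; apply: leq_ltn_trans t1 _; lia.
have Mn : (\max_(i < n) p i <= m)%N.
  apply/bigmax_leqP => i _; have [i1|i1] := leqP i n1.
    exact: leq_bigmax_nat.
  have := visit_timeS i; have := visit_time_mono (ltn_ord i).
  have := visit_time_mono i1; lia.
have mM : (m <= \max_(i < n.+1) p i)%N by exact: bigmax_widen.
exists n; split; [|by rewrite Mn|lia].
have tn k : t k = (trimmed_sum p k + \max_(i < k) p i + e)%N.
  by rewrite trimmed_sumK /t addnC.
have MS : \max_(i < n.+1) p i = maxn (\max_(i < n) p i) (p n).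
  by rewrite big_ord_recr.
have tS := visit_timeS n.
apply/andP; split.
  have [nn|] := ltnP n1 n; last first.
    move=> nn; have -> : n = n1 by lia.
    by apply: leq_trans t1; rewrite tn; lia.
  have : (m <= \max_(i < n) p i)%N by exact: bigmax_widen.
  have := tn n; lia.
have [H|H] := leqP (p n) m.
  have := tn n.+1; lia.
have nn : (n1 < n)%N.
  rewrite ltnNge; apply/negP => nn; move: H; rewrite ltnNge; apply/negP.
  by rewrite negbK; apply: leq_bigmax_nat; lia.
have := visit_time_mono nn; have := tn n.+1; lia.
Qed.

Variables (g : X -> R) (c : R).
Hypothesis g_out : forall y, ~ E y -> g y = c.
Let ga n := g (iter (t n) T x).

(** One value g_i per visit, and c at the other times. *)
Lemma orbit_sum n s : (t n < s <= t n.+1)%N ->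
  birkhoff_sum T g s x = \sum_(i < n.+1) ga i + c * (s%:R - n.+1%:R).
Proof.
have block n' s' : (t n' < s' <= t n'.+1)%N ->
    \sum_(t n' <= l < s') g (iter l T x) = ga n' + c * (s'%:R - (t n').+1%:R).
  move=> /andP[H1 H2]; rewrite big_ltn //; congr (_ + _).
  rewrite (eq_big_nat _ _ (F2 := fun=> c)) => [|l /andP[l1 l2]].
    rewrite big_const_nat iter_addr_0 -[c *+ _]mulr_natr natrB //; congr (_ * _).
  by apply: g_out; apply: (@no_visit n'); rewrite l1 (leq_trans l2).
have full n' : \sum_(0 <= l < t n') g (iter l T x) =
    \sum_(i < n') ga i + c * ((t n')%:R - n'%:R).
  elim: n' => [|n' IH].
    rewrite big_ord0 add0r subr0 /t big_ord0 addn0.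
    rewrite (eq_big_nat _ _ (F2 := fun=> c)) => [|l /andP[l1 l2]].
      by rewrite big_const_nat iter_addr_0 subn0 mulr_natr.
    by apply: g_out; exact: no_visit_before.
  rewrite (big_cat_nat (n := t n')) //=; last exact: visit_time_mono.
  rewrite IH block; last by rewrite leqnn visit_time_ltn.
  by rewrite big_ord_recr /= -!natr1; ring.
move=> /andP[H1 H2]; rewrite /birkhoff_sum big_add1 /=.
rewrite (big_cat_nat (n := t n)) //=; last exact: ltnW.
rewrite full block ?H1 //.
by rewrite big_ord_recr /= -!natr1; ring.
Qed.

Lemma birkhoff_max_ge s l : (l < s)%N -> g (iter l T x) <= birkhoff_max T g s x.
Proof.
move=> ls; rewrite /birkhoff_max big_add1 /= big_mkord.
exact: (@le_bigmax _ _ _ (g x) (fun i : 'I_s => g (iter i T x)) (Ordinal ls)).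
Qed.

Lemma birkhoff_max_le s (B : R) : (0 < s)%N ->
  (forall l, (l < s)%N -> g (iter l T x) <= B) -> birkhoff_max T g s x <= B.
Proof.
move=> s0 gB; rewrite /birkhoff_max big_add1 /= big_mkord.
by apply/bigmax_leP; split=> [|i _]; [exact: (gB 0%N)|exact: gB].
Qed.

Variable gn : nat -> nat.
Hypothesis gn_ceil : forall n, ga n <= (gn n)%:R < ga n + 1.
Hypothesis g_ge0 : forall y, 0 <= g y.
Hypothesis c_ge0 : 0 <= c.

(** The values off E are all c, whence the error c; rounding g up to gn costs
1. *)
Lemma orbit_max n s : (t n < s <= t n.+1)%N ->
  (\max_(i < n.+1) gn i)%:R - 1 <= birkhoff_max T g s x <=
  (\max_(i < n.+1) gn i)%:R + c.
Proof.
move=> /andP[H1 H2]; apply/andP; split.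
  have [i il Hi] := bigmax_attained gn n.
  rewrite Hi lerBlDr; have /andP[_ /ltW H] := gn_ceil i; apply: le_trans H _.
  rewrite lerD2r; apply: birkhoff_max_ge; apply: leq_ltn_trans H1.
  exact: visit_time_mono.
apply: birkhoff_max_le; first by lia.
move=> l ls; have [El|nEl] := pselect (E (iter l T x)); last first.
  by rewrite (g_out nEl) lerDr.
have /visits[i li] := El; subst l.
have il : (i < n.+1)%N by apply: visit_time_lt_inv; exact: leq_trans H2.
have /andP[H _] := gn_ceil i; apply: le_trans H _.
by apply: (@le_trans _ _ (\max_(l < n.+1) gn l)%:R);
  [rewrite ler_nat; exact: leq_bigmax_nat|rewrite lerDl].
Qed.

Lemma orbit_trimmed n s : (t n < s <= t n.+1)%N ->
  `|birkhoff_sum T g s x - birkhoff_max T g s x -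
    c * (s%:R - n.+1%:R) - (trimmed_sum gn n.+1)%:R| <= n.+1%:R + c + 1.
Proof.
move=> H; rewrite (orbit_sum H); have /andP[M1 M2] := orbit_max H.
have DE : (trimmed_sum gn n.+1)%:R + (\max_(i < n.+1) gn i)%:R =
    \sum_(i < n.+1) (gn i)%:R :> R.
  by rewrite -natrD trimmed_sumK natr_sum.
have S1 : \sum_(i < n.+1) ga i <= \sum_(i < n.+1) (gn i)%:R.
  by apply: ler_sum => i _; have /andP[] := gn_ceil i.
have S2 : \sum_(i < n.+1) (gn i)%:R <= \sum_(i < n.+1) ga i + n.+1%:R.
  have -> : n.+1%:R = \sum_(i < n.+1) (1 : R) by rewrite sumr_const card_ord.
  by rewrite -big_split; apply: ler_sum => i _; have /andP[_ /ltW] := gn_ceil i.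
have n0 : 0 <= n.+1%:R :> R by [].
move: M1 M2 DE S1 S2 n0; set A := \sum_(i < n.+1) ga i.
set B := \sum_(i < n.+1) _; set M := (\max_(i < n.+1) _)%:R.
set D := (trimmed_sum _ _)%:R; set w := c * (_ - _); set b := birkhoff_max _ _ _ _.
move: (n.+1%:R) c_ge0 => r c0 M1 M2 DE S1 S2 r0.
by rewrite ler_norml; apply/andP; split; lra.
Qed.

End Orbit.

(** * Asymptotics along a typical orbit *)

Lemma limn_esup_pinfty (R : realType) (u : nat -> R) :
  (forall (A : R) K, exists2 N, (K <= N)%N & A <= u N) ->
  limn_esup (fun N => (u N)%:E) = +oo%E.
Proof.
move=> uA; rewrite limn_esup_lim; apply: cvg_lim => //.
suff -> : esups (fun N => (u N)%:E) = fun=> +oo%E by exact: cvg_cst.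
apply/funext => K; apply/eqP; rewrite eq_le leey /= leye_eq; apply/eqP.
apply/eqyP => A _; have [N KN AN] := uA A K.
apply: (@le_trans _ _ (u N)%:E); first by rewrite lee_fin.
by apply: ereal_sup_ubound; exists N.
Qed.

Section OrbitAsymptotics.
Context d (X : measurableType d) (R : realType) (T : X -> X) (E : set X) (x : X).
Variables (e : nat) (p : nat -> nat).
Local Notation t := (visit_time e p).
Hypothesis p_gt0 : forall i, (0 < p i)%N.
Hypothesis visits : forall s, E (iter s T x) <-> exists n, s = t n.
Variable b : nat -> nat.
Hypothesis b_large : forall B : nat, \forall n \near \oo, (B <= b n)%N.
Hypothesis b_next : forall eps : R, 0 < eps ->
  \forall n \near \oo, (b n.+1)%:R <= (1 + eps) * (b n)%:R.
Hypothesis p_trimmed : forall eps : R, 0 < eps -> \forall n \near \oo,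
  `|(trimmed_sum p n)%:R - 1 * (b n)%:R| <= eps * (b n)%:R.
Hypothesis p_exceeds : forall s k, exists2 n, (k <= n)%N & (16 ^ s * b n < p n)%N.
Local Notation m N := (longest_excursion T E N x).

Let b_real (A : R) : \forall n \near \oo, A <= (b n)%:R.
Proof.
have := b_large (Num.truncn `|A|).+1; apply: filterS => n Hn.
apply: le_trans (ler_norm A) _.
have /andP[_ /ltW H] := truncn_itv (normr_ge0 A).
by apply: le_trans H _; rewrite ler_nat.
Qed.

Let b_absorb (A eps : R) : 0 < eps -> \forall n \near \oo, A <= eps * (b n)%:R.
Proof.
by move=> e0; have := b_real (A / eps); apply: filterS => n;
  rewrite ler_pdivrMr // mulrC.
Qed.

(** The sandwich, combined with D_n(p) ~ b(n) and b(n+1) ~ b(n): the index n of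
the excursion that contains N + m(N) satisfies N ~ b(n+1). *)
Lemma index_asymptotics (eps : R) n0 : 0 < eps -> \forall N \near \oo,
  exists n, [/\ (n0 <= n)%N,
    (trimmed_sum p n + e <= N <= trimmed_sum p n.+1 + e)%N,
    (\max_(i < n) p i <= m N <= \max_(i < n.+1) p i)%N,
    (t n < N + m N <= t n.+1)%N &
    `|N%:R - (b n.+1)%:R| <= eps * (b n.+1)%:R].
Proof.
(* Three errors of relative size del: the trimmed law, b(n+1) / b(n), and e. *)
move=> eps0; pose del := Num.min eps 1 / 4.
have d0 : 0 < del by rewrite divr_gt0 // lt_min eps0 ltr01.
have dmin : 4 * del = Num.min eps 1 by rewrite /del; field.
have d1 : 4 * del <= eps by rewrite dmin ge_min lexx.
have d2 : 4 * del <= 1 by rewrite dmin ge_min lexx orbT.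
have [K _ HK] : \forall n \near \oo, [/\
    `|(trimmed_sum p n)%:R - 1 * (b n)%:R| <= del * (b n)%:R,
    (b n.+1)%:R <= (1 + del) * (b n)%:R & e%:R <= del * (b n)%:R].
  near=> n; split; near: n.
  - exact: p_trimmed.
  - exact: b_next.
  - exact: b_absorb.
have [i0 _ ei0] := p_exceeds 0 0.
have [i1 ei1] : exists i1, (e <= p i1)%N.
  have [n1 _ Hn1] := b_large e.
  have [n nn1 Hn] := p_exceeds 0 n1; exists n.
  by apply: leq_trans (ltnW Hn); rewrite mul1n; exact: Hn1.
pose n1 := maxn n0 K.
near=> N.
have N1 : (t i1 <= N)%N by near: N; exact: nbhs_infty_ge.
have N2 : (trimmed_sum p n1 + e < N)%N by near: N; exact: nbhs_infty_ge.
have [n [H1 H2 H3]] := excursion_sandwich p_gt0 visits ei1 N1.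
have n1n : (n1 <= n)%N.
  rewrite leqNgt; apply/negP => /(trimmed_sum_mono p).
  by move: H1 => /andP[_ H1] H; lia.
exists n; split=> //; first by apply: leq_trans n1n; rewrite leq_maxl.
have Kn : (K <= n)%N by apply: leq_trans n1n; rewrite leq_maxr.
have [D1 B1 e1] := HK n Kn; have [D2 _ e2] := HK n.+1 (leqW Kn).
move: H1 => /andP[]; rewrite -!(ler_nat R) !natrD => S1 S2.
move: D1 D2; rewrite !mul1r !ler_distl => /andP[D1 _] /andP[_ D2].
have b0 : 0 <= (b n)%:R :> R by []; have b1 : 0 <= (b n.+1)%:R :> R by [].
have key : (1 - 2 * del) * (b n.+1)%:R <= (1 - del) * (b n)%:R.
  have w0 : 0 <= 1 - 2 * del by lra.
  apply: le_trans (ler_wpM2l w0 B1) _; rewrite mulrA ler_wpM2r //.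
  have := mulr_ge0 (ltW d0) (ltW d0); lra.
have e0 : 0 <= e%:R :> R by [].
have epsb := ler_wpM2r b1 d1.
by apply/andP; split; lra.
Unshelve. all: by end_near. Qed.

(** The common part of both upper limits.  If q_n > 16^s b(n), take for N the first
time beyond D_(n+1)(p) + e.  The sandwich then places N + m(N) beyond the visit
n + 1, so that q_n has been seen, while N is at most 4 b(n). *)
Let exceed_large (q : nat -> nat) (F : nat -> R) :
  (forall s k, exists2 n, (k <= n)%N & (16 ^ s * b n < q n)%N) ->
  (forall N n n', (n < n')%N -> (\max_(i < n') p i <= m N)%N ->
     (t n' < N + m N <= t n'.+1)%N -> (q n)%:R - 1 <= F N) ->
  forall A K, exists2 N, (K <= N)%N & A <= F N / N%:R.
Proof.
move=> qb qF A K.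
(* The factor 16^s absorbs A + 1 together with the factor 4 in N <= 4 b(n). *)
pose s := (Num.truncn `|A|).+1.
have As : A + 1 <= 16 ^+ s / 4.
  have /andP[_ /ltW H] := truncn_itv (normr_ge0 A); have H' := ler_norm A.
  have : (s.+1 * 4)%:R <= 16 ^+ s :> R.
    rewrite -natrX ler_nat (_ : 16 = 4 * 4)%N // expnMn leq_mul //.
      by rewrite ltn_expl.
    by rewrite /s expnS leq_pmulr // expn_gt0.
  by rewrite natrM -[s.+1%:R]natr1; move: H; rewrite -/s; move: (s%:R : R) => z; lra.
have q4 : 0 < 1 / 4 :> R by rewrite divr_gt0.
have [n1 _ Hn1] : \forall n \near \oo, [/\
    `|(trimmed_sum p n)%:R - 1 * (b n)%:R| <= 1 / 4 * (b n)%:R :> R,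
    (b n.+1)%:R <= (1 + 1 / 4) * (b n)%:R :> R,
    e%:R + 1 <= 1 / 4 * (b n)%:R :> R & (1 : R) <= (b n)%:R].
  near=> n; split; near: n.
  - exact: p_trimmed q4.
  - exact: b_next q4.
  - exact: b_absorb q4.
  - exact: b_real.
have [K2 _ HK2] := index_asymptotics 0 ltr01.
have [n2 _ Hn2] : \forall n \near \oo, (K + K2)%:R <= 1 / 4 * (b n)%:R :> R.
  exact: b_absorb q4.
have [n /[!geq_max] /andP[nn1 nn2] Hn] := qb s (maxn n1 n2).
have [_ B1 e1 b1] := Hn1 n nn1; have [D _ _ _] := Hn1 n.+1 (leqW nn1).
have K2n := Hn2 n.+1 (leqW nn2).
pose N := (trimmed_sum p n.+1 + e).+1.
have NE : N%:R = (trimmed_sum p n.+1)%:R + e%:R + 1 :> R by rewrite -natrD natr1.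
move: D; rewrite mul1r ler_distl => /andP[D1 D2].
have b0 : 0 <= (b n.+1)%:R :> R by [].
have KN : (K + K2 <= N)%N.
  by rewrite -(ler_nat R) NE; have : 0 <= e%:R :> R by []; lra.
exists N; first by apply: leq_trans KN; rewrite leq_addr.
have /HK2[n' [_ /andP[_ S2] /andP[M1 _] tn' _]] : (K2 <= N)%N.
  by apply: leq_trans KN; rewrite leq_addl.
have nn' : (n < n')%N.
  rewrite ltnNge; apply/negP => nn'.
  have : (trimmed_sum p n'.+1 <= trimmed_sum p n.+1)%N by exact: trimmed_sum_mono.
  by rewrite /N in S2; lia.
have := qF N n n' nn' M1 tn'.
have N0 : 0 < N%:R :> R by rewrite ltr0n.
have {}Hn : 16 ^+ s * (b n)%:R <= (q n)%:R :> R by rewrite -natrX -natrM ler_nat ltnW.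
rewrite ler_pdivlMr // => /(le_trans _); apply.
have N4 : N%:R <= 4 * (b n)%:R :> R by rewrite NE; lra.
have [A0|A0] := lerP 0 A.
  have : A * N%:R <= A * (4 * (b n)%:R) by rewrite ler_wpM2l.
  have := ler_wpM2r (ler0n R (b n)) As; lra.
have : A * N%:R <= 0 by rewrite mulr_le0_ge0 // ltW.
have : 16 * (b n)%:R <= 16 ^+ s * (b n)%:R :> R.
  rewrite ler_wpM2r // -[leLHS]expr1 ler_weXn2l //.
  by rewrite ler1n.
lra.
Unshelve. all: by end_near. Qed.

Lemma longest_excursion_limsup :
  limn_esup (fun N => ((m N)%:R / N%:R : R)%:E) = +oo%E.
Proof.
apply: limn_esup_pinfty; apply: (exceed_large p_exceeds) => N n n' nn' M1 _.
rewrite lerBlDr; apply: (@le_trans _ _ (m N)%:R); last by rewrite lerDl.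
by rewrite ler_nat; apply: leq_trans M1; exact: leq_bigmax_nat.
Qed.

Variables (g : X -> R) (c : R).
Hypothesis g_out : forall y, ~ E y -> g y = c.
Hypothesis c_ge0 : 0 <= c.
Variable gn : nat -> nat.
Hypothesis gn_ceil : forall n,
  g (iter (t n) T x) <= (gn n)%:R < g (iter (t n) T x) + 1.

Section Maximum.
Hypothesis g_exceeds : forall s k, exists2 n, (k <= n)%N & (16 ^ s * b n < gn n)%N.

Lemma birkhoff_max_limsup :
  limn_esup (fun N => (birkhoff_max T g (N + m N) x / N%:R)%:E) = +oo%E.
Proof.
apply: limn_esup_pinfty; apply: (exceed_large g_exceeds) => N n n' nn' _ tn'.
have /andP[H _] := orbit_max visits g_out gn_ceil c_ge0 tn'.
apply: le_trans H; rewrite lerD2r ler_nat; apply: leq_bigmax_nat.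
exact: ltnW.
Qed.

End Maximum.

Variable kap : R.
Hypothesis kap_ge0 : 0 <= kap.
Hypothesis b_time : forall eps : R, 0 < eps ->
  \forall n \near \oo, n%:R <= eps * (b n)%:R.
Hypothesis g_trimmed : forall eps : R, 0 < eps -> \forall n \near \oo,
  `|(trimmed_sum gn n)%:R - kap * (b n)%:R| <= eps * (b n)%:R.

(** S - max - c m - (c + kap) N splits into the rounding error of [orbit_trimmed],
the error D_(n+1)(gn) - kap b(n+1), and kap (b(n+1) - N) - c (n + 1). *)
Lemma trimmed_orbit_asymptotics (eps : R) : 0 < eps -> \forall N \near \oo,
  (0 < N)%N /\
  `|birkhoff_sum T g (N + m N) x - birkhoff_max T g (N + m N) x -
    c * (m N)%:R - (c + kap) * N%:R| <= eps * N%:R.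
Proof.
move=> eps0; pose C := 3 + kap + c.
have C0 : 0 < C by rewrite /C; move: kap_ge0 c_ge0; lra.
pose del := Num.min (eps / C) 1 / 2.
have d0 : 0 < del by rewrite divr_gt0 // lt_min divr_gt0 // ltr01.
have dmin : 2 * del = Num.min (eps / C) 1 by rewrite /del; field.
have d1 : 2 * del <= eps / C by rewrite dmin ge_min lexx.
have d2 : 2 * del <= 1 by rewrite dmin ge_min lexx orbT.
have [K _ HK] : \forall n \near \oo, [/\
    `|(trimmed_sum gn n)%:R - kap * (b n)%:R| <= del * (b n)%:R,
    n%:R <= del * (b n)%:R, c + 1 <= del * (b n)%:R & 1 <= (b n)%:R :> R].
  near=> n; split; near: n.
  - exact: g_trimmed.
  - exact: b_time.
  - exact: b_absorb.
  - exact: b_real.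
have := index_asymptotics K d0; apply: filterS => N [n [Kn _ _ H NB]].
have [D n1 c1 B1] := HK n.+1 (leqW Kn).
have := orbit_trimmed p_gt0 visits g_out gn_ceil c_ge0 H.
move: NB D; set B := (b n.+1)%:R in n1 c1 B1 *.
set S := birkhoff_sum _ _ _ _; set bm := birkhoff_max _ _ _ _.
set Dg := (trimmed_sum _ _)%:R; move: n1; set r := n.+1%:R => n1.
have r0 : 0 <= r by [].
rewrite natrD => NB D HS.
have NB2 : B <= 2 * N%:R.
  move: NB; rewrite ler_distl => /andP[NB _].
  have := ler_wpM2r (le_trans ler01 B1) d2; lra.
split.
  rewrite -(ltr_nat R); move: NB2 B1; lra.
have -> : S - bm - c * (m N)%:R - (c + kap) * N%:R =
  (S - bm - c * (N%:R + (m N)%:R - r) - Dg) + (Dg - kap * B) +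
  (kap * (B - N%:R) - c * r) by ring.
apply: le_trans (ler_normD _ _) _.
apply: le_trans (lerD (ler_normD _ _) (ler_normB _ _)) _.
rewrite normrM (ger0_norm kap_ge0) (distrC B) normrM (ger0_norm c_ge0) (ger0_norm r0).
have t1 : kap * `|N%:R - B| <= kap * (del * B) by rewrite ler_wpM2l.
have t2 : c * r <= c * (del * B) by rewrite ler_wpM2l.
apply: (@le_trans _ _ (C * (del * B))).
  by rewrite /C; move: HS D t1 t2; lra.
have : C * (del * B) <= C * del * (2 * N%:R).
  by rewrite [leLHS]mulrA ler_wpM2l // mulr_ge0 // ltW.
move=> /le_trans; apply.
have -> : C * del * (2 * N%:R) = (2 * del) * C * N%:R by ring.
by rewrite ler_wpM2r // -ler_pdivlMr.
Unshelve. all: by end_near. Qed.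

Lemma trimmed_orbit_limit :
  (birkhoff_sum T g (N + m N) x - birkhoff_max T g (N + m N) x -
    c * (m N)%:R) / N%:R @[N --> \oo] --> c + kap.
Proof.
apply/cvgrPdist_le => eps eps0.
have := trimmed_orbit_asymptotics eps0; apply: filterS => N [N0 H].
have N0' : 0 < N%:R :> R by rewrite ltr0n.
rewrite /= distrC; move: H; set Y := _ - c * (m N)%:R => H.
have YE : `|Y / N%:R - (c + kap)| * N%:R = `|Y - (c + kap) * N%:R|.
  rewrite -[X in _ * X = _](ger0_norm (ltW N0')) -normrM mulrBl.
  by rewrite divfK // gt_eqF.
by rewrite -(ler_pM2r N0') YE.
Qed.

Hypothesis g_ge0 : forall y, 0 <= g y.
Hypothesis common_max : forall eps : R, 0 < eps -> \forall n \near \oo,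
  (minn (\max_(i < n) p i) (\max_(i < n) gn i))%:R <= eps * (b n)%:R.

(** max (x, y) = x + y - min (x, y), and the minimum is o(N). *)
Lemma joint_trimmed_orbit_limit :
  (birkhoff_sum T g (N + m N) x -
    Num.max (birkhoff_max T g (N + m N) x) (c * (m N)%:R)) / N%:R
  @[N --> \oo] --> c + kap.
Proof.
have small (eps : R) : 0 < eps -> \forall N \near \oo, (0 < N)%N /\
    `|Num.min (birkhoff_max T g (N + m N) x) (c * (m N)%:R)| <= eps * N%:R.
  move=> eps0; pose C := 2 + c; pose del := eps / (2 * C).
  have C0 : 0 < C by rewrite /C; move: c_ge0; lra.
  have d0 : 0 < del by rewrite divr_gt0 // mulr_gt0.
  have [K _ HK] : \forall n \near \oo, [/\
      (minn (\max_(i < n) p i) (\max_(i < n) gn i))%:R <= del * (b n)%:R,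
      c <= del * (b n)%:R & 1 <= (b n)%:R :> R].
    near=> n; split; near: n.
    - exact: common_max.
    - exact: b_absorb.
    - exact: b_real.
  have h0 : 0 < 1 / 2 :> R by rewrite divr_gt0.
  have := index_asymptotics K h0; apply: filterS => N [n [Kn _ Hm tn NB]].
  have [mm c1 B1] := HK n.+1 (leqW Kn).
  have B2 : (b n.+1)%:R <= 2 * N%:R :> R.
    by move: NB; rewrite ler_distl => /andP[NB _]; lra.
  split; first by rewrite -(ltr_nat R); move: B2 B1; lra.
  have bm0 : 0 <= birkhoff_max T g (N + m N) x.
    apply: le_trans (g_ge0 x) _; apply: (@birkhoff_max_ge _ _ _ _ _ _ _ 0%N).
    by move: tn => /andP[tn _]; lia.
  rewrite ger0_norm; last by rewrite le_min bm0 mulr_ge0.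
  have /andP[_ H] := orbit_max visits g_out gn_ceil c_ge0 tn.
  move: Hm => /andP[_ Hm].
  have CE : C * del * (b n.+1)%:R <= eps * N%:R.
    have -> : C * del = eps / 2 by rewrite /del; field; rewrite gt_eqF.
    by rewrite -mulrA ler_pM2l //; move: B2; lra.
  apply: le_trans CE.
  have db0 : 0 <= del * (b n.+1)%:R by rewrite mulr_ge0 // ltW.
  move: mm; rewrite ge_min; case: leqP => _ mm; apply/orP.
    right; apply: le_trans (_ : c * (del * (b n.+1)%:R) <= _).
      by rewrite ler_wpM2l //; apply: le_trans mm; rewrite ler_nat.
    by rewrite /C; lra.
  by left; apply: le_trans H _; rewrite /C; have := mulr_ge0 c_ge0 db0; lra.
apply/cvgrPdist_le => eps eps0.
have e2 : 0 < eps / 2 by rewrite divr_gt0.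
have H1 := trimmed_orbit_asymptotics e2; have H2 := small _ e2.
near=> N.
have [N0 A1] : (0 < N)%N /\
  `|birkhoff_sum T g (N + m N) x - birkhoff_max T g (N + m N) x -
    c * (m N)%:R - (c + kap) * N%:R| <= eps / 2 * N%:R by near: N.
have [_ A2] : (0 < N)%N /\
    `|Num.min (birkhoff_max T g (N + m N) x) (c * (m N)%:R)| <= eps / 2 * N%:R.
  by near: N.
have N0' : 0 < N%:R :> R by rewrite ltr0n.
have mM : Num.max (birkhoff_max T g (N + m N) x) (c * (m N)%:R) =
    birkhoff_max T g (N + m N) x + c * (m N)%:R -
    Num.min (birkhoff_max T g (N + m N) x) (c * (m N)%:R).
  by rewrite -[X in X - _]addr_max_min addrK.
rewrite mM -(ler_pM2r N0') distrC -[X in _ * X <= _](ger0_norm (ltW N0')).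
rewrite -normrM mulrBl divfK ?gt_eqF //.
move: A1 A2; set S := birkhoff_sum _ _ _ _; set bm := birkhoff_max _ _ _ _.
set mn := Num.min _ _ => A1 A2.
have -> : S - (bm + c * (m N)%:R - mn) - (c + kap) * N%:R =
  (S - bm - c * (m N)%:R - (c + kap) * N%:R) + mn by ring.
by apply: le_trans (ler_normD _ _) _; lra.
Unshelve. all: by end_near. Qed.

End OrbitAsymptotics.

(** * Recurrence and the induced map *)

Lemma trivIset_ltn (X : Type) (F : nat -> set X) :
  (forall i j, (i < j)%N -> F i `&` F j = set0) -> trivIset setT F.
Proof.
move=> FF; apply/trivIsetP => i j _ _; rewrite neq_ltn => /orP[/FF//|/FF].
by rewrite setIC.
Qed.

Section Recurrence.
Context d (X : measurableType d) (R : realType).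
Variables (mu : {measure set X -> \bar R}) (T : X -> X) (E : set X).
Hypothesis mpT : measure_preserving mu T.
Hypothesis mE : measurable E.

Lemma iter_preimage_measurable n A : measurable A -> measurable (iter n T @^-1` A).
Proof.
elim: n A => [//|n IH] A mA.
have -> : iter n.+1 T @^-1` A = iter n T @^-1` (T @^-1` A) by [].
by apply: IH; rewrite -[_ @^-1` _]setTI; exact: mpT.1.
Qed.

Lemma iter_preimage_measure n A : measurable A -> mu (iter n T @^-1` A) = mu A.
Proof.
elim: n A => [//|n IH] A mA.
have -> : iter n.+1 T @^-1` A = iter n T @^-1` (T @^-1` A) by [].
rewrite IH; first exact: mpT.2.
by rewrite -[_ @^-1` _]setTI; exact: mpT.1.
Qed.

Lemma iter_preimage_negligible n A : mu.-negligible A ->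
  mu.-negligible (iter n T @^-1` A).
Proof.
move=> [B [mB B0 AB]]; exists (iter n T @^-1` B); split.
- exact: iter_preimage_measurable.
- by rewrite iter_preimage_measure.
- by move=> x /AB.
Qed.

Definition visits_infinitely_often (x : X) : Prop :=
  forall n, exists2 m, (n <= m)%N & E (iter m T x).

(** The points of E that never return form a wandering set. *)
Lemma ae_recurrent : conservative mu T ->
  {ae mu, forall x, E x -> visits_infinitely_often x}.
Proof.
move=> consT; pose W := E `\` \bigcup_k (iter k.+1 T @^-1` E).
have mW : measurable W.
  apply: measurableD => //; apply: bigcupT_measurable => k.
  exact: iter_preimage_measurable.
have W0 : mu W = 0%E.
  apply: consT => //; apply: trivIset_ltn => i j ltij.
  apply/seteqP; split=> // x [Wi Wj]; case: Wi => _; apply.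
  exists (j - i.+1)%N => //; rewrite /preimage /= -iterS -iterD.
  by case: Wj => + _; have -> : ((j - i.+1).+1 + i = j)%N by lia.
apply: (@negligibleS _ _ _ _ (\bigcup_n (iter n T @^-1` W))); last first.
  apply: negligible_bigcup => n; apply: iter_preimage_negligible.
  exact/negligibleP.
move=> x /= nx; apply: contrapT => nW; apply: nx => Ex n.
elim: n => [|n [m nm Em]]; first by exists 0%N.
have [?|] := ltnP n m; first by exists m.
move=> mn; have {mn nm} mn : m = n by lia.
subst m; have : ~ W (iter n T x) by move=> Wn; apply: nW; exists n.
move=> /not_andP[//|/contrapT[k _ Ek]].
by exists (k.+1 + n)%N; [lia|rewrite iterD].
Qed.

(** The set of points that visit E infinitely often is invariant and contains
almost all of E. *)
Lemma ae_visits : conservative mu T -> ergodic mu T -> (0 < mu E)%E ->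
  {ae mu, forall x, visits_infinitely_often x}.
Proof.
move=> consT ergT E0; pose A := [set x | visits_infinitely_often x].
have mA : measurable A.
  have -> : A = \bigcap_n \bigcup_(m in [set m | (n <= m)%N]) (iter m T @^-1` E).
    apply/seteqP; split=> x H n => [_|]; first by have [m nm Em] := H n; exists m.
    by have [m nm Em] := H n I; exists m.
  apply: bigcapT_measurable => n; apply: bigcup_measurable => m _.
  exact: iter_preimage_measurable.
have AT : T @^-1` A = A.
  apply/seteqP; split=> x H n.
    by have [m nm] := H n; rewrite -iterSr => Em; exists m.+1 => //; lia.
  have [[|m] nm Em] := H n.+1; first by [].
  by exists m => //; rewrite -iterSr.
case: (ergT A mA AT) => A0; last first.
  by apply/negligibleP => //; exact: measurableC.
exfalso; have := ae_recurrent consT => nE.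
have : mu.-negligible E.
  apply: negligibleS (negligibleU nE ((negligibleP mu mA).2 A0)) => x Ex.
  by have [Ax|nA] := pselect (A x); [right|left => /(_ Ex)].
by move=> /(negligibleP mu mE) E00; move: E0; rewrite E00 ltxx.
Qed.

Definition return_time (x : X) : nat := Num.truncn (fine (first_return R T E x)).

Lemma induced_mapE x : induced_map R T E x = iter (return_time x) T x.
Proof. by []. Qed.

Lemma first_returnE x k : (0 < k)%N -> E (iter k T x) ->
  (forall i, (0 < i < k)%N -> ~ E (iter i T x)) ->
  first_return R T E x = (k%:R)%:E.
Proof.
move=> k0 Ek min_k; apply/le_anti/andP; split.
  by apply: ereal_inf_lbound; exists k.
apply: le_ereal_inf_tmp => _ [l [l0 El] <-]; rewrite lee_fin ler_nat leqNgt.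
by apply/negP => lk; apply: (min_k l) => //; rewrite l0.
Qed.

Lemma first_return_infty x : (forall k, (0 < k)%N -> ~ E (iter k T x)) ->
  first_return R T E x = +oo%E.
Proof.
move=> nE; rewrite /first_return (_ : [set _ | _ in _] = set0) ?ereal_inf0 //.
by apply/seteqP; split=> // y [k [k0 Ek] _]; exact: (nE k).
Qed.

Lemma first_return_dec x : (exists k, [/\ (0 < k)%N, E (iter k T x) &
    forall i, (0 < i < k)%N -> ~ E (iter i T x)]) \/
  (forall k, (0 < k)%N -> ~ E (iter k T x)).
Proof.
have [[k [k0 Ek]]|nE] := pselect (exists k, (0 < k)%N /\ E (iter k T x)); last first.
  by right=> k k0 Ek; apply: nE; exists k.
left; have ex : exists k, `[< (0 < k)%N /\ E (iter k T x) >].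
  by exists k; apply/asboolP.
case: (ex_minnP ex) => l /asboolP[l0 El] lmin; exists l; split=> // i /andP[i0 il] Ei.
have : (l <= i)%N by apply: lmin; apply/asboolP.
lia.
Qed.

Lemma return_timeP x k : (0 < k)%N -> E (iter k T x) ->
  [/\ (0 < return_time x)%N, E (iter (return_time x) T x),
    forall i, (0 < i < return_time x)%N -> ~ E (iter i T x) &
    first_return R T E x = ((return_time x)%:R)%:E].
Proof.
move=> k0 Ek; have [[l [l0 El lmin]]|nE] := first_return_dec x; last first.
  by exfalso; exact: (nE k).
have fE := first_returnE l0 El lmin.
have rl : return_time x = l by rewrite /return_time fE /= natrK.
by rewrite rl; split.
Qed.

Lemma return_gtE n : return_gt R T E n =
  E `&` [set x | forall i, (0 < i <= n)%N -> ~ E (iter i T x)].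
Proof.
apply/seteqP; split=> x [Ex].
  move=> nf; split=> // i /andP[i0 il] Ei.
  have [r0 Er rmin fE] := return_timeP i0 Ei.
  move: nf; rewrite fE lte_fin ltr_nat => nr.
  by apply: (rmin i) => //; rewrite i0 (leq_ltn_trans il).
move=> nE; split=> //; have [[l [l0 El lmin]]|nE'] := first_return_dec x.
  rewrite (first_returnE l0 El lmin) lte_fin ltr_nat ltnNge; apply/negP => ln.
  by apply: (nE l) => //; rewrite l0.
by rewrite first_return_infty // ltry.
Qed.

Lemma return_gt_measurable n : measurable (return_gt R T E n).
Proof.
rewrite return_gtE; apply: measurableI => //.
have -> : [set x | forall i, (0 < i <= n)%N -> ~ E (iter i T x)] =
    \bigcap_(i in [set i | (0 < i <= n)%N]) ~` (iter i T @^-1` E).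
  by apply/seteqP; split=> x.
apply: bigcap_measurableType => i _; apply: measurableC.
exact: iter_preimage_measurable.
Qed.

Definition returns_in (B : set X) k : set X :=
  [set x | [/\ E x, forall i, (0 < i <= k)%N -> ~ E (iter i T x) & B (iter k.+1 T x)]].

Definition enters_in (B : set X) k : set X :=
  [set x | (forall i, (i < k)%N -> ~ E (iter i T x)) /\ B (iter k T x)].

Lemma returns_in_measurable B k : measurable B -> measurable (returns_in B k).
Proof.
move=> mB; have -> : returns_in B k = return_gt R T E k `&` iter k.+1 T @^-1` B.
  by rewrite return_gtE; apply/seteqP; split=> x; [case|case=> -[]].
by apply: measurableI; [exact: return_gt_measurable|exact: iter_preimage_measurable].
Qed.

Lemma enters_in_measurable B k : measurable B -> measurable (enters_in B k).
Proof.
move=> mB; have -> : enters_in B k =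
  \bigcap_(i in [set i | (i < k)%N]) ~` (iter i T @^-1` E) `&` iter k T @^-1` B.
  by apply/seteqP; split=> x.
apply: measurableI; last exact: iter_preimage_measurable.
apply: bigcap_measurableType => i _; apply: measurableC.
exact: iter_preimage_measurable.
Qed.

(** Pull the set back by T once and distinguish whether the starting point lies
in E. *)
Lemma enters_in_split B k : B `<=` E -> measurable B ->
  mu (enters_in B k) = (mu (returns_in B k) + mu (enters_in B k.+1))%E.
Proof.
move=> BE mB; rewrite -(iter_preimage_measure 1); last exact: enters_in_measurable.
have -> : iter 1 T @^-1` enters_in B k = returns_in B k `|` enters_in B k.+1.
  apply/seteqP; split=> x.
    rewrite /preimage /= => -[nE Bk]; have [Ex|nEx] := pselect (E x).
      left; split=> //; last by rewrite iterSr.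
      by move=> [//|i] /= ik; rewrite -iterS iterSr; exact: nE.
    right; split; last by rewrite iterSr.
    by move=> [//|i] ik; rewrite iterSr; exact: nE.
  case=> [[Ex nE Bk]|[nE Bk]]; split; rewrite -?iterSr // => i ik;
    rewrite -iterSr; exact: nE.
rewrite measureU //; [exact: returns_in_measurable|exact: enters_in_measurable|].
by apply/seteqP; split=> // x [[Ex _ _] [nE _]]; exact: (nE 0%N).
Qed.

Lemma returns_in_sum B n : B `<=` E -> measurable B ->
  (\sum_(0 <= k < n) mu (returns_in B k) + mu (enters_in B n))%E = mu B.
Proof.
move=> BE mB; elim: n => [|n IH].
  rewrite big_geq // add0e; congr (mu _).
  by apply/seteqP; split=> x; [case|move=> Bx; split].
by rewrite -IH big_nat_recr //= -addeA -enters_in_split.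
Qed.

Lemma induced_preimageE B : B `<=` E ->
  E `&` induced_map R T E @^-1` B =
  \bigcup_k returns_in B k `|`
  (B `&` [set x | forall k, (0 < k)%N -> ~ E (iter k T x)]).
Proof.
move=> BE; apply/seteqP; split=> x.
  move=> [Ex]; rewrite /preimage /= induced_mapE => Bx.
  have [[k [k0 Ek _]]|nE] := first_return_dec x.
    have [r0 _ rmin _] := return_timeP k0 Ek.
    left; exists (return_time x).-1 => //; split=> //; last by rewrite prednK.
    by move=> i ik; apply: rmin; lia.
  right; split=> //; move: Bx.
  by rewrite /return_time first_return_infty //= truncn0.
case=> [[k _ [Ex nE Bk]]|[Bx nE]].
  split=> //; rewrite /preimage /= induced_mapE.
  have fE := first_returnE (ltn0Sn k) (BE _ Bk) nE.
  by rewrite /return_time fE /= natrK.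
split; first exact: BE.
by rewrite /preimage /= induced_mapE /return_time first_return_infty //= truncn0.
Qed.

Lemma never_returns_measurable :
  measurable [set x | forall k, (0 < k)%N -> ~ E (iter k T x)].
Proof.
have -> : [set x | forall k, (0 < k)%N -> ~ E (iter k T x)] =
    \bigcap_(i in [set i | (0 < i)%N]) ~` (iter i T @^-1` E).
  by apply/seteqP; split=> x.
apply: bigcap_measurableType => i _; apply: measurableC.
exact: iter_preimage_measurable.
Qed.

Lemma induced_preimage_measurable B : B `<=` E -> measurable B ->
  measurable (E `&` induced_map R T E @^-1` B).
Proof.
move=> BE mB; rewrite induced_preimageE //; apply: measurableU.
  by apply: bigcupT_measurable => k; exact: returns_in_measurable.
by apply: measurableI => //; exact: never_returns_measurable.
Qed.

Lemma induced_map_E x : E x -> E (induced_map R T E x).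
Proof.
move=> Ex; rewrite induced_mapE.
have [[k [k0 Ek _]]|nE] := first_return_dec x.
  by have [] := return_timeP k0 Ek.
by rewrite /return_time first_return_infty //= truncn0.
Qed.

Hypothesis consT : conservative mu T.
Hypothesis muE : mu E = 1%E.

(** The sets [returns_in B k] make up the preimage of B under the induced map;
iterating [enters_in_split] from mu B = mu (enters_in B 0), their measures sum to
at most mu B. *)
Lemma induced_preimage_le B : B `<=` E -> measurable B ->
  (mu (E `&` induced_map R T E @^-1` B) <= mu B)%E.
Proof.
move=> BE mB; rewrite induced_preimageE //.
have mret k : measurable (returns_in B k) by exact: returns_in_measurable.
have mN : measurable (B `&` [set x | forall k, (0 < k)%N -> ~ E (iter k T x)]).
  by apply: measurableI => //; exact: never_returns_measurable.
have N0 : mu (B `&` [set x | forall k, (0 < k)%N -> ~ E (iter k T x)]) = 0%E.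
  apply/negligibleP => //; apply: negligibleS (ae_recurrent consT) => x [Bx nE].
  move=> /= H; have [m m1 Em] := H (BE _ Bx) 1%N.
  exact: (nE m).
apply: (@le_trans _ _ (mu (\bigcup_k returns_in B k) +
    mu (B `&` [set x | forall k, (0 < k)%N -> ~ E (iter k T x)]))%E).
  by apply: measureU2 => //; exact: bigcupT_measurable.
rewrite N0 adde0.
have -> : mu (\bigcup_k returns_in B k) =
    (\sum_(0 <= k <oo) mu (returns_in B k))%E.
  apply: measure_semi_bigcup => //; last exact: bigcupT_measurable.
  apply: trivIset_ltn => i j ltij.
  apply/seteqP; split=> // x [[_ _ Bi] [_ nE _]].
  by apply: (nE i.+1) => //; exact: BE.
apply: lime_le; first by apply: is_cvg_nneseries => n _ _; exact: measure_ge0.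
apply: nearW => n; rewrite -(returns_in_sum n BE mB).
by rewrite leeDl.
Qed.

(** The inequality for B and for its complement in E; both sides have total mass
mu E, which is finite. *)
Lemma induced_preimage_measure B : B `<=` E -> measurable B ->
  mu (E `&` induced_map R T E @^-1` B) = mu B.
Proof.
move=> BE mB; apply/le_anti/andP; split; first exact: induced_preimage_le.
have mC : measurable (E `\` B) by exact: measurableD.
have sub : (mu (E `\` B) <= mu E)%E by apply: le_measure; rewrite ?inE.
have finC : mu (E `\` B) \is a fin_num.
  by rewrite ge0_fin_numE // (le_lt_trans sub) // muE ltry.
have H := induced_preimage_le (@subDsetl _ E B) mC.
rewrite -(leeD2rE _ _ finC).
have -> : (mu B + mu (E `\` B))%E = mu E.
  rewrite -measureU //; last by rewrite setDE setICA setICr setI0.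
  by congr (mu _); apply/seteqP; split=> x;
    [case=> [/BE//|[]]|move=> Ex; have [|] := pselect (B x); [left|right]].
have -> : mu E = (mu (E `&` induced_map R T E @^-1` B) +
                  mu (E `&` induced_map R T E @^-1` (E `\` B)))%E.
  rewrite -measureU; [congr (mu _)| | |].
  - apply/seteqP; split=> x; last by case=> -[].
    move=> Ex; have := induced_map_E Ex => ETx.
    by have [Bx|nB] := pselect (B (induced_map R T E x)); [left|right].
  - exact: induced_preimage_measurable.
  - by apply: induced_preimage_measurable => //; exact: subDsetl.
  - by apply/seteqP; split=> // x [[_ Bx] [_ [_ nB]]].
exact: leeD2l.
Qed.

Lemma iter_induced_E n x : E x -> E (iter n (induced_map R T E) x).
Proof. by move=> Ex; elim: n => //= n; exact: induced_map_E. Qed.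

Lemma iter_induced_preimage n B : B `<=` E -> measurable B ->
  measurable (E `&` iter n (induced_map R T E) @^-1` B) /\
  mu (E `&` iter n (induced_map R T E) @^-1` B) = mu B.
Proof.
elim: n B => [|n IH] B BE mB.
  by have -> : E `&` iter 0 (induced_map R T E) @^-1` B = B by rewrite setIidr.
have -> : E `&` iter n.+1 (induced_map R T E) @^-1` B =
    E `&` iter n (induced_map R T E) @^-1` (E `&` induced_map R T E @^-1` B).
  apply/seteqP; split=> x [Ex]; rewrite /preimage /=; last by case.
  by move=> Bx; split=> //; split=> //; exact: iter_induced_E.
have [H1 H2] := IH (E `&` induced_map R T E @^-1` B) (@subIsetl _ _ _)
  (induced_preimage_measurable BE mB).
by split=> //; rewrite H2 induced_preimage_measure.
Qed.

End Recurrence.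

(** * Coding the partition *)

Section PartitionCode.
Context d (X : measurableType d) (E : set X) (PE : set (set X)).
Hypothesis mE : measurable E.
Hypothesis cPE : countable PE.
Hypothesis mPE : forall A, PE A -> measurable A.
Hypothesis partPE : partition PE id E.

(** A numbering of the countably many atoms: code is constant on each of them and
tells them apart. *)
Lemma partition_code_exists : exists code : X -> nat,
  [/\ forall v, measurable (E `&` [set x | code x = v]),
    forall A x y, PE A -> A x -> A y -> code x = code y &
    forall x, E x -> exists2 A, PE A & E `&` [set y | code y = code x] `<=` A].
Proof.
have [covE trivE _] := partPE.
have [f f_inj] := countable_injP _ cPE.
pose blk x : set X := xget set0 [set A | PE A /\ A x].
have blkP x : E x -> PE (blk x) /\ blk x x.
  move=> Ex; rewrite /blk; case: xgetP => [A _ //|nA]; exfalso.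
  by move: Ex; rewrite -covE => -[A PA Ax]; exact: (nA A).
have blkE A x : PE A -> A x -> blk x = A.
  move=> PA Ax; have Ex : E x by rewrite -covE; exists A.
  have [PB Bx] := blkP x Ex.
  by apply: trivE => //; exists x.
exists (f \o blk); split.
- move=> v; have [[A [PA fA]]|nA] := pselect (exists A, PE A /\ f A = v).
    have -> : E `&` [set x | (f \o blk) x = v] = A; last exact: mPE.
    apply/seteqP; split=> x.
      move=> [Ex] /= fx; have [PB Bx] := blkP x Ex.
      by rewrite -(f_inj (blk x) A) ?inE // fA.
    move=> Ax; have Ex : E x by rewrite -covE; exists A.
    by split=> //=; rewrite (blkE A x).
  have -> : E `&` [set x | (f \o blk) x = v] = set0 => //.
  apply/seteqP; split=> // x [Ex] /= fx; apply: nA.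
  by exists (blk x); split=> //; have [] := blkP x Ex.
- by move=> A x y PA Ax Ay /=; rewrite (blkE A x) // (blkE A y).
- move=> x Ex; have [PB Bx] := blkP x Ex; exists (blk x) => // y [Ey] /= fyx.
  have [PB' By] := blkP y Ey.
  by rewrite -(f_inj (blk y) (blk x)) ?inE.
Qed.

End PartitionCode.

Lemma measurable_code d (X : measurableType d) (E : set X) (code : X -> nat) :
  (forall v, measurable (E `&` [set x | code x = v])) ->
  forall V : set nat, measurable (E `&` code @^-1` V).
Proof.
move=> mcode V.
have -> : E `&` code @^-1` V = \bigcup_(v in V) (E `&` [set x | code x = v]).
  apply/seteqP; split=> x; first by move=> [Ex Vx]; exists (code x).
  by move=> [v Vv [Ex cx]]; split=> //; rewrite /preimage /= cx.
by apply: bigcup_measurable => v _; exact: mcode.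
Qed.

Section InducedMixing.
Context d (X : measurableType d) (R : realType).
Variables (mu : {measure set X -> \bar R}) (T : X -> X) (E : set X).
Hypothesis mpT : measure_preserving mu T.
Hypothesis consT : conservative mu T.
Hypothesis mE : measurable E.
Hypothesis muE : mu E = 1%E.
Variable code : X -> nat.
Hypothesis mcode : forall v, measurable (E `&` [set x | code x = v]).

Local Notation TE := (induced_map R T E).
Local Notation P := (mrestr mu mE).

(** The value 0 off E makes every coordinate measurable on the whole space;
[mrestr mu mE] does not charge these points. *)
Definition code_process (i : nat) (x : X) : nat :=
  if `[< E x >] then code (iter i TE x) else 0%N.
Local Notation Z := code_process.

(** The observables to which the mixing hypothesis is applied.  They are indexed
from 1, whence the shift between Y and the coordinates of [code_process]. *)
Let Y (n : nat) : X -> R := (fun x => (code x)%:R) \o iter n.-1 TE.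

Definition code_psi (n : nat) : R := fine (psi_coef mu E Y n).

Hypothesis psi_series :
  (\sum_(1 <= n <oo) (psi_coef mu E Y n * (n%:R^-1)%:E) < +oo)%E.
Hypothesis psi_cvg : psi_mixing mu E Y.

Let sigE I : sigma_algebra E (sigma_field E Y I).
Proof. exact: smallest_sigma_algebra. Qed.

Lemma psi_coef_ge0 n : (0 <= psi_coef mu E Y n)%E.
Proof.
apply: ereal_sup_ubound; exists 1%N, E, E.
have SE I : sigma_field E Y I E.
  by have [S0 SC _] := sigE I; rewrite -[X in sigma_field E Y I X]setD0; exact: SC.
split=> //; first by rewrite muE.
by rewrite setIid muE /= mulr1 divr1 subrr normr0.
Qed.

Lemma psi_term_ge0 n :
  (0 <= psi_coef mu E Y n * (n%:R^-1)%:E)%E.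
Proof. by rewrite mule_ge0 ?psi_coef_ge0 // lee_fin invr_ge0. Qed.

(** An infinite coefficient would make the series infinite. *)
Lemma psi_coef_fin n : (0 < n)%N -> psi_coef mu E Y n \is a fin_num.
Proof.
move=> n0; rewrite ge0_fin_numE ?psi_coef_ge0 // ltey; apply/eqP => psioo.
move: psi_series; rewrite ereal_series (@eseries_pinfty _ _ _ n) //.
- by move=> k _; rewrite gt_eqF // (lt_le_trans ltNy0 (psi_term_ge0 k)).
- by rewrite psioo gt0_mulye // lte_fin invr_gt0 ltr0n.
Qed.

Lemma code_psi_sum : bounded_sums (fun n => code_psi n.+1 / n.+1%:R).
Proof.
have := psi_series; set S := (\sum_(1 <= n <oo) _)%E => S1.
have S0 : (0 <= S)%E by apply: nneseries_ge0 => n _ _; exact: psi_term_ge0.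
have SE : S \is a fin_num by rewrite ge0_fin_numE.
exists (fine S) => n; rewrite -lee_fin fineK // -sumEFin.
apply: (@le_trans _ _ (\sum_(1 <= k < n.+1) psi_coef mu E Y k * (k%:R^-1)%:E)%E).
  rewrite big_add1 /= big_mkord le_eqVlt; apply/orP; left; apply/eqP.
  apply: eq_bigr => k _; rewrite EFinM /code_psi fineK //.
  exact: psi_coef_fin.
by apply: nneseries_lim_ge => k _ _; exact: psi_term_ge0.
Qed.

Lemma code_psi_small (e : R) : 0 < e -> \forall n \near \oo, code_psi n < e.
Proof.
move=> e0; have := psi_cvg; rewrite /psi_mixing => /fine_cvgP[_].
move=> /cvgrPdist_lt /(_ e e0); apply: filterS => n /=.
by rewrite sub0r normrN ger0_norm // fine_ge0 // psi_coef_ge0.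
Qed.

Lemma code_processE i x : E x -> Z i x = code (iter i TE x).
Proof. by move=> Ex; rewrite /code_process asboolT. Qed.

Let code_sigma I l v : I l.+1 -> sigma_field E Y I (E `&` [set x | Z l x = v]).
Proof.
move=> Il; apply: sub_sigma_algebra; exists l.+1 => //.
exists [set (v%:R : R)]; first exact: measurable_set1.
apply/seteqP; split=> x [Ex]; rewrite /Y /preimage /=.
  by move=> /eqP; rewrite eqr_nat => /eqP; rewrite code_processE.
by rewrite code_processE // => <-.
Qed.

Lemma code_process_level i (V : set nat) : E `&` Z i @^-1` V =
  E `&` iter i TE @^-1` (E `&` code @^-1` V).
Proof.
apply/seteqP; split=> x [Ex]; rewrite /preimage /= code_processE //.
  by move=> Vx; split=> //; split=> //; exact: iter_induced_E.
by move=> [_].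
Qed.

(** Events determined by coordinates belong to the sigma-fields of the mixing
hypothesis, and invariance under the induced map gives stationarity. *)
Lemma code_process_mixing : mixing_process P Z code_psi.
Proof.
have mV := measurable_code mcode.
have inv (V : set nat) i : measurable (E `&` Z i @^-1` V) /\
    mu (E `&` Z i @^-1` V) = mu (E `&` code @^-1` V).
  rewrite code_process_level.
  by apply: iter_induced_preimage => //; exact: subIsetl.
have prP A : pr P A = fine (mu (E `&` A)) by rewrite /pr /= /mrestr setIC.
split.
- by rewrite /= /mrestr setTI.
- move=> i v; have [mZ _] := inv [set v] i.
  have -> : [set x | Z i x = v] = (E `&` Z i @^-1` [set v]) `|`
      (if v == 0%N then ~` E else set0).
    apply/seteqP; split=> x /=.
      have [Ex|nEx] := pselect (E x); first by left.
      by rewrite /code_process asboolF // => <-; right.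
    by case=> [[]//|]; case: eqP => [-> /= nE|//]; rewrite /code_process asboolF.
  by apply: measurableU => //; case: eqP => // _; exact: measurableC.
- by move=> n; rewrite fine_ge0 // psi_coef_ge0.
- move=> j i n B C /andP[j0 ji] dB dC.
  set I1 := [set k | (1 <= k <= j)%N]; set I2 := [set k | (j + (i - j).+1 <= k)%N].
  have SB : sigma_field E Y I1 (E `&` B).
    apply: determined_sigma_algebra dB => // l v /andP[_ lj].
    by apply: code_sigma; rewrite /I1 /=.
  have SC : sigma_field E Y I2 (E `&` C).
    apply: determined_sigma_algebra dC => // l v /andP[il _].
    by apply: code_sigma; rewrite /I2 /=; lia.
  have finE A : (mu (E `&` A) <= 1)%E -> mu (E `&` A) \is a fin_num.
    by move=> A1; rewrite ge0_fin_numE // (le_lt_trans A1) // ltry.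
  have mfield I A : sigma_field E Y I (E `&` A) -> measurable (E `&` A).
    have := @smallest_sub _ (sigma_algebra E) (\bigcup_(n in I)
      preimage_set_system E (Y n) measurable) [set A | measurable A /\ A `<=` E].
    move=> H SA; suff [] : [set A | measurable A /\ A `<=` E] (E `&` A) by [].
    apply: H SA.
      split=> [|D [mD DE]|F mF].
      + by split.
      + by split; [exact: measurableD|exact: subDsetl].
      + split; first by apply: bigcupT_measurable => k; case: (mF k).
        by move=> x [k _]; case: (mF k) => _; apply.
    move=> _ [k Ik [V mVV <-]]; split; last exact: subIsetl.
    pose W : set nat := [set v | V (v%:R : R)].
    have -> : E `&` Y k @^-1` V = E `&` Z k.-1 @^-1` W.
      apply/seteqP; split=> x [Ex]; rewrite /Y /W /preimage /= code_processE //.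
    by have [] := inv W k.-1.
  have le1 A I : sigma_field E Y I (E `&` A) -> (mu (E `&` A) <= 1)%E.
    by move=> /mfield mA; rewrite -muE; apply: le_measure; rewrite ?inE.
  have fB := finE _ (le1 _ _ SB); have fC := finE _ (le1 _ _ SC).
  have EBC : E `&` (B `&` C) = (E `&` B) `&` (E `&` C) by rewrite setIACA setIid.
  have mEB := mfield _ _ SB; have mEC := mfield _ _ SC.
  rewrite !prP EBC; set be := mu (E `&` B) in fB *; set ga := mu (E `&` C) in fC *.
  set de := mu _.
  have de0 : (0 <= de)%E by exact: measure_ge0.
  have deb : (de <= be)%E.
    by apply: le_measure; rewrite ?inE //; exact: measurableI.
  have dec : (de <= ga)%E.
    by apply: le_measure; rewrite ?inE //; exact: measurableI.
  have b0 : (0 <= be)%E by exact: measure_ge0.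
  have c0 : (0 <= ga)%E by exact: measure_ge0.
  have [B0|Bn0] := eqVneq be 0%E.
    have -> : de = 0%E by apply/le_anti; rewrite de0 andbT -B0.
    by rewrite B0 /= mul0r subr0 mulr0 normr0.
  have [C0|Cn0] := eqVneq ga 0%E.
    have -> : de = 0%E by apply/le_anti; rewrite de0 andbT -C0.
    by rewrite C0 /= mulr0 subr0 mulr0 normr0.
  have fbp : 0 < fine be by rewrite fine_gt0 // lt0e Bn0 b0 /= ltey_eq fB.
  have fcp : 0 < fine ga by rewrite fine_gt0 // lt0e Cn0 c0 /= ltey_eq fC.
  have : (`|fine de / (fine be * fine ga) - 1|%:E <= psi_coef mu E Y (i - j).+1)%E.
    apply: ereal_sup_ubound; exists j, (E `&` B), (E `&` C); split=> //.
    by rewrite !lt0e -/be -/ga Bn0 Cn0.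
  have pn : psi_coef mu E Y (i - j).+1 \is a fin_num by exact: psi_coef_fin.
  rewrite -(fineK pn) lee_fin -/(code_psi _) => H.
  have bc : 0 < fine be * fine ga by rewrite mulr_gt0.
  have -> : fine de - fine be * fine ga =
      (fine de / (fine be * fine ga) - 1) * (fine be * fine ga).
    by field; rewrite !gt_eqF.
  by rewrite normrM (gtr0_norm bc) ler_pM2r.
- by move=> i V; rewrite !prP (inv V i).2 (inv V 0%N).2.
Qed.

End InducedMixing.

(** * Comparison of tails *)

Section TailComparison.
Context (R : realType) (a b : nat -> R) (kap : R).
Hypothesis b_gt0 : forall s, 0 < b s.
Hypothesis kap0 : 0 <= kap.
Hypothesis ab : forall e : R, 0 < e -> \forall s \near \oo,
  `|a s - kap * b s| <= e * b s.

Lemma tail_upper : exists2 C : R, 0 <= C & forall s, a s <= C * b s.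
Proof.
have [K _ HK] := ab ltr01.
exists (kap + 1 + \sum_(s < K) `|a s| / b s).
  by rewrite !addr_ge0 // sumr_ge0 // => s _; rewrite divr_ge0 // ltW.
move=> s; have bs := ltW (b_gt0 s).
have S0 : 0 <= \sum_(s < K) `|a s| / b s.
  by rewrite sumr_ge0 // => l _; rewrite divr_ge0 // ltW.
have [Ks|sK] := leqP K s.
  have := HK s Ks; rewrite ler_distl => /andP[_ H].
  have := mulr_ge0 S0 bs; lra.
have : `|a s| / b s <= \sum_(s < K) `|a s| / b s.
  rewrite (bigD1 (Ordinal sK)) //= lerDl sumr_ge0 // => l _.
  by rewrite divr_ge0 // ltW.
rewrite ler_pdivrMr // => H; have := ler_norm (a s).
have := mulr_ge0 kap0 bs; lra.
Qed.

(** As the partial sums of b are unbounded in the applications, the constant D is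
negligible. *)
Lemma partial_sum_equivalence (e : R) : 0 < e -> exists D : R, forall n,
  `|partial_sum a n - kap * partial_sum b n| <= e * partial_sum b n + D.
Proof.
move=> e0; have [K _ HK] := ab e0.
exists (\sum_(s < K) `|a s - kap * b s|) => n.
rewrite /partial_sum !mulr_sumr -sumrB.
apply: le_trans (ler_norm_sum _ _ _) _.
rewrite -(big_mkord xpredT (fun s => `|a s - kap * b s|)).
elim: n => [|n IH].
  by rewrite !(big_geq (leqnn 0)) add0r sumr_ge0.
rewrite [leLHS]big_nat_recr //= [X in _ <= X + _]big_nat_recr //=.
have [Kn|nK] := leqP K n; first by have := HK n Kn; lra.
have eb i : 0 <= e * b i by rewrite mulr_ge0 // ltW.
rewrite [X in _ <= _ + X](big_cat_nat (n := n.+1)) //= big_nat_recr //=.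
have S1 : 0 <= \sum_(0 <= i < n) e * b i by apply: sumr_ge0.
have S2 : 0 <= \sum_(n.+1 <= i < K) `|a i - kap * b i| by apply: sumr_ge0.
by rewrite addrA; have := eb n; lra.
Qed.

End TailComparison.

Section MeasureTails.
Context d (X : measurableType d) (R : realType) (mu : {measure set X -> \bar R}).

Lemma measure_le_negligible A B : measurable A -> measurable B ->
  mu.-negligible (A `\` B) -> (mu A <= mu B)%E.
Proof.
move=> mA mB [N [mN N0 AN]].
apply: (@le_trans _ _ (mu (B `|` N))).
  apply: le_measure; rewrite ?inE //; first exact: measurableU.
  by move=> x Ax; have [Bx|nB] := pselect (B x); [left|right; apply: AN].
apply: (@le_trans _ _ (mu B + mu N)%E); first exact: measureU2.
by rewrite N0 adde0.
Qed.

(** A nonnegative r is at most the number of natural numbers s < r, so the sum of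
the tails dominates the integral. *)
Lemma integrable_of_tails (E : set X) (g : X -> R) (M : R) : measurable E ->
  (mu E < +oo)%E ->
  measurable_fun setT g -> (forall x, 0 <= g x) ->
  (forall n, \sum_(0 <= s < n) fine (mu (E `&` [set x | s%:R < g x])) <= M) ->
  mu.-integrable E (EFin \o g).
Proof.
move=> mE Efin mg g0 gM; apply/integrableP; split.
  by apply/measurable_EFinP; exact: measurable_funS mg.
have mgs (s : nat) : measurable [set x | s%:R < g x].
  rewrite -[X in measurable X]setTI.
  have -> : [set x | s%:R < g x] = g @^-1` `]s%:R, +oo[%classic.
    by apply/seteqP; split=> x; rewrite /preimage /= in_itv /= andbT.
  exact: mg.
pose F (s : nat) (x : X) := (\1_[set x | s%:R < g x] x)%:E : \bar R.
apply: (@le_lt_trans _ _ (\int[mu]_(x in E) (\sum_(s <oo) F s x))%E).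
  apply: ge0_le_integral => //.
  - apply: measurableT_comp => //; apply/measurable_EFinP.
    exact: measurable_funS mg.
  - apply: ge0_emeasurable_sum => [n x _ _|n _]; first by rewrite lee_fin.
    by apply/measurable_EFinP; exact: measurable_indic.
  move=> x _; rewrite /= ger0_norm //.
  have [_ gx] := andP (truncn_itv (g0 x)).
  apply: (@le_trans _ _ (\sum_(0 <= s < (Num.truncn (g x)).+1) F s x)%E); last first.
    by apply: nneseries_lim_ge => n _ _; rewrite lee_fin.
  rewrite /F sumEFin lee_fin.
  have [ltx|] := ltrP (Num.truncn (g x))%:R (g x); last first.
    move=> lex; apply: (@le_trans _ _ (Num.truncn (g x))%:R) => //.
    rewrite big_nat_recr //= -[leLHS]addr0; apply: lerD; last by [].
    have := @sum_ge_const R 0 (Num.truncn (g x))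
      (fun s => \1_[set x | s%:R < g x] x) 1.
    rewrite subn0 mulr1; apply => s /andP[_ sx]; rewrite indicE mem_set //=.
    have /andP[H _] := truncn_itv (g0 x).
    by apply: lt_le_trans H; rewrite ltr_nat.
  have := @sum_ge_const R 0 (Num.truncn (g x)).+1
    (fun s => \1_[set x | s%:R < g x] x) 1.
  rewrite subn0 mulr1 => H; apply: le_trans (ltW gx) _; apply: H => s /andP[_ sx].
  rewrite indicE mem_set //=; apply: le_lt_trans ltx.
  by rewrite ler_nat -ltnS.
rewrite integral_nneseries //; last 2 first.
- by move=> n; apply/measurable_EFinP; exact: measurable_indic.
- by move=> n x _; rewrite lee_fin.
apply: (@le_lt_trans _ _ M%:E); last exact: ltry.
apply: lime_le.
  by apply: is_cvg_nneseries => n _ _; apply: integral_ge0 => x _; rewrite lee_fin.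
apply: nearW => n.
rewrite (eq_bigr (fun s => (fine (mu (E `&` [set x | s%:R < g x])))%:E)).
  by rewrite sumEFin lee_fin.
move=> s _; rewrite /F integral_indic // setIC fineK // ge0_fin_numE //.
apply: le_lt_trans Efin; apply: le_measure; rewrite ?inE //.
exact: measurableI.
Qed.

End MeasureTails.

Lemma nat_ceil (R : realType) (r : R) : 0 <= r ->
  exists v : nat, r <= v%:R < r + 1.
Proof.
move=> r0; have /andP[H1 H2] := truncn_itv r0.
have [H|H] := lerP r (Num.truncn r)%:R.
  by exists (Num.truncn r); rewrite H; lra.
by exists (Num.truncn r).+1; rewrite (ltW H2) -natr1 ltrD2r.
Qed.

Lemma nat_ceil_lt (R : realType) (r : R) (v s : nat) : r <= v%:R < r + 1 ->
  (s < v)%N <-> s%:R < r.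
Proof.
move=> /andP[H1 H2]; split=> H.
  have : s.+1%:R <= v%:R :> R by rewrite ler_nat.
  by rewrite -natr1; lra.
by rewrite -(ltr_nat R); exact: lt_le_trans H1.
Qed.

(** * Coded return times and observable *)

Section Coding.
Context d (X : measurableType d) (R : realType).
Variables (mu : {measure set X -> \bar R}) (T : X -> X) (E : set X).
Hypothesis mpT : measure_preserving mu T.
Hypothesis consT : conservative mu T.
Hypothesis mE : measurable E.
Hypothesis muE : mu E = 1%E.
Variables (PE : set (set X)) (code : X -> nat).
Hypothesis mcode : forall v, measurable (E `&` [set x | code x = v]).
Hypothesis code_block : forall x, E x ->
  exists2 A, PE A & E `&` [set y | code y = code x] `<=` A.
Local Notation TE := (induced_map R T E).
Local Notation P := (mrestr mu mE).
Local Notation Z := (code_process R T E code).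

(** Up to null sets every atom lies in one level set of the first return time. *)
Lemma return_code_exists : finer mu PE (level_sets R T E) ->
  exists f : nat -> nat,
  {ae mu, forall x, E x -> first_return R T E x = ((f (code x))%:R)%:E}.
Proof.
move=> finPE.
have : forall v, exists n : nat,
    mu.-negligible (E `&` [set x | code x = v] `\` return_eq R T E n).
  move=> v; have [[x [Ex xv]]|nx] := pselect (exists x, E x /\ code x = v); last first.
    exists 0%N; apply: negligibleS (negligible_set0 mu) => x [[Ex xv] _].
    by apply: nx; exists x.
  have [A PA EA] := code_block Ex.
  have [_ [n _ <-] AB] := finPE A PA; exists n.
  apply: negligibleS AB => y [[Ey yv] nB]; split=> //; apply: EA.
  by split=> //=; rewrite xv.
move=> /choice[f Hf]; exists f.
apply: (@negligibleS _ _ _ _ (\bigcup_v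
    (E `&` [set x | code x = v] `\` return_eq R T E (f v)))).
  move=> x /= /not_implyP[Ex nf]; exists (code x) => //; split=> //.
  by move=> [].
exact: negligible_bigcup.
Qed.

(** Rounding up to a natural number keeps the events g > s for natural s
([nat_ceil_lt]) and changes sums over n visits by at most n. *)
Lemma observable_code_exists (g : X -> R) : (forall x, 0 <= g x) ->
  constant_on_partition PE g ->
  exists f : nat -> nat, forall x, E x -> g x <= (f (code x))%:R < g x + 1.
Proof.
move=> g0 gP.
have : forall v, exists n : nat, forall x, E x -> code x = v ->
    g x <= n%:R < g x + 1.
  move=> v; have [[x [Ex xv]]|nx] := pselect (exists x, E x /\ code x = v); last first.
    by exists 0%N => x Ex xv; exfalso; apply: nx; exists x.
  have [n Hn] := nat_ceil (g0 x); exists n => y Ey yv.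
  have [A PA EA] := code_block Ex.
  suff -> : g y = g x by [].
  by apply: (gP A PA); apply: EA => //; split=> //=; rewrite xv.
by move=> /choice[f Hf]; exists f => x Ex; exact: Hf.
Qed.

Lemma ae_mrestr (Q : X -> Prop) : {ae P, forall x, Q x} ->
  {ae mu, forall x, E x -> Q x}.
Proof.
move=> [B [mB B0 QB]]; exists (B `&` E); split.
- exact: measurableI.
- exact: B0.
- by move=> x /not_implyP[Ex nQ]; split=> //; exact: QB.
Qed.

(** Preimages of null subsets of E under the induced map are null. *)
Lemma ae_iter_induced (Q : X -> Prop) : {ae mu, forall x, E x -> Q x} ->
  {ae mu, forall x, E x -> forall n, Q (iter n TE x)}.
Proof.
move=> [B [mB B0 QB]].
have BE0 : mu (B `&` E) = 0%E.
  apply/le_anti; rewrite measure_ge0 andbT -B0.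
  by apply: le_measure; rewrite ?inE //; exact: measurableI.
apply: (@negligibleS _ _ _ _ (\bigcup_n (E `&` iter n TE @^-1` (B `&` E)))).
  move=> x /= /not_implyP[Ex /existsNP[n nQ]]; exists n => //; split=> //.
  split; last exact: iter_induced_E.
  apply: QB => /= H; apply: nQ; apply: H; exact: iter_induced_E.
apply: negligible_bigcup => n.
have [m1 m2] := @iter_induced_preimage _ _ _ _ _ _ mpT mE consT muE n (B `&` E)
  (@subIsetr _ _ _) (measurableI _ _ mB mE).
by apply/negligibleP => //; exact: (eq_trans m2 BE0).
Qed.

Lemma pr_code (V : set nat) : pr P (Z 0%N @^-1` V) = fine (mu (E `&` code @^-1` V)).
Proof.
rewrite /pr /= /mrestr; congr (fine (mu _)); apply/seteqP; split=> x.
  by move=> [Vx Ex]; split=> //; move: Vx; rewrite /preimage /= code_processE.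
by move=> [Ex Vx]; split=> //; rewrite /preimage /= code_processE.
Qed.

Lemma return_code_tail (f : nat -> nat) :
  {ae mu, forall x, E x -> first_return R T E x = ((f (code x))%:R)%:E} ->
  forall (V : set nat) s,
  mu ((E `&` code @^-1` V) `&` return_gt R T E s) =
  mu (E `&` code @^-1` (V `&` [set v | (s < f v)%N])).
Proof.
move=> fE V s.
have m1 : measurable ((E `&` code @^-1` V) `&` return_gt R T E s).
  apply: measurableI; first exact: measurable_code.
  exact: (return_gt_measurable mpT mE).
have m2 := measurable_code mcode (V `&` [set v | (s < f v)%N]).
apply/le_anti/andP; split; apply: measure_le_negligible => //.
  apply: negligibleS fE => x [[[Ex Vx] [_ xs]] nE] /= fx; apply: nE.
  split=> //; split=> //=; move: xs; rewrite (fx Ex) lte_fin ltr_nat.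
  by [].
apply: negligibleS fE => x [[Ex [Vx xs]] nE] /= fx; apply: nE.
by split=> //; split=> //; rewrite (fx Ex) lte_fin ltr_nat.
Qed.

(** The orbit of the induced map, started at the first point in E, consists of
all the visits, and the return times are the gaps between them. *)
Lemma orbit_visits (x : X) (e : nat) (p : nat -> nat) :
  E (iter e T x) -> (forall s, (s < e)%N -> ~ E (iter s T x)) ->
  visits_infinitely_often T E (iter e T x) ->
  (forall n, first_return R T E (iter n TE (iter e T x)) = ((p n)%:R)%:E) ->
  [/\ forall n, iter n TE (iter e T x) = iter (visit_time e p n) T x,
    forall n, (0 < p n)%N &
    forall s, E (iter s T x) <-> exists n, s = visit_time e p n].
Proof.
move=> Ee emin vis pE; set y := iter e T x in Ee vis pE *.
have rE n : return_time R T E (iter n TE y) = p n.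
  by rewrite /return_time pE /= natrK.
have itE n : iter n TE y = iter (visit_time e p n) T x.
  elim: n => [|n IH]; first by rewrite /visit_time big_ord0 addn0.
  by rewrite iterS induced_mapE rE IH -iterD addnC -visit_timeS.
have ret n : exists2 k, (0 < k)%N & E (iter k T (iter n TE y)).
  have [m nm Em] := vis (visit_time e p n).+1.
  have en : (e <= visit_time e p n)%N by rewrite leq_addr.
  exists (m + e - visit_time e p n)%N; first by lia.
  rewrite itE -iterD subnK; last by lia.
  by rewrite iterD.
have p0 n : (0 < p n)%N.
  by have [k k0 /(return_timeP R k0)[]] := ret n; rewrite rE.
split=> // s; split=> [Es|[n ->]]; last first.
  by rewrite -itE; exact: iter_induced_E.
have es : (e <= s)%N by rewrite leqNgt; apply/negP => /emin.
have [n /andP[ns sn]] := visit_index p0 es.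
exists n; apply/eqP; rewrite eqn_leq ns andbT leqNgt; apply/negP => ns'.
have [k k0 /(return_timeP R k0)[_ _ rmin _]] := ret n.
apply: (rmin (s - visit_time e p n)%N).
  by rewrite rE; move: sn; rewrite visit_timeS; lia.
by rewrite itE -iterD subnK.
Qed.

End Coding.

(** * Tails of the return time and of the observable *)

Section ReturnTails.
Context d (X : measurableType d) (R : realType).
Variables (mu : {measure set X -> \bar R}) (T : X -> X) (E : set X).
Hypothesis mpT : measure_preserving mu T.
Hypothesis mE : measurable E.
Hypothesis muE : mu E = 1%E.
Variables (g : X -> R) (kappa c : R).
Hypothesis g_measurable : measurable_fun setT g.
Hypothesis g_ge0 : forall x, 0 <= g x.
Hypothesis tail_summable :
  (\sum_(1 <= n <oo)
     (n%:R * fine (mu (return_gt R T E n)) ^+ 2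
       / wandering_rate mu T E n ^+ 2)%:E < +oo)%E.
Hypothesis kappa_gt0 : 0 < kappa.
Hypothesis g_tail : asymp_equiv (fun n : nat => fine (mu [set x | n%:R < g x]))
  (fun n : nat => kappa * fine (mu (return_gt R T E n))).
Hypothesis g_not_integrable : ~ mu.-integrable E (EFin \o g).
Hypothesis g_outside : forall x, ~ E x -> g x = c.

Definition return_tail (n : nat) : R := fine (mu (return_gt R T E n)).
Definition observable_tail (n : nat) : R :=
  fine (mu (E `&` [set x | n%:R < g x])).

Let m_gt n : measurable (return_gt R T E n) := return_gt_measurable mpT mE n.

Let fin_sub A : measurable A -> A `<=` E -> mu A \is a fin_num.
Proof.
move=> mA AE; rewrite ge0_fin_numE //; apply: (@le_lt_trans _ _ (mu E)).
  by apply: le_measure; rewrite ?inE.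
by rewrite muE ltry.
Qed.

Let gt_fin n : mu (return_gt R T E n) \is a fin_num.
Proof. by apply: fin_sub => // x []. Qed.

Lemma return_tail_noninc m n : (m <= n)%N -> return_tail n <= return_tail m.
Proof.
move=> mn; apply: fine_le => //; apply: le_measure; rewrite ?inE //.
by move=> x [Ex H]; split=> //; apply: le_lt_trans H; rewrite lee_fin ler_nat.
Qed.

Lemma return_tail_ge0 n : 0 <= return_tail n.
Proof. by rewrite fine_ge0. Qed.

(** If the tail vanished at some n, it would vanish from then on, and so would the
quotients of g_tail (division by 0 being 0), which tend to 1. *)
Lemma return_tail_gt0 n : 0 < return_tail n.
Proof.
rewrite lt0r return_tail_ge0 andbT; apply/eqP => n0.
have /cvgrPdist_lt /(_ 1 ltr01)[K _ HK] := g_tail.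
have := HK (maxn n K) (leq_maxr _ _).
have -> : fine (mu (return_gt R T E (maxn n K))) = 0.
  apply/le_anti; rewrite return_tail_ge0 andbT.
  by rewrite -n0; apply: return_tail_noninc; exact: leq_maxl.
by rewrite mulr0 invr0 mulr0 subr0 normr1 ltxx.
Qed.

(** For n beyond |c| the points with g > n lie in E. *)
Lemma observable_tailE : \forall n \near \oo,
  observable_tail n = fine (mu [set x | n%:R < g x]).
Proof.
exists (Num.truncn `|c|).+1 => // n /= cn; congr (fine (mu _)).
apply/seteqP; split=> x; first by case.
move=> gx; split=> //; apply: contrapT => nE; move: gx; rewrite /= g_outside //.
apply/negP; rewrite -leNgt; apply: le_trans (ler_norm c) _.
have /andP[_ /ltW H] := truncn_itv (normr_ge0 c); apply: le_trans H _.
by rewrite ler_nat.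
Qed.

Lemma observable_tail_equiv (e : R) : 0 < e -> \forall s \near \oo,
  `|observable_tail s - kappa * return_tail s| <= e * return_tail s.
Proof.
move=> e0; have /cvgrPdist_le H := g_tail.
near=> s.
have t0 := return_tail_gt0 s.
have -> : observable_tail s = fine (mu [set x | s%:R < g x]).
  by near: s; exact: observable_tailE.
have : `|1 - fine (mu [set x | s%:R < g x]) / (kappa * return_tail s)| <= e / kappa.
  by near: s; apply: H; rewrite divr_gt0.
set w := fine _; have kt : 0 < kappa * return_tail s by rewrite mulr_gt0.
move=> H1; rewrite distrC.
have -> : kappa * return_tail s - w =
    (1 - w / (kappa * return_tail s)) * (kappa * return_tail s).
  by field; rewrite !gt_eqF.
rewrite normrM (gtr0_norm kt) -ler_pdivlMr //.
by apply: le_trans H1 _; rewrite le_eqVlt; apply/orP; left; apply/eqP; field; rewrite !gt_eqF.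
Unshelve. all: by end_near. Qed.

(** Divergence is the point: if the tails of the return time were summable, those
of g would be, and g would be integrable on E. *)
Lemma return_tail_regular : regular_tail return_tail.
Proof.
have upper := tail_upper return_tail_gt0 (ltW kappa_gt0) observable_tail_equiv.
split.
- exact: return_tail_noninc.
- exact: return_tail_gt0.
- move=> n; rewrite -lee_fin /return_tail fineK // -muE.
  by apply: le_measure; rewrite ?inE // => x [].
- move=> M; apply: contrapT => nM; apply: g_not_integrable.
  have [C C0 HC] := upper.
  apply: (@integrable_of_tails _ _ _ _ _ _ (C * M)) => //; first by rewrite muE ltry.
  move=> n; apply: (@le_trans _ _ (C * partial_sum return_tail n)).
    by rewrite /partial_sum mulr_sumr; apply: ler_sum_nat => s _; exact: HC.
  by rewrite ler_wpM2l // leNgt; apply/negP => /ltW H; apply: nM; exists n.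
- have := tail_summable; set S := (\sum_(1 <= n <oo) _)%E => S1.
  have term0 n : (0 <= (n%:R * fine (mu (return_gt R T E n)) ^+ 2
      / wandering_rate mu T E n ^+ 2)%:E)%E.
    by rewrite lee_fin; exact: divr_ge0 (mulr_ge0 (ler0n _ _) (sqr_ge0 _)) (sqr_ge0 _).
  have S0 : (0 <= S)%E by apply: nneseries_ge0.
  have SE : S \is a fin_num by rewrite ge0_fin_numE.
  exists (fine S) => n; rewrite -lee_fin fineK // -sumEFin.
  exact: nneseries_lim_ge.
Qed.

End ReturnTails.

(** * The theorem *)

Theorem theorem3p1 (d : measure_display) (X : measurableType d) (R : realType)
    (mu : {measure set X -> \bar R}) (T : X -> X) (E : set X)
    (PE : set (set X)) (g : X -> R) (kappa c : R)
    (mu_sigma_finite : sigma_finite setT mu)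
    (mu_infinite : mu setT = +oo%E)
    (T_measure_preserving : measure_preserving mu T)
    (T_ergodic : ergodic mu T)
    (T_conservative : conservative mu T)
    (E_rapid_psi_mixing : rapid_psi_mixing mu T E PE)
    (g_measurable : measurable_fun setT g)
    (g_ge0 : forall x : X, 0 <= g x)
    (tail_summable :
      (\sum_(1 <= n <oo)
         (n%:R * fine (mu (return_gt R T E n)) ^+ 2
           / wandering_rate mu T E n ^+ 2)%:E < +oo)%E)
    (wandering_rate_slow : slowly_varying (wandering_rate mu T E))
    (kappa_gt0 : 0 < kappa)
    (g_tail : asymp_equiv (fun n : nat => fine (mu [set x | n%:R < g x]))
                (fun n : nat => kappa * fine (mu (return_gt R T E n))))
    (g_constant_PE : constant_on_partition PE g)
    (g_not_integrable : ~ mu.-integrable E (EFin \o g))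
    (g_outside : forall x : X, ~ E x -> g x = c) :
  let m := longest_excursion T E in
  [/\ {ae mu, forall x : X,
        (birkhoff_sum T g (N + m N x) x - birkhoff_max T g (N + m N x) x
           - c * (m N x)%:R) / N%:R @[N --> \oo] --> c + kappa},
      {ae mu, forall x : X,
        limn_esup (fun N : nat =>
          (birkhoff_max T g (N + m N x) x / N%:R)%:E) = +oo%E /\
        limn_esup (fun N : nat => ((m N x)%:R / N%:R : R)%:E) = +oo%E} &
      double_asymp
        (fun N M : nat =>
          fine (mu ([set x | N%:R < g x] `&` return_gt R T E M)))
        (fun N : nat => fine (mu [set x | N%:R < g x]))
        (fun M : nat => fine (mu (return_gt R T E M))) ->
      {ae mu, forall x : X,
        (birkhoff_sum T g (N + m N x) x
           - Num.max (birkhoff_max T g (N + m N x) x) (c * (m N x)%:R))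
          / N%:R @[N --> \oo] --> c + kappa}].
Proof.
have [[mE muE] _ [[cPE mPE partPE _] finPE _] mixPE] := E_rapid_psi_mixing.
have mpT := T_measure_preserving.
have kappa_ge0 := ltW kappa_gt0.
have c_ge0 : 0 <= c.
  have [[x nEx]|allE] := pselect (exists x, ~ E x).
    by rewrite -(g_outside x nEx).
  have ET : E = setT.
    by apply/seteqP; split=> // x _; apply: contrapT => nEx; apply: allE; exists x.
  by move: mu_infinite; rewrite -ET muE.
have [code [mcode code_const code_block]] := partition_code_exists cPE mPE partPE.
have [fr fr_return] := return_code_exists code_block finPE.
have [fg fg_ceil] := observable_code_exists code_block g_ge0 g_constant_PE.
have [psi_cvg psi_series] := mixPE (fun _ x => (code x)%:R)
  (fun _ _ A PA x y Ax Ay => congr1 (fun v : nat => v%:R : R) (code_const A x y PA Ax Ay)).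
have mp := code_process_mixing mpT T_conservative mE muE mcode psi_series.
have psi_sum := code_psi_sum muE psi_series.
have psi_small := code_psi_small muE psi_cvg.
set P := mrestr mu mE in mp; set Z := code_process R T E code in mp.
set psi := code_psi mu T E code in mp psi_sum psi_small.
have rt : regular_tail (return_tail mu T E).
  exact: (return_tail_regular mpT mE muE g_measurable g_ge0 tail_summable kappa_gt0
    g_tail g_not_integrable g_outside).
have equiv : forall e : R, 0 < e -> \forall s \near \oo,
    `|observable_tail mu E g s - kappa * return_tail mu T E s| <=
    e * return_tail mu T E s.
  exact: (observable_tail_equiv mpT mE muE kappa_gt0 g_tail g_outside).
have [b Hb] := inverse_scale_exists rt.
have frT s : code_tail P Z fr s = return_tail mu T E s.
  have := return_code_tail mpT mE mcode fr_return setT s.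
  rewrite preimage_setT setIT setTI setIidr; last by move=> x [].
  by rewrite /return_tail => ->; exact: pr_code.
have fgT s : code_tail P Z fg s = observable_tail mu E g s.
  have -> : code_tail P Z fg s = fine (mu (E `&` code @^-1` [set v | (s < fg v)%N])).
    exact: pr_code.
  congr (fine (mu _)); apply/seteqP; split=> x [Ex H]; split=> //;
    exact/(nat_ceil_lt s (fg_ceil x Ex)).
have [C C0 HC] := tail_upper (tail_gt0 rt) kappa_ge0 equiv.
have fgTE : code_tail P Z fg = observable_tail mu E g by apply/funext.
have frTE : code_tail P Z fr = return_tail mu T E by apply/funext.
have fgC s : code_tail P Z fg s <= C * return_tail mu T E s by rewrite fgT.
have b_large := scale_large rt Hb.
have b_next := scale_next rt Hb.
have b_time := time_negligible rt Hb.
have fr_trimmed : {ae P, forall y, forall eps : R, 0 < eps -> \forall n \near \oo,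
    `|(trimmed_sum (fun i => fr (Z i y)) n)%:R - 1 * (b n)%:R| <= eps * (b n)%:R}.
  apply: (trimmed_sum_ae mp rt Hb psi_sum (C := 1)) => //.
    by move=> s; rewrite frT mul1r.
  move=> eps eps0; exists 0 => n; rewrite frTE mul1r subrr normr0 addr0.
  by rewrite mulr_ge0 ?(ltW eps0) ?(L_ge0 rt).
have fg_trimmed : {ae P, forall y, forall eps : R, 0 < eps -> \forall n \near \oo,
    `|(trimmed_sum (fun i => fg (Z i y)) n)%:R - kappa * (b n)%:R| <=
    eps * (b n)%:R}.
  apply: (trimmed_sum_ae mp rt Hb psi_sum C0 kappa_ge0 fgC) => eps eps0.
  by rewrite fgTE; exact: (partial_sum_equivalence (tail_gt0 rt) equiv).
have be_mono s : {homo (fun n => 16 ^ s * b n)%N : i j / (i <= j)%N}.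
  by move=> i j ij; rewrite leq_mul2l (scale_mono rt Hb) ?orbT.
have fr_exceeds : {ae P, forall y, forall s k, exists2 n, (k <= n)%N &
    (16 ^ s * b n < fr (Z n y))%N}.
  apply/ae_foralln => s; apply: (exceed_infinitely_often mp) => //.
  by rewrite frTE; exact: (scale_tail_not_summable rt Hb).
have fg_exceeds : {ae P, forall y, forall s k, exists2 n, (k <= n)%N &
    (16 ^ s * b n < fg (Z n y))%N}.
  apply/ae_foralln => s; apply: (exceed_infinitely_often mp) => //.
  rewrite fgTE => bnd; apply: (scale_tail_not_summable rt Hb (s := s)).
  have k2 : 0 < kappa / 2 by rewrite divr_gt0.
  apply: (@bounded_sums_le _ _ (fun n => 2 / kappa *
      observable_tail mu E g (16 ^ s * b n)%N)).
  - by move=> n; exact: return_tail_ge0.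
  - have [K _ HK] := equiv _ k2.
    have := b_large K; apply: filterS => n Kn.
    have := HK (16 ^ s * b n)%N; rewrite ler_distl => H.
    have /andP[H1 _] := H (leq_trans Kn (leq_pmull _ (expn_gt0 16 s))).
    rewrite mulrAC ler_pdivlMr //; lra.
  - by move=> n; rewrite mulr_ge0 ?divr_ge0 // fine_ge0.
  - by apply: bounded_sumsZ => //; rewrite divr_ge0.
pose typical y := [/\
  forall eps : R, 0 < eps -> \forall n \near \oo,
    `|(trimmed_sum (fun i => fr (Z i y)) n)%:R - 1 * (b n)%:R| <= eps * (b n)%:R,
  forall eps : R, 0 < eps -> \forall n \near \oo,
    `|(trimmed_sum (fun i => fg (Z i y)) n)%:R - kappa * (b n)%:R| <=
    eps * (b n)%:R,
  forall s k, exists2 n, (k <= n)%N & (16 ^ s * b n < fr (Z n y))%N &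
  forall s k, exists2 n, (k <= n)%N & (16 ^ s * b n < fg (Z n y))%N].
have typical_ae : {ae P, forall y, typical y}.
  by near=> y; split; near: y.
(* What holds almost surely on E for the coded visits holds for almost every
   orbit, from the first point of the orbit in E on. *)
have core (Q : X -> Prop) : {ae P, forall y, Q y} ->
    {ae mu, forall x, exists e : nat, let y := iter e T x in
      [/\ Q y, forall n, (0 < fr (Z n y))%N,
        forall s, E (iter s T x) <->
          exists n, s = visit_time e (fun i => fr (Z i y)) n &
        forall n, g (iter (visit_time e (fun i => fr (Z i y)) n) T x) <=
          (fg (Z n y))%:R < g (iter (visit_time e (fun i => fr (Z i y)) n) T x) + 1]}.
  move=> QP.
  have vis := ae_visits mpT mE T_conservative T_ergodic
    (eq_ind_r (fun z => (0 < z)%E) lte01 muE).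
  have Q' := ae_mrestr QP.
  have ret := ae_iter_induced mpT T_conservative mE muE fr_return.
  have pull (Q1 : X -> Prop) : {ae mu, forall x, Q1 x} ->
      {ae mu, forall x, forall n, Q1 (iter n T x)}.
    move=> Q1ae; apply/ae_foralln => n.
    exact: (iter_preimage_negligible mpT n Q1ae).
  have {Q' ret} : {ae mu, forall y, E y -> Q y /\ forall n,
      first_return R T E (iter n (induced_map R T E) y) =
      ((fr (code (iter n (induced_map R T E) y)))%:R)%:E}.
    by apply: filterS2 Q' ret => y H1 H2 Ey; split; [exact: H1|exact: H2].
  move=> /pull H; near=> x.
  have xvis : visits_infinitely_often T E x by near: x.
  have xE n : E (iter n T x) -> Q (iter n T x) /\
      forall k, first_return R T E (iter k (induced_map R T E) (iter n T x)) =
      ((fr (code (iter k (induced_map R T E) (iter n T x))))%:R)%:E.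
    by move: n; near: x.
  have ex : exists e, `[< E (iter e T x) >].
    by have [e _ Ee] := xvis 0%N; exists e; apply/asboolP.
  case: (ex_minnP ex) => e /asboolP Ee emin; exists e => /=.
  have [Qy rety] := xE e Ee.
  have before s : (s < e)%N -> ~ E (iter s T x).
    by move=> se Es; have := emin s (asboolT Es); lia.
  have visy : visits_infinitely_often T E (iter e T x).
    move=> n; have [l nl El] := xvis (n + e)%N; exists (l - e)%N; first by lia.
    by rewrite -iterD subnK //; lia.
  have [itE p0 visits] := orbit_visits Ee before visy
    (p := fun i => fr (Z i (iter e T x)))
    (fun n => etrans (rety n) (congr1 (fun v => ((fr v)%:R)%:E)
       (esym (code_processE R T code n Ee)))).
  split=> // n; rewrite -itE /Z code_processE //.
  by apply: fg_ceil; exact: iter_induced_E.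
have core_typical := core _ typical_ae.
split.
- apply: filterS core_typical => x [e [[H1 H2 H3 H4] p0 visits ceil]].
  exact: (trimmed_orbit_limit p0 visits b_large b_next H1 H3 g_outside c_ge0
    ceil kappa_ge0 b_time H2).
- apply: filterS core_typical => x [e [[H1 H2 H3 H4] p0 visits ceil]]; split.
    exact: (birkhoff_max_limsup p0 visits b_large b_next H1 H3 g_outside
      c_ge0 ceil H4).
  exact: (longest_excursion_limsup p0 visits b_large b_next H1 H3).
- move=> [D [N0 [D0 HD]]].
  have fr_fg : {ae P, forall y, forall eps : R, 0 < eps -> \forall n \near \oo,
     (minn (\max_(i < n) fr (Z i y)) (\max_(i < n) fg (Z i y)))%:R <=
     eps * (b n)%:R}.
    have [u1 _ Hu1] := observable_tailE mu g_outside.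
    apply: (common_max_ae mp rt Hb (u0 := maxn N0 u1) (C := 1 + C) (D := D)).
    + by rewrite addr_ge0.
    + exact: ltW.
    + move=> s; rewrite frT mulrDl mul1r lerDl.
      by rewrite mulr_ge0 // return_tail_ge0.
    + move=> s; apply: le_trans (fgC s) _; rewrite mulrDl mul1r lerDr.
      exact: return_tail_ge0.
    move=> u; rewrite geq_max => /andP[Nu uu].
    have [H _] := HD u u Nu Nu.
    have -> : pr P [set x | (u < fr (Z 0%N x))%N /\ (u < fg (Z 0%N x))%N] =
        fine (mu ([set x | u%:R < g x] `&` return_gt R T E u)).
      have := return_code_tail mpT mE mcode fr_return [set v | (u < fg v)%N] u.
      have -> : E `&` code @^-1` [set v | (u < fg v)%N] `&` return_gt R T E u =
          [set x | u%:R < g x] `&` return_gt R T E u.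
        apply/seteqP; split=> x [].
          by move=> [Ex /(nat_ceil_lt u (fg_ceil x Ex)) ?] ?.
        move=> gu [Ex xu]; split=> //; split=> //.
        exact/(nat_ceil_lt u (fg_ceil x Ex)).
      move=> ->; rewrite -(pr_code mu T mE); congr (pr P _).
      by apply/seteqP; split=> x [].
    have gE : fine (mu [set x | u%:R < g x]) = code_tail P Z fg u.
      by rewrite fgT -Hu1.
    move: H; rewrite gE -[fine (mu (return_gt R T E u))]/(return_tail mu T E u).
    rewrite -frT => H; rewrite -(ler_pM2l (_ : 0 < D^-1)) ?invr_gt0 //.
    by rewrite [leRHS]mulrA mulVf ?gt_eqF // mul1r [leRHS]mulrC.
  have joint : {ae P, forall y, typical y /\ forall eps : R, 0 < eps ->
      \forall n \near \oo,
      (minn (\max_(i < n) fr (Z i y)) (\max_(i < n) fg (Z i y)))%:R <=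
      eps * (b n)%:R}.
    by near=> y; split; near: y.
  apply: filterS (core _ joint) => x [e [[[H1 H2 H3 H4] H5] p0 visits ceil]].
  exact: (joint_trimmed_orbit_limit p0 visits b_large b_next H1 H3 g_outside
    c_ge0 ceil kappa_ge0 b_time H2 g_ge0 H5).
Unshelve. all: by end_near. Qed.
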